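(* Let $f_0:\mathbb{C}\to\hat{\mathbb{C}}$ be a transcendental meromorphic function of finite order $\rho>0$ satisfying: (KU1) $\infty$ is not an asymptotic value of $f_0$; (KU2) there exist a co-finite subset $\mathcal{P}^*$ of the set $\mathcal{P}$ of poles and $R^*>0$ with $\mathrm{dist}(\mathrm{Sing}(f_0^{-1}),a)>2R^*$ for all $a\in\mathcal{P}^*$; (KU3) there is $R^\dagger>0$ with $B(a_1,R^\dagger)\cap B(a_2,R^\dagger)=\emptyset$ for distinct poles; (KU4) there exist $M\in\mathbb{N}$, $\beta\geq0$ such that for each $a\in\mathcal{P}^*$, $1\leq m(a)\leq M$ and $|f_0(z)|\asymp|a|^{-\beta}|z-a|^{-m(a)}$, $|f_0'(z)|\asymp m(a)|a|^{-\beta}|z-a|^{-m(a)-1}$ for $z\in B(a,R^\dagger)$. Then there is $\varepsilon>0$ such that if $|c_n|<\varepsilon$ for all $n$, then $$\frac{\rho M^*}{\beta+M^*+1}\leq\mathrm{EHD}(F_+)\leq\mathrm{ED}(F_+)\leq\frac{\rho M}{\beta+M+1}.$$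
   Context: $m(a)$ is pole multiplicity; $\mathrm{Sing}(f^{-1})$ the finite critical and asymptotic values; $A\asymp B$ means $C^{-1}A\leq B\leq CA$, $C\geq1$ independent of $a,z$. $M^*$ is the largest integer $1\leq M^*\leq M$ such that $\sum_{a\in\mathcal{P},m(a)=M^*}|a|^{-t}$ converges for $t>\rho$ and diverges for $t<\rho$. $f_n=f_0+c_n$, $F_+^n=f_n\circ\dots\circ f_1$. $\mathcal{J}(F_+)$ is the complement of the set of points with a neighborhood on which all $F_+^n$ are defined and normal; $\mathcal{J}_r(F_+)$ is the set of $z\in\mathcal{J}(F_+)$ with all $F_+^n(z)$ defined and some $\delta>0$ such that for infinitely many $n$, $B(F_+^n(z),\delta)$ pulls back univalently along the orbit of $z$. $\mathrm{ED}(F)=\lim_{R\to\infty}\mathrm{HD}\{z\in\mathcal{J}(F):|F^n(z)|>R\ \forall n\geq1\}$, $\mathrm{EHD}(F)=\lim_{R\to\infty}\mathrm{HD}\{z\in\mathcal{J}_r(F):|F^n(z)|>R\ \forall n\geq1\}$. *)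

(* Defs.v *)
From HB Require Import structures.
From mathcomp Require Import all_boot all_order all_algebra.
From mathcomp Require Import all_classical all_reals all_analysis.
From mathcomp Require Import complex.
Import Order.TTheory GRing.Theory Num.Theory.
Import numFieldNormedType.Exports.

Set Implicit Arguments.
Unset Strict Implicit.
Unset Printing Implicit Defensive.

Local Open Scope classical_set_scope.
Local Open Scope ring_scope.

Section Defs.
Variable R : realType.
Local Notation C := (R[i]).

Definition cabs (z : C) : R := Num.sqrt (complex.Re z ^+ 2 + complex.Im z ^+ 2).
Definition cball (a : C) (r : R) : set C := [set z | cabs (z - a) < r].
Definition copen (U : set C) : Prop :=
  forall z, U z -> exists r, 0 < r /\ cball z r `<=` U.

(** ** Functions into the Riemann sphere  C^ = option C  (None = infinity) *)
(* finite part of a map into the sphere (value at infinity irrelevant) *)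
Definition fv (f : C -> option C) : C^o -> C^o := fun z => odflt 0 (f z).
Definition cderiv (g : C^o -> C^o) (z : C) : C := 'D_1 g z.
Definition holo_on (g : C^o -> C^o) (U : set C) : Prop :=
  forall z, U z -> derivable g z 1.

Definition pole_of_order (f : C -> option C) (a : C) (m : nat) : Prop :=
  (0 < m)%N /\ f a = None /\
  exists r, 0 < r /\ exists g : C^o -> C^o,
    holo_on g (cball a r) /\ g a != 0 /\
    forall z, cball a r z -> z != a -> f z = Some (g z / (z - a) ^+ m).

Definition meromorphic (f : C -> option C) : Prop :=
  forall a, (exists r, 0 < r /\ forall z, cball a r z ->
                 f z <> None /\ derivable (fv f) z 1)
            \/ (exists m, pole_of_order f a m).

Definition poles (f : C -> option C) : set C := [set a | f a = None].
Definition mult (f : C -> option C) (a : C) : nat := xget 0%N [set m | pole_of_order f a m].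

Definition rational_fun (f : C -> option C) : Prop :=
  exists p q : {poly C}, q != 0 /\ forall z, q.[z] != 0 -> f z = Some (p.[z] / q.[z]).
Definition transcendental (f : C -> option C) : Prop := ~ rational_fun f.

Definition npoles (f : C -> option C) (t : R) : nat :=
  (\sum_(a \in [set a | f a = None /\ (cabs a <= t)%R]) mult f a)%N.
Definition circ (r th : R) : C := Complex (r * cos th) (r * sin th).
Definition logplus (v : option C) : \bar R :=
  if v is Some w then (Num.max 0 (ln (cabs w)))%:E else +oo%E.
Definition prox (f : C -> option C) (r : R) : \bar R :=
  ((2 * pi)^-1)%:E * (\int[@lebesgue_measure R]_(th in `[0%R, (2 * pi)%R]%classic)
                         logplus (f (circ r th)))%E.
Definition count_fn (f : C -> option C) (r : R) : \bar R :=
  ((\int[@lebesgue_measure R]_(t in `[0%R, r]%classic)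
       (((npoles f t - npoles f 0)%N%:R / t)%:E))
   + ((npoles f 0)%:R * ln r)%:E)%E.
Definition nev_T (f : C -> option C) (r : R) : \bar R := (prox f r + count_fn f r)%E.
Definition has_order (f : C -> option C) (rho : R) : Prop :=
  limf_esup (fun r : R => (ln (fine (nev_T f r)) / ln r)%:E) (pinfty_nbhs R) = rho%:E.

Definition crit_values (f : C -> option C) : set C :=
  [set w | exists c, f c = Some w /\ cderiv (fv f) c = 0].
Definition path_to_inf (gam : R -> C) : Prop :=
  continuous (gam : R -> C^o) /\
  forall K : R, exists T : R, forall t, T < t -> K < cabs (gam t).
Definition asym_values (f : C -> option C) : set C :=
  [set w | exists gam, path_to_inf gam /\
     forall e : R, 0 < e -> exists T : R, forall t, T < t ->
        exists v, f (gam t) = Some v /\ cabs (v - w) < e].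
Definition inf_asymptotic_value (f : C -> option C) : Prop :=
  exists gam, path_to_inf gam /\
     forall K : R, exists T : R, forall t, T < t ->
        forall v, f (gam t) = Some v -> K < cabs v.
Definition sing_vals (f : C -> option C) : set C := crit_values f `|` asym_values f.
(* dist(A, a) in the extended reals (+oo for empty A) *)
Definition dist_to (A : set C) (a : C) : \bar R :=
  ereal_inf [set (cabs (w - a))%:E | w in A].

Definition conv_exp_class (f : C -> option C) (rho : R) (k : nat) : Prop :=
  (forall t, rho < t ->
     (\esum_(a in [set a | f a = None /\ mult f a = k]) (cabs a `^ (- t))%:E < +oo)%E) /\
  (forall t, t < rho ->
     (\esum_(a in [set a | f a = None /\ mult f a = k]) (cabs a `^ (- t))%:E = +oo)%E).
Definition is_Mstar (f : C -> option C) (rho : R) (M Ms : nat) : Prop :=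
  [/\ (1 <= Ms <= M)%N, conv_exp_class f rho Ms &
      forall k, (Ms < k <= M)%N -> ~ conv_exp_class f rho k].

Definition fn (f0 : C -> option C) (c : nat -> C) (n : nat) (z : C) : option C :=
  omap (fun w => w + c n) (f0 z).
(* Fit n z = F^n(z) in C^; once infinity is reached the orbit is undefined (None) *)
Fixpoint Fit (f0 : C -> option C) (c : nat -> C) (n : nat) (z : C) : option C :=
  match n with
  | 0%N => Some z
  | k.+1 => if Fit f0 c k z is Some w then fn f0 c k.+1 w else None
  end.
Definition chordal (u v : option C) : R :=
  match u, v with
  | Some z, Some w => 2 * cabs (z - w) / Num.sqrt ((1 + cabs z ^+ 2) * (1 + cabs w ^+ 2))
  | Some z, None | None, Some z => 2 / Num.sqrt (1 + cabs z ^+ 2)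
  | None, None => 0
  end.
Definition all_defined_on f0 c (U : set C) : Prop :=
  forall z, U z -> forall n, Fit f0 c n z <> None.
Definition normal_on f0 c (U : set C) : Prop :=
  forall s : nat -> nat, exists phi : nat -> nat,
    (forall k, (phi k < phi k.+1)%N) /\
    exists g : C -> option C,
      forall z, U z -> exists r, 0 < r /\ cball z r `<=` U /\
        forall e : R, 0 < e -> exists N, forall k, (N <= k)%N ->
          forall w, cball z r w ->
            chordal (Fit f0 c (s (phi k)) w) (g w) < e.
Definition fatou f0 c : set C :=
  [set z | exists r, 0 < r /\ all_defined_on f0 c (cball z r) /\ normal_on f0 c (cball z r)].
Definition julia f0 c : set C := ~` fatou f0 c.
Definition univ_pullback f0 c (z : C) (n : nat) (d : R) : Prop :=
  exists V : set C, [/\ copen V, V z,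
    (forall w, V w -> forall k, (k <= n)%N -> Fit f0 c k w <> None),
    {in V &, injective (fun w => odflt 0 (Fit f0 c n w))} &
    (fun w => odflt 0 (Fit f0 c n w)) @` V = cball (odflt 0 (Fit f0 c n z)) d].
Definition radial_julia f0 c : set C :=
  [set z | julia f0 c z /\ (forall n, Fit f0 c n z <> None) /\
     exists d, 0 < d /\ forall N, exists n, (N <= n)%N /\ univ_pullback f0 c z n d].

Definition cdiam (U : set C) : \bar R :=
  ereal_sup [set (cabs (x.1 - x.2))%:E | x in U `*` U].
Definition hterm (s : R) (U : set C) : \bar R :=
  if asbool (U = set0) then 0%E else ((fine (cdiam U)) `^ s)%:E.
Definition haus_delta (s d : R) (A : set C) : \bar R :=
  ereal_inf [set (\sum_(0 <= i <oo) hterm s (U i))%E | U in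
     [set U : nat -> set C | A `<=` \bigcup_i U i /\ forall i, (cdiam (U i) <= d%:E)%E]].
(* H^s = lim_{delta -> 0} H^s_delta = sup_{delta > 0} H^s_delta *)
Definition hausdorff (s : R) (A : set C) : \bar R :=
  ereal_sup [set haus_delta s d A | d in [set d : R | 0 < d]].
Definition HD (A : set C) : R := inf [set s : R | 0 <= s /\ hausdorff s A = 0%E].

Definition escaping_part (S : set C) f0 c (r : R) : set C :=
  [set z | S z /\ forall n, (0 < n)%N -> exists w, Fit f0 c n z = Some w /\ r < cabs w].
Definition ED f0 c : R := lim (HD (escaping_part (julia f0 c) f0 c r) @[r --> +oo]).
Definition EHD f0 c : R := lim (HD (escaping_part (radial_julia f0 c) f0 c r) @[r --> +oo]).

End Defs.

(* Main.v *)
Require Import Defs.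
From HB Require Import structures.
From mathcomp Require Import all_boot all_order all_algebra.
From mathcomp Require Import finmap.
From mathcomp Require Import all_classical all_reals all_analysis.
From mathcomp Require Import measurable_realfun complex ring lra.
Import Order.TTheory GRing.Theory Num.Theory.
Import numFieldNormedType.Exports.
Set Implicit Arguments.
Unset Strict Implicit.
Unset Printing Implicit Defensive.
Local Open Scope classical_set_scope.
Local Open Scope ring_scope.

(** Upper bound. By (KU1) and a Phragmen-Lindelof argument every point where |f| is
    large lies near a pole. Near a pole [a] of multiplicity [m] the points whose
    image is near a pole [a'] fall into boundedly many pieces, on each of which [f]
    expands by at least a constant times |a|^(beta/m) |a'|^(1+1/m). Finite order
    makes the sum of |a|^(-tau) over the poles converge for [tau > rho], so iterating
    these covers shows that the escaping set is null for [H^t] as soon as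
    [t (beta + M + 1) / M > rho].

    Lower bound. Take finitely many large poles of multiplicity [m] = M^* with
    sum_a (kappa |a|^(-(beta+m+1)/m))^s >= 1. The inverse branches of f_n between
    discs around these poles are contractions, and every word over the poles codes a
    point of the radial Julia set whose orbit stays large. Two coded points are
    separated by the product of the numbers kappa |a|^(-(beta+m+1)/m) along their
    common prefix, so comparison with the product measure of weights
    (kappa |a|^(-(beta+m+1)/m))^s shows that [H^s] of this set is not zero. *)

(** * Modulus and complex derivative *)

(** The function theory rests on Goursat's theorem alone: constants lost in integral bounds are
    removed by taking powers, and zeros are produced by the minimum principle. The local constants
    depend on [K], [M] and [Rdag] but not on the pole. On a disc of radius [eta] times |z0 - a| the
    map deviates from its linear part by at most half, which gives injectivity and expansion with no
    monodromy argument. Since [f] is many-to-one around a pole, the upper bound sorts points into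
    cells of this relative size instead of choosing branches. The one-step factor |a|^(beta/m)
    |a'|^(1+1/m) mixes two consecutive poles. Along an orbit it regroups into |a|^((beta+m+1)/m) for
    each pole, up to end factors: this is the source of beta+m+1. Expansion is weakest for the
    largest m, so [M] governs the covers, while the lower bound may use any multiplicity whose poles
    already have a divergent series below [rho]. The shifts enter only through |c n| < 1, which is
    negligible against the moduli involved, so [eps = 1] serves. *)

Section ComplexModulus.
Variable R : realType.
Local Notation C := (R[i]).
Implicit Types (z w : C) (x y : R).

Lemma normE z : `|z| = (cabs z)%:C%C.
Proof. by rewrite normc_def. Qed.

Lemma cabs_ge0 z : 0 <= cabs z. Proof. exact: sqrtr_ge0. Qed.

Lemma cabsM z w : cabs (z * w) = cabs z * cabs w.
Proof. by apply: complexI; rewrite rmorphM /= -!normE normrM. Qed.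

Lemma cabsD z w : cabs (z + w) <= cabs z + cabs w.
Proof. by rewrite -lecR rmorphD /= -!normE ler_normD. Qed.

Lemma cabsN z : cabs (- z) = cabs z.
Proof. by apply: complexI; rewrite -!normE normrN. Qed.

Lemma cabsBC z w : cabs (z - w) = cabs (w - z).
Proof. by rewrite -cabsN opprB. Qed.

Lemma cabsV z : cabs z^-1 = (cabs z)^-1.
Proof. by apply: complexI; rewrite fmorphV /= -!normE normfV. Qed.

Lemma cabsX z n : cabs (z ^+ n) = cabs z ^+ n.
Proof. by apply: complexI; rewrite rmorphXn /= -!normE normrX. Qed.

Lemma cabs0 : cabs (0 : C) = 0.
Proof. by apply: complexI; rewrite -normE normr0. Qed.

Lemma cabs1 : cabs (1 : C) = 1.
Proof. by apply: complexI; rewrite -normE normr1. Qed.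

Lemma cabs_eq0 z : (cabs z == 0) = (z == 0).
Proof.
rewrite -(normr_eq0 z) normE; apply/eqP/eqP => [->//|h]; exact: (complexI h).
Qed.

Lemma cabs_gt0 z : (0 < cabs z) = (z != 0).
Proof. by rewrite lt_def cabs_ge0 andbT cabs_eq0. Qed.

Lemma cabsr x : cabs (x%:C%C : C) = `|x|.
Proof. by rewrite /cabs /= expr0n /= addr0 sqrtr_sqr. Qed.

Lemma cabs_tri z w u : cabs (z - u) <= cabs (z - w) + cabs (w - u).
Proof. by rewrite (_ : z - u = (z - w) + (w - u)) ?cabsD//; ring. Qed.

Lemma cabsB_ge z w : cabs z - cabs w <= cabs (z - w).
Proof. by rewrite lerBlDr (le_trans _ (cabsD _ _))// subrK. Qed.

Lemma cabsB_le z w : cabs (z - w) <= cabs z + cabs w.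
Proof. by rewrite (le_trans (cabsD _ _))// cabsN. Qed.

Lemma Re_le_cabs z : `|complex.Re z| <= cabs z.
Proof.
by rewrite -(sqrtr_sqr (complex.Re z)) /cabs ler_wsqrtr// lerDl sqr_ge0.
Qed.

Lemma Im_le_cabs z : `|complex.Im z| <= cabs z.
Proof.
by rewrite -(sqrtr_sqr (complex.Im z)) /cabs ler_wsqrtr// lerDr sqr_ge0.
Qed.

Lemma cabs_le_ReIm z : cabs z <= `|complex.Re z| + `|complex.Im z|.
Proof.
rewrite -[leRHS]ger0_norm ?addr_ge0// -[leRHS]sqrtr_sqr /cabs ler_wsqrtr// sqrrD !real_normK ?num_real//.
by rewrite -addrA [X in _ <= _ + X]addrC addrA lerDl mulrn_wge0// mulr_ge0.
Qed.

Definition ccont (g : C -> C) z := forall e : R, 0 < e ->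
  exists d, 0 < d /\ forall w, cabs (w - z) < d -> cabs (g w - g z) < e.

(** Derivative in additive form with real epsilons: there is no quotient, so [w = z] is allowed, and
    estimates stay within real arithmetic. [has_cdP] ties it to [is_derive]. *)
Definition has_cd (g : C -> C) z (l : C) := forall e : R, 0 < e ->
  exists d, 0 < d /\ forall w, cabs (w - z) < d ->
    cabs (g w - g z - l * (w - z)) <= e * cabs (w - z).

Lemma ltC_split (e : C) : 0 < e -> exists2 r : R, 0 < r & e = r%:C%C.
Proof.
case: e => a b; rewrite ltcE /= => /andP[/eqP -> ?]; by exists a.
Qed.

Lemma ccontP (g : C -> C) z :
  ccont g z <-> {for z, continuous (g : C^o -> C^o)}.
Proof.
rewrite /prop_for /continuous_at; split=> [h|h e e0].
  apply/(@cvgrPdist_lt _ C^o _ _ (nbhs_filter (z : C^o))) => e.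
  move=> /ltC_split[r r0 ->].
  have [d [d0 H]] := h _ r0.
  rewrite near_simpl; apply/nbhs_ballP; exists d%:C%C => /=; first by rewrite ltcR.
  move=> w; rewrite /ball /= => hw; rewrite normE ltcR cabsBC; apply: H.
  by move: hw; rewrite normE ltcR cabsBC.
have /(@cvgrPdist_lt _ C^o _ _ (nbhs_filter (z : C^o))) /(_ e%:C%C) := h; rewrite ltcR => /(_ e0).
rewrite near_simpl => /nbhs_ballP[_ /ltC_split[r r0 ->]] H.
exists r; split=> // w wz.
have := H w; rewrite /ball /= !normE !ltcR (cabsBC z w) (cabsBC (g z)).
exact.
Qed.

Lemma has_cdP (g : C -> C) z l :
  has_cd g z l <-> is_derive (z : C^o) (1 : C^o) (g : C^o -> C^o) l.
Proof.
split=> [h|[+ <-]].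
  have : (fun k : C^o => k^-1 *: ((g (k *: (1:C^o) + z) : C^o) - g z)) @ (0:C^o)^' --> (l : C^o).
    apply/(@cvgrPdist_lt _ C^o) => e /ltC_split[r r0 ->].
    have [|d [d0 H]] := h (r / 2); first by lra.
    apply/nbhs_ballP; exists d%:C%C => /=; first by rewrite ltcR.
    move=> k; rewrite /ball /= sub0r normrN normE ltcR => kd k0.
    rewrite normE ltcR cabsBC.
    have := H (k + z); rewrite addrK => /(_ kd) hk.
    have k0' : 0 < cabs k by rewrite cabs_gt0.
    rewrite -(ltr_pM2l k0') -cabsM.
    rewrite (_ : k * _ = g (k + z) - g z - l * k); last first.
      rewrite mulrBr; congr (_ - _); last by rewrite mulrC.
      change (k * (k^-1 * (g (k * 1 + z) - g z)) = g (k + z) - g z).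
      by rewrite mulrA mulfV// mul1r mulr1.
    apply: (le_lt_trans hk); rewrite mulrC ltr_pM2l//; lra.
  move=> H; split; first by apply/cvg_ex; exists l.
  by rewrite /derive; apply/cvg_lim => //; exact: norm_hausdorff.
move=> dg e e0.
have /(@cvgrPdist_lt _ C^o) /(_ e%:C%C) : (fun k : C^o => k^-1 *: ((g (k *: (1:C^o) + z) : C^o) - g z)) @ (0:C^o)^' --> ('D_1 (g : C^o -> C^o) z : C^o) by exact: dg.
rewrite ltcR => /(_ e0).
move=> /nbhs_ballP[_ /ltC_split[r r0 ->]] H.
exists r; split=> // w wz.
have [->|wz0] := eqVneq w z; first by rewrite !subrr mulr0 subr0 cabs0 mulr0.
have k0' : 0 < cabs (w - z) by rewrite cabs_gt0 subr_eq0.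
have := H (w - z); rewrite /ball /= sub0r normrN !normE !ltcR => /(_ wz).
rewrite subr_eq0 => /(_ wz0) hk; apply: ltW; move: hk.
rewrite (cabsBC ('D_1 (g : C^o -> C^o) z)) -(ltr_pM2l k0') -cabsM [_ * e]mulrC.
rewrite [(w - z) * _](_ : _ =
  g w - g z - 'D_1 (g : C^o -> C^o) z * (w - z)); first exact.
rewrite mulrBr; congr (_ - _); last by rewrite mulrC.
change ((w - z) * ((w - z)^-1 * (g ((w - z) * 1 + z) - g z)) = g w - g z).
by rewrite mulrA mulfV ?subr_eq0// mul1r mulr1 subrK.
Qed.

Lemma derivable_has_cd (g : C -> C) z :
  derivable (g : C^o -> C^o) z 1 -> has_cd g z (cderiv g z).
Proof. by move=> dg; apply/has_cdP; exact: derivableP. Qed.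

Lemma has_cd_derivable (g : C -> C) z l :
  has_cd g z l -> derivable (g : C^o -> C^o) z 1 /\ cderiv g z = l.
Proof. by move=> /has_cdP[d <-]. Qed.

Lemma has_cd_ccont (g : C -> C) z l : has_cd g z l -> ccont g z.
Proof.
move=> /has_cdP[/derivable1_diffP/differentiable_continuous h _].
by apply/ccontP.
Qed.

Lemma has_cd_cst (a : C) z : has_cd (fun _ => a) z 0.
Proof. by apply/has_cdP; exact: is_derive_cst. Qed.

Lemma has_cd_id z : has_cd (fun w => w) z 1.
Proof. by apply/has_cdP; exact: is_derive_id. Qed.

Lemma has_cdD (g h : C -> C) z l k : has_cd g z l -> has_cd h z k ->
  has_cd (fun w => g w + h w) z (l + k).
Proof. by move=> /has_cdP ? /has_cdP ?; apply/has_cdP; exact: is_deriveD. Qed.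

Lemma has_cdB (g h : C -> C) z l k : has_cd g z l -> has_cd h z k ->
  has_cd (fun w => g w - h w) z (l - k).
Proof. by move=> /has_cdP ? /has_cdP ?; apply/has_cdP; exact: is_deriveB. Qed.

Lemma has_cdM (g h : C -> C) z l k : has_cd g z l -> has_cd h z k ->
  has_cd (fun w => g w * h w) z (l * h z + g z * k).
Proof.
move=> /has_cdP dg /has_cdP dh; apply/has_cdP.
apply: (is_derive_eq (is_deriveM dg dh)).
by rewrite addrC [l * _]mulrC.
Qed.

Lemma has_cdX (g : C -> C) z l n : has_cd g z l ->
  has_cd (fun w => g w ^+ n) z (n%:R * g z ^+ n.-1 * l).
Proof.
case: n => [_|n].
  by rewrite !mul0r; apply: has_cd_cst.
elim: n => [h|n IH h]; first by rewrite expr0 !mul1r.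
have := has_cdM h (IH h).
rewrite (_ : l * _ + _ = n.+2%:R * g z ^+ n.+2.-1 * l) => [|/=]; last first.
  by rewrite -[n.+2%:R]natr1 exprS; ring.
congr has_cd; by apply/funext => w; rewrite [RHS]exprS.
Qed.

Lemma has_cdV (g : C -> C) z l : g z != 0 -> has_cd g z l ->
  has_cd (fun w => (g w)^-1) z (- l / g z ^+ 2).
Proof.
move=> g0 /has_cdP dg; apply/has_cdP.
have dg' : derivable (g : C^o -> C^o) z 1 by case: dg.
split; first by apply: derivableV.
have /= -> := deriveV g0 dg'; case: dg => _ ->.
by rewrite mulrC mulrN -mulNr.
Qed.

Lemma has_cd_ext (g h : C -> C) z l r : 0 < r ->
  (forall w, cabs (w - z) < r -> g w = h w) -> has_cd g z l -> has_cd h z l.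
Proof.
move=> r0 gh dg e e0; have [d [d0 H]] := dg e e0.
exists (Num.min d r); split=> [|w]; first by rewrite lt_min d0.
by rewrite lt_min => /andP[wd wr]; rewrite -!gh ?subrr ?cabs0//; exact: H.
Qed.

Lemma ccont_ext (g h : C -> C) z r : 0 < r ->
  (forall w, cabs (w - z) < r -> g w = h w) -> ccont g z -> ccont h z.
Proof.
move=> r0 gh dg e e0; have [d [d0 H]] := dg e e0.
exists (Num.min d r); split=> [|w]; first by rewrite lt_min d0.
by rewrite lt_min => /andP[wd wr]; rewrite -!gh ?subrr ?cabs0//; exact: H.
Qed.

Lemma ccont_cst (a : C) z : ccont (fun _ => a) z.
Proof. exact: has_cd_ccont (has_cd_cst _ _). Qed.

Lemma ccont_id z : ccont (fun w => w) z.
Proof. exact: has_cd_ccont (has_cd_id _). Qed.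

Lemma ccontD (g h : C -> C) z : ccont g z -> ccont h z ->
  ccont (fun w => g w + h w) z.
Proof.
move=> cg ch e e0; have [|d [d0 Hd]] := cg (e / 2); first by lra.
have [|r [r0 Hr]] := ch (e / 2); first by lra.
exists (Num.min d r); split=> [|w]; first by rewrite lt_min d0.
rewrite lt_min => /andP[/Hd h1 /Hr h2].
rewrite (_ : _ - _ = (g w - g z) + (h w - h z)); last by ring.
by rewrite (le_lt_trans (cabsD _ _))//; lra.
Qed.

Lemma ccontB (g h : C -> C) z : ccont g z -> ccont h z ->
  ccont (fun w => g w - h w) z.
Proof.
move=> cg ch; have cN : ccont (fun w => - h w) z.
  move=> e /ch[d [d0 Hd]]; exists d; split=> // w /Hd.
  by rewrite -cabsN opprB addrC opprK.
exact: ccontD cg cN.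
Qed.

Lemma ccontM (g h : C -> C) z : ccont g z -> ccont h z ->
  ccont (fun w => g w * h w) z.
Proof.
move=> cg ch e e0; set A := cabs (g z) + 1; set B := cabs (h z) + 1.
have A0 : 0 < A by rewrite ltr_wpDl ?cabs_ge0.
have B0 : 0 < B by rewrite ltr_wpDl ?cabs_ge0.
have [|d1 [d10 H1]] := cg 1; first by lra.
have [|d [d0 Hd]] := cg (e / 2 / B); first by rewrite !divr_gt0.
have [|r [r0 Hr]] := ch (e / 2 / A); first by rewrite !divr_gt0.
exists (Num.min d1 (Num.min d r)); split=> [|w].
  by rewrite !lt_min d0 d10.
rewrite !lt_min => /and3P[/H1 h1 /Hd h2 /Hr h3].
rewrite (_ : _ - _ = (g w - g z) * h z + g w * (h w - h z)); last by ring.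
rewrite (le_lt_trans (cabsD _ _))// !cabsM (splitr e) ltr_leD//.
  rewrite (@le_lt_trans _ _ (cabs (g w - g z) * B))// -?ltr_pdivlMr//.
  by rewrite ler_wpM2l ?cabs_ge0// lerDl.
rewrite (@le_trans _ _ (A * cabs (h w - h z)))//.
  rewrite ler_wpM2r ?cabs_ge0// /A -lerBlDl.
  by rewrite (le_trans (cabsB_ge _ _)) ?ltW.
by rewrite mulrC -ler_pdivlMr// ltW.
Qed.

Lemma ccontX (g : C -> C) z n : ccont g z -> ccont (fun w => g w ^+ n) z.
Proof.
move=> h; elim: n => [|n IH]; first by exact: ccont_cst.
have := ccontM h IH; congr ccont; by apply/funext => w; rewrite exprS.
Qed.

Lemma ccontV (g : C -> C) z : g z != 0 -> ccont g z ->
  ccont (fun w => (g w)^-1) z.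
Proof. by move=> g0 /ccontP ?; apply/ccontP; apply: continuousV. Qed.

End ComplexModulus.

(** * Bisection *)

Section RectangleInduction.
Variable R : realType.
Local Notation C := (R[i]).

Definition rect (x y w v : R) : set C :=
  [set z | x <= complex.Re z <= x + w /\ y <= complex.Im z <= y + v].

Lemma nested_point (s w : nat -> R) : (forall n, 0 <= w n) ->
  (forall n, s n <= s n.+1 /\ s n.+1 + w n.+1 <= s n + w n) ->
  exists p, forall n, s n <= p <= s n + w n.
Proof.
move=> w0 hs.
have up n k : s n <= s (n + k)%N.
  elim: k => [|k IH]; first by rewrite addn0.
  by rewrite addnS (le_trans IH)//; case: (hs (n + k)%N).
have dn n k : s (n + k)%N + w (n + k)%N <= s n + w n.
  elim: k => [|k IH]; first by rewrite addn0.
  by rewrite addnS (le_trans _ IH)//; case: (hs (n + k)%N).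
have ub n m : s m <= s n + w n.
  apply: (@le_trans _ _ (s (maxn m n))).
    by have := up m (maxn m n - m)%N; rewrite subnKC ?leq_maxl.
  apply: (@le_trans _ _ (s (maxn m n) + w (maxn m n))); first by rewrite lerDl.
  by have := dn n (maxn m n - n)%N; rewrite subnKC ?leq_maxr.
exists (sup (range s)) => n; apply/andP; split.
  apply: ub_le_sup; last by exists n.
  by exists (s 0%N + w 0%N) => _ [m _ <-]; exact: ub.
by apply: ge_sup; [exists (s 0%N), 0%N|move=> _ [m _ <-]; exact: ub].
Qed.

Lemma halves_small (w0 d : R) : 0 < d -> exists n, w0 / 2 ^+ n < d.
Proof.
move=> d0; have [n hn] : exists n : nat, `|w0| / d < n%:R.
  exists (Num.Def.truncn (`|w0| / d)).+1; exact: truncnS_gt.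
exists n; rewrite ltr_pdivrMr ?exprn_gt0// (le_lt_trans (ler_norm _))//.
rewrite mulrC -ltr_pdivrMr// (lt_le_trans hn)// -natrX ler_nat.
exact: ltnW (ltn_expl _ _).
Qed.

(** If [P] failed, some quarter of each bad rectangle would be bad, and the nested bad rectangles
    would shrink to a point where the local hypothesis applies. The quarters stay similar to the
    first rectangle, whence the proportion [v * w0 = w * v0] offered to the local hypothesis. *)
Lemma rect_induction (P : R -> R -> R -> R -> Prop) x0 y0 w0 v0 :
  0 < w0 -> 0 < v0 ->
  (forall x y w v, 0 < w -> 0 < v -> x0 <= x -> y0 <= y ->
     x + w <= x0 + w0 -> y + v <= y0 + v0 ->
     P x y (w / 2) (v / 2) -> P (x + w / 2) y (w / 2) (v / 2) ->
     P x (y + v / 2) (w / 2) (v / 2) ->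
     P (x + w / 2) (y + v / 2) (w / 2) (v / 2) -> P x y w v) ->
  (forall p, rect x0 y0 w0 v0 p -> exists d, 0 < d /\ forall x y w v,
     0 < w -> 0 < v -> x0 <= x -> y0 <= y ->
     x + w <= x0 + w0 -> y + v <= y0 + v0 ->
     w < d -> v < d -> v * w0 = w * v0 -> rect x y w v p ->
     P x y w v) ->
  P x0 y0 w0 v0.
Proof.
move=> w00 v00 split4 loc; apply: contrapT => nP.
pose wn n : R := w0 / 2 ^+ n; pose vn n : R := v0 / 2 ^+ n.
have wn0 n : 0 < wn n by rewrite divr_gt0// exprn_gt0.
have vn0 n : 0 < vn n by rewrite divr_gt0// exprn_gt0.
have wnS n : wn n.+1 = wn n / 2 by rewrite /wn exprS; field; rewrite expf_neq0.
have vnS n : vn n.+1 = vn n / 2 by rewrite /vn exprS; field; rewrite expf_neq0.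
pose bad n (p : R * R) := [/\ x0 <= p.1, y0 <= p.2, p.1 + wn n <= x0 + w0,
  p.2 + vn n <= y0 + v0 & ~ P p.1 p.2 (wn n) (vn n)].
have step n p : exists q, bad n p -> [/\ bad n.+1 q,
    p.1 <= q.1 /\ q.1 + wn n.+1 <= p.1 + wn n &
    p.2 <= q.2 /\ q.2 + vn n.+1 <= p.2 + vn n].
  have [hb|] := pselect (bad n p); last by exists p.
  have [h1 h2 h3 h4 h5] := hb.
  have := wn0 n; have := vn0 n => vnn wnn.
  apply: contrapT => /forallNP nq; apply: h5.
  have good q : p.1 <= q.1 -> p.2 <= q.2 -> q.1 <= p.1 + wn n / 2 ->
      q.2 <= p.2 + vn n / 2 -> P q.1 q.2 (wn n / 2) (vn n / 2).
    move=> a1 a2 a3 a4; apply: contrapT => nPq; apply: (nq q) => _.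
    rewrite /bad !wnS !vnS; split; [split=> //| |]; try lra; split; lra.
  apply: split4 => //.
  - by apply: (good p) => //; lra.
  - by apply: (good (p.1 + wn n / 2, p.2)) => //=; lra.
  - by apply: (good (p.1, p.2 + vn n / 2)) => //=; lra.
  - by apply: (good (p.1 + wn n / 2, p.2 + vn n / 2)) => //=; lra.
have [F HF] : exists F : nat -> R * R -> R * R, forall n p, bad n p ->
    [/\ bad n.+1 (F n p),
    p.1 <= (F n p).1 /\ (F n p).1 + wn n.+1 <= p.1 + wn n &
    p.2 <= (F n p).2 /\ (F n p).2 + vn n.+1 <= p.2 + vn n].
  have /choice[F HF] : forall np : nat * (R * R), exists q, bad np.1 np.2 ->
     [/\ bad np.1.+1 q, np.2.1 <= q.1 /\ q.1 + wn np.1.+1 <= np.2.1 + wn np.1 &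
     np.2.2 <= q.2 /\ q.2 + vn np.1.+1 <= np.2.2 + vn np.1].
    by case=> n p; exact: step.
  by exists (fun n p => F (n, p)) => n p; exact: (HF (n, p)).
pose fix s n := if n is k.+1 then F k (s k) else (x0, y0).
have bads n : bad n (s n).
  elim: n => [|n IH]; last by case: (HF _ _ IH).
  by rewrite /bad /wn /vn expr0 !divr1 /=; split.
have [px hx] := @nested_point (fun n => (s n).1) wn (fun n => ltW (wn0 n))
  (fun n => let: And3 _ h _ := HF _ _ (bads n) in h).
have [py hy] := @nested_point (fun n => (s n).2) vn (fun n => ltW (vn0 n))
  (fun n => let: And3 _ _ h := HF _ _ (bads n) in h).
have [|d [d0 hd]] := loc (px +i* py)%C.
  have := hx 0%N; have := hy 0%N; rewrite /= /wn /vn expr0 !divr1.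
  by split.
have [n1 hn1] := halves_small w0 d0; have [n2 hn2] := halves_small v0 d0.
have mono (u : R) (a b : nat) : 0 < u -> (a <= b)%N -> u / 2 ^+ b <= u / 2 ^+ a.
  move=> u0 ab; rewrite ler_pM2l// lef_pV2 ?posrE ?exprn_gt0//.
  by rewrite ler_eXn2l// ltr1n.
have [b1 b2 b3 b4 +] := bads (maxn n1 n2); apply.
apply: hd => //.
- by rewrite (le_lt_trans _ hn1)// mono// leq_maxl.
- by rewrite (le_lt_trans _ hn2)// mono// leq_maxr.
- by rewrite /wn /vn; ring.
Qed.

End RectangleInduction.

(** * Goursat's theorem *)

Section LineIntegral.
Variable R : realType.
Local Notation C := (R[i]).
Local Notation mu := (@lebesgue_measure R).

Definition rint (f : R -> R) (a b : R) : R := \int[mu]_(t in `[a, b]) f t.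
Definition icont (f : R -> R) a b := {in `[a, b], continuous f}.

Lemma icont_integrable f a b : icont f a b ->
  mu.-integrable `[a, b] (EFin \o f).
Proof.
move=> cf; apply: continuous_compact_integrable; first exact: segment_compact.
by apply: continuous_in_subspaceT => x /set_mem; exact: cf.
Qed.

Lemma rintD f g a b : icont f a b -> icont g a b ->
  rint (fun t => f t + g t) a b = rint f a b + rint g a b.
Proof. by move=> /icont_integrable ? /icont_integrable ?; exact: RintegralD. Qed.

Lemma rintZ k f a b : icont f a b ->
  rint (fun t => k * f t) a b = k * rint f a b.
Proof. by move=> /icont_integrable ?; exact: RintegralZl. Qed.

Lemma rint_split f a e b : a <= e -> e <= b -> icont f a b ->
  rint f a b = rint f a e + rint f e b.
Proof.
move=> ae eb cf; have If := icont_integrable cf; apply/eqP; rewrite addrC -subr_eq; apply/eqP.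
rewrite /rint (Rintegral_itvB If) ?bnd_simp//.
rewrite Rintegral_itv_obnd_cbnd//; apply: integrableS If => //.
by apply: subset_itvr; rewrite bnd_simp.
Qed.

Lemma rint_cst k a b : a <= b -> rint (fun _ => k) a b = k * (b - a).
Proof.
move=> ab; rewrite /rint Rintegral_cst//= lebesgue_measure_itv /= lte_fin.
by move: ab; rewrite le_eqVlt => /predU1P[->|->] //=; rewrite ltxx subrr.
Qed.

Lemma rint_bound f a b B : a <= b -> icont f a b ->
  (forall t, a <= t <= b -> `|f t| <= B) -> `|rint f a b| <= B * (b - a).
Proof.
move=> ab cf fB; have If := icont_integrable cf.
apply: (le_trans (le_normr_Rintegral _ If)) => //.
rewrite -rint_cst//; apply: le_Rintegral => //.
- have := integrable_norm If; apply: eq_integrable => // x _ //=.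
- by apply: (@icont_integrable (fun _ => B)) => x _; exact: cst_continuous.
Qed.

Lemma rint_id a b : a <= b -> rint (fun t => t) a b = (b ^+ 2 - a ^+ 2) / 2.
Proof.
rewrite le_eqVlt => /predU1P[->|ab].
  by rewrite subrr mul0r /rint set_itv1 Rintegral_set1.
rewrite /rint /Rintegral.
pose F (t : R) := t ^+ 2 / 2.
have dF (t : R) : is_derive t 1 F t.
  rewrite /F; apply: is_derive_eq; rewrite /GRing.scale /=.
  by rewrite !mulr0 add0r mulr1; field.
have cF : continuous F.
  move=> t; apply: differentiable_continuous; apply/derivable1_diffP.
  by case: (dF t).
rewrite (@continuous_FTC2 _ (fun t : R => t) F)//.
- by rewrite /= /F; ring.
- by apply: continuous_subspaceT => x; exact: cvg_id.
- split.
  + by move=> x _; case: (dF x).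
  + by apply: cvg_at_right_filter; exact: cF.
  + by apply: cvg_at_left_filter; exact: cF.
- by move=> x _; rewrite derive1E; case: (dF x).
Qed.

Definition lcont (f : R -> C) a b :=
  icont (fun t => complex.Re (f t)) a b /\ icont (fun t => complex.Im (f t)) a b.
Definition lint (f : R -> C) a b : C :=
  (rint (fun t => complex.Re (f t)) a b +i* rint (fun t => complex.Im (f t)) a b)%C.

Lemma creD (z w : C) : complex.Re (z + w) = complex.Re z + complex.Re w.
Proof. by case: z w => [? ?] [? ?]. Qed.
Lemma cimD (z w : C) : complex.Im (z + w) = complex.Im z + complex.Im w.
Proof. by case: z w => [? ?] [? ?]. Qed.
Lemma creB (z w : C) : complex.Re (z - w) = complex.Re z - complex.Re w.
Proof. by case: z w => [? ?] [? ?]. Qed.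
Lemma cimB (z w : C) : complex.Im (z - w) = complex.Im z - complex.Im w.
Proof. by case: z w => [? ?] [? ?]. Qed.
Lemma creM (z w : C) : complex.Re (z * w) =
  complex.Re z * complex.Re w - complex.Im z * complex.Im w.
Proof. by case: z w => [? ?] [? ?]. Qed.
Lemma cimM (z w : C) : complex.Im (z * w) =
  complex.Re z * complex.Im w + complex.Im z * complex.Re w.
Proof. by case: z w => [? ?] [? ?]. Qed.

Lemma lintD f g a b : lcont f a b -> lcont g a b ->
  lint (fun t => f t + g t) a b = lint f a b + lint g a b.
Proof.
move=> [f1 f2] [g1 g2]; rewrite /lint.
under eq_fun do rewrite creD; under [X in (_ +i* rint X _ _)%C]eq_fun do rewrite cimD.
by rewrite !rintD.
Qed.

Lemma lintZ k f a b : lcont f a b ->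
  lint (fun t => k * f t) a b = k * lint f a b.
Proof.
move=> [f1 f2]; rewrite /lint.
have cZ (u : R) h : icont h a b -> icont (fun t => u * h t) a b.
  by move=> ch x xi; apply: cvgM; [exact: cvg_cst|exact: ch].
have -> : (fun t => complex.Re (k * f t)) =
    (fun t => complex.Re k * complex.Re (f t) + - complex.Im k * complex.Im (f t)).
  by apply/funext => t; rewrite creM mulNr.
have -> : (fun t => complex.Im (k * f t)) =
    (fun t => complex.Re k * complex.Im (f t) + complex.Im k * complex.Re (f t)).
  by apply/funext => t; rewrite cimM.
rewrite !rintD ?rintZ//; try exact: cZ.
by apply/eqP; rewrite eq_complex /= creM cimM /= mulNr !eqxx.
Qed.

Lemma lint_split f a e b : a <= e -> e <= b -> lcont f a b ->
  lint f a b = lint f a e + lint f e b.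
Proof.
move=> ae eb [f1 f2].
by rewrite /lint (rint_split ae eb f1) (rint_split ae eb f2).
Qed.

(** Real and imaginary parts are bounded separately, whence the factor 2. Such losses are harmless,
    since [pow_trick] later removes multiplicative constants. *)
Lemma lint_bound f a b B : a <= b -> lcont f a b ->
  (forall t, a <= t <= b -> cabs (f t) <= B) ->
  cabs (lint f a b) <= 2 * B * (b - a).
Proof.
move=> ab [f1 f2] fB; rewrite (le_trans (cabs_le_ReIm _))//= mulrAC mulr2n mulrDl mul1r mulrDl.
apply: lerD; rewrite mulrC; apply: rint_bound => // t /fB; apply: le_trans.
  exact: Re_le_cabs.
exact: Im_le_cabs.
Qed.

Lemma lint_affine (p q : C) a b : a <= b ->
  lint (fun t => p + q * t%:C%C) a b =
  p * (b - a)%:C%C + q * ((b ^+ 2 - a ^+ 2) / 2)%:C%C.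
Proof.
move=> ab.
have aff (u v : R) : rint (fun t => u + v * t) a b = u * (b - a) + v * ((b ^+ 2 - a ^+ 2) / 2).
  rewrite rintD ?rintZ ?rint_cst ?rint_id// => x _; first exact: cvg_id.
    exact: cst_continuous.
  by apply: cvgM; [exact: cvg_cst|exact: cvg_id].
rewrite /lint.
have -> : (fun t : R => complex.Re (p + q * t%:C%C)) =
    (fun t => complex.Re p + complex.Re q * t).
  by apply/funext => t; rewrite creD creM /= mulr0 subr0.
have -> : (fun t : R => complex.Im (p + q * t%:C%C)) =
    (fun t => complex.Im p + complex.Im q * t).
  by apply/funext => t; rewrite cimD cimM /= mulr0 add0r.
rewrite !aff; apply/eqP; rewrite eq_complex /= creD cimD !creM !cimM /=.
by rewrite !mulr0 !subr0 !add0r !eqxx.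
Qed.

Lemma lcont_ccont (g : C -> C) (h : R -> C) a b :
  (forall s t, cabs (h s - h t) = `|s - t|) ->
  (forall t, a <= t <= b -> ccont g (h t)) -> lcont (fun t => g (h t)) a b.
Proof.
move=> hh cg; split=> t; rewrite in_itv /= => /cg ct;
  apply/cvgrPdist_lt => e /ct[d [d0 Hd]]; rewrite near_simpl;
  apply/nbhs_ballP; exists d => //= s; rewrite /ball /= => st;
  have {}/Hd : cabs (h s - h t) < d by [rewrite hh distrC|idtac];
  rewrite -cabsN opprB; apply: le_lt_trans.
  by rewrite -creB Re_le_cabs.
by rewrite -cimB Im_le_cabs.
Qed.

End LineIntegral.

Section Goursat.
Variable R : realType.
Local Notation C := (R[i]).

Ltac ceq := apply/eqP; rewrite eq_complex /=; apply/andP; split; apply/eqP; ring.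

Lemma lcont_h (g : C -> C) a b y : (forall t, a <= t <= b -> ccont g (t +i* y)%C) ->
  lcont (fun t => g (t +i* y)%C) a b.
Proof.
apply: (@lcont_ccont _ g (fun t => t +i* y)%C) => s t.
by rewrite (_ : _ - _ = (s - t)%:C%C) ?cabsr//; ceq.
Qed.

Lemma lcont_v (g : C -> C) a b x : (forall t, a <= t <= b -> ccont g (x +i* t)%C) ->
  lcont (fun t => g (x +i* t)%C) a b.
Proof.
apply: (@lcont_ccont _ g (fun t => x +i* t)%C) => s t.
have -> : (x +i* s)%C - (x +i* t)%C = 'i%C * (s - t)%:C%C.
  by ceq.
by rewrite cabsM cabsr /cabs /= expr0n /= add0r expr1n sqrtr1 mul1r.
Qed.

(** The counterclockwise boundary integral of [g]; ['i] is the velocity on the vertical sides. All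
    sides are parametrised by increasing coordinate, so common sides of adjacent rectangles
    cancel. *)
Definition contour (g : C -> C) (x y w v : R) : C :=
  lint (fun t => g (t +i* y)%C) x (x + w) +
  'i%C * lint (fun t => g ((x + w) +i* t)%C) y (y + v) -
  lint (fun t => g (t +i* (y + v))%C) x (x + w) -
  'i%C * lint (fun t => g (x +i* t)%C) y (y + v).

Definition hcont (g : C -> C) y a b := forall t, a <= t <= b -> ccont g (t +i* y)%C.
Definition vcont (g : C -> C) x a b := forall t, a <= t <= b -> ccont g (x +i* t)%C.

Definition bcont g x y w v := [/\ hcont g y x (x + w), vcont g (x + w) y (y + v),
  hcont g (y + v) x (x + w) & vcont g x y (y + v)].

Lemma contour_hsplit g x y w1 w2 v : 0 <= w1 -> 0 <= w2 ->
  hcont g y x (x + (w1 + w2)) -> hcont g (y + v) x (x + (w1 + w2)) ->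
  contour g x y (w1 + w2) v = contour g x y w1 v + contour g (x + w1) y w2 v.
Proof.
move=> w10 w20 c1 c2; rewrite /contour.
have h1 : x <= x + w1 by lra.
have h2 : x + w1 <= x + (w1 + w2) by lra.
rewrite (lint_split h1 h2 (lcont_h c1)).
rewrite (lint_split h1 h2 (lcont_h c2)).
by rewrite addrA; ring.
Qed.

Lemma contour_vsplit g x y w v1 v2 : 0 <= v1 -> 0 <= v2 ->
  vcont g x y (y + (v1 + v2)) -> vcont g (x + w) y (y + (v1 + v2)) ->
  contour g x y w (v1 + v2) = contour g x y w v1 + contour g x (y + v1) w v2.
Proof.
move=> v10 v20 c1 c2; rewrite /contour.
have h1 : y <= y + v1 by lra.
have h2 : y + v1 <= y + (v1 + v2) by lra.
rewrite (lint_split h1 h2 (lcont_v c1)).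
rewrite (lint_split h1 h2 (lcont_v c2)).
by rewrite addrA; ring.
Qed.

Lemma contourD g h x y w v : bcont g x y w v -> bcont h x y w v ->
  contour (fun z => g z + h z) x y w v = contour g x y w v + contour h x y w v.
Proof.
move=> [g1 g2 g3 g4] [h1 h2 h3 h4]; rewrite /contour.
rewrite (lintD (lcont_h g1) (lcont_h h1)) (lintD (lcont_v g2) (lcont_v h2)).
rewrite (lintD (lcont_h g3) (lcont_h h3)) (lintD (lcont_v g4) (lcont_v h4)).
ring.
Qed.

Lemma contourZ k g x y w v : bcont g x y w v ->
  contour (fun z => k * g z) x y w v = k * contour g x y w v.
Proof.
move=> [g1 g2 g3 g4]; rewrite /contour.
rewrite (lintZ k (lcont_h g1)) (lintZ k (lcont_v g2)).
rewrite (lintZ k (lcont_h g3)) (lintZ k (lcont_v g4)); ring.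
Qed.

Definition bdry (x y w v : R) : set C := [set z | rect x y w v z /\
  [\/ complex.Re z = x, complex.Re z = x + w, complex.Im z = y | complex.Im z = y + v]].

Lemma cabs_i : cabs ('i%C : C) = 1.
Proof. by rewrite /cabs /= expr0n /= add0r expr1n sqrtr1. Qed.

Lemma bdry_h0 x y w v t : 0 <= v -> x <= t <= x + w -> bdry x y w v (t +i* y)%C.
Proof. by move=> ? ?; split; [split=> //=; lra|apply: Or43]. Qed.
Lemma bdry_h1 x y w v t : 0 <= v -> x <= t <= x + w -> bdry x y w v (t +i* (y + v))%C.
Proof. by move=> ? ?; split; [split=> //=; lra|apply: Or44]. Qed.
Lemma bdry_v0 x y w v t : 0 <= w -> y <= t <= y + v -> bdry x y w v (x +i* t)%C.
Proof. by move=> ? ?; split; [split=> //=; lra|apply: Or41]. Qed.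
Lemma bdry_v1 x y w v t : 0 <= w -> y <= t <= y + v -> bdry x y w v ((x + w) +i* t)%C.
Proof. by move=> ? ?; split; [split=> //=; lra|apply: Or42]. Qed.

Lemma bcontP g x y w v : 0 <= w -> 0 <= v ->
  (forall z, bdry x y w v z -> ccont g z) -> bcont g x y w v.
Proof.
move=> w0 v0 c; split=> t ht; apply: c.
- exact: bdry_h0.
- exact: bdry_v1.
- exact: bdry_h1.
- exact: bdry_v0.
Qed.

Lemma contour_bound g x y w v B : 0 <= w -> 0 <= v -> bcont g x y w v ->
  (forall z, bdry x y w v z -> cabs (g z) <= B) ->
  cabs (contour g x y w v) <= 4 * B * (w + v).
Proof.
move=> w0 v0 [g1 g2 g3 g4] gB; rewrite /contour.
have b1 : cabs (lint (fun t => g (t +i* y)%C) x (x + w)) <= 2 * B * (x + w - x).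
  apply: lint_bound => [||t ht]; [lra|exact: lcont_h|apply: gB; exact: bdry_h0].
have b2 : cabs (lint (fun t => g ((x + w) +i* t)%C) y (y + v)) <= 2 * B * (y + v - y).
  apply: lint_bound => [||t ht]; [lra|exact: lcont_v|apply: gB; exact: bdry_v1].
have b3 : cabs (lint (fun t => g (t +i* (y + v))%C) x (x + w)) <= 2 * B * (x + w - x).
  apply: lint_bound => [||t ht]; [lra|exact: lcont_h|apply: gB; exact: bdry_h1].
have b4 : cabs (lint (fun t => g (x +i* t)%C) y (y + v)) <= 2 * B * (y + v - y).
  apply: lint_bound => [||t ht]; [lra|exact: lcont_v|apply: gB; exact: bdry_v0].
apply: (le_trans (cabsB_le _ _)); rewrite cabsM cabs_i mul1r.
apply: (@le_trans _ _ (2 * B * (x + w - x) + 2 * B * (y + v - y) + 2 * B * (x + w - x) +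
  2 * B * (y + v - y))); last by lra.
apply: lerD b4; apply: (le_trans (cabsB_le _ _)); apply: lerD b3.
apply: (le_trans (cabsD _ _)); rewrite cabsM cabs_i mul1r; exact: lerD.
Qed.

(** The only contour integral that is computed exactly; it lets the linear part drop out in
    [goursat]. *)
Lemma contour_affine (p q : C) x y w v : 0 <= w -> 0 <= v ->
  contour (fun z => p + q * z) x y w v = 0.
Proof.
move=> w0 v0; rewrite /contour.
have hE (u : R) : (fun t : R => p + q * (t +i* u)%C) =
    (fun t => (p + q * (0 +i* u)%C) + q * t%:C%C).
  apply/funext => t; rewrite -addrA -mulrDr; congr (_ + _ * _).
  by ceq.
have vE (u : R) : (fun t : R => p + q * (u +i* t)%C) =
    (fun t => (p + q * u%:C%C) + (q * 'i%C) * t%:C%C).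
  apply/funext => t; rewrite -addrA -mulrA -mulrDr; congr (_ + _ * _).
  by ceq.
have i2 : 'i%C * 'i%C = -1 :> C by rewrite -expr2 sqr_i.
have h1 : x <= x + w by lra.
have h2 : y <= y + v by lra.
rewrite !hE !vE !lint_affine//.
have -> : (0 +i* y)%C = 'i%C * y%:C%C :> C.
  by ceq.
have -> : (0 +i* (y + v))%C = 'i%C * (y%:C%C + v%:C%C) :> C.
  by ceq.
rewrite (addrC x w) addrK (addrC y v) addrK (addrC v y) !rmorphD /= !mulrDr !mulrDl.
ring: i2.
Qed.

(** The bound [e] times area is additive under quartering. It holds on small rectangles because
    there [g] differs from its linear part at [p] by at most [e'] times the distance to [p]. *)
Lemma goursat g x0 y0 w0 v0 : 0 < w0 -> 0 < v0 ->
  (forall z, rect x0 y0 w0 v0 z -> exists l, has_cd g z l) ->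
  contour g x0 y0 w0 v0 = 0.
Proof.
move=> w00 v00 dg.
have cg z : rect x0 y0 w0 v0 z -> ccont g z by move=> /dg[l /has_cd_ccont].
have subr x y w v : 0 < w -> 0 < v -> x0 <= x -> y0 <= y ->
    x + w <= x0 + w0 -> y + v <= y0 + v0 -> rect x y w v `<=` rect x0 y0 w0 v0.
  by move=> ? ? ? ? ? ? z [/andP[? ?] /andP[? ?]]; split; lra.
have subc x y w v : 0 < w -> 0 < v -> x0 <= x -> y0 <= y ->
    x + w <= x0 + w0 -> y + v <= y0 + v0 -> forall z, rect x y w v z -> ccont g z.
  by move=> ? ? ? ? ? ? z hz; apply: cg; move: hz; exact: subr.
suff H e : 0 < e -> cabs (contour g x0 y0 w0 v0) <= e * (w0 * v0).
  apply/eqP; rewrite -cabs_eq0; apply: contrapT => /negP c0.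
  have {}c0 : 0 < cabs (contour g x0 y0 w0 v0) by rewrite lt_def c0 cabs_ge0.
  have wv0 : 0 < w0 * v0 by rewrite mulr_gt0.
  have := H (cabs (contour g x0 y0 w0 v0) / 2 / (w0 * v0)).
  by rewrite !divr_gt0// mulfVK ?gt_eqF// => /(_ isT); lra.
move=> e0; apply: (@rect_induction _ (fun x y w v =>
  cabs (contour g x y w v) <= e * (w * v)) x0 y0 w0 v0) => //.
  move=> x y w v w_0 v_0 xx yy xw yv P1 P2 P3 P4.
  have w20 : 0 <= w / 2 by lra.
  have v20 : 0 <= v / 2 by lra.
  have E : contour g x y w v = contour g x y (w / 2) (v / 2) +
      contour g x (y + v / 2) (w / 2) (v / 2) +
      (contour g (x + w / 2) y (w / 2) (v / 2) +
      contour g (x + w / 2) (y + v / 2) (w / 2) (v / 2)).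
    have c := subc x y w v w_0 v_0 xx yy xw yv; clear P1 P2 P3 P4.
    rewrite -contour_vsplit//; first rewrite -contour_vsplit//.
    - rewrite -!splitr -contour_hsplit//; first by rewrite -splitr.
      + by move=> t; rewrite -splitr => ?; apply: c; split => /=; lra.
      + by move=> t; rewrite -splitr => ?; apply: c; split => /=; lra.
    - by move=> t; rewrite -splitr => ?; apply: c; split => /=; lra.
    - by move=> t; rewrite -splitr => ?; apply: c; split => /=; lra.
    - by move=> t; rewrite -splitr => ?; apply: c; split => /=; lra.
    - by move=> t; rewrite -splitr => ?; apply: c; split => /=; lra.
  rewrite E; apply: (le_trans (cabsD _ _)).
  have h1 := cabsD (contour g x y (w / 2) (v / 2)) (contour g x (y + v / 2) (w / 2) (v / 2)).
  have h2 := cabsD (contour g (x + w / 2) y (w / 2) (v / 2))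
    (contour g (x + w / 2) (y + v / 2) (w / 2) (v / 2)).
  move: P1 P2 P3 P4; rewrite (_ : w / 2 * (v / 2) = w * v / 4); last by field.
  lra.
move=> p hp; have [l dl] := dg p hp.
have [r [r0 rE]] : exists r : R, 0 < r /\ r = v0 / w0.
  by exists (v0 / w0); rewrite divr_gt0.
have r1 : 0 < 1 + r by lra.
(* With [v = w * r] this is the value for which [4 * e' * (w + v) ^+ 2 = e * (w * v)]; similarity of
   the rectangles makes [r] the same for all of them. *)
pose e' : R := e * r / (4 * (1 + r) ^+ 2).
have e'0 : 0 < e' by rewrite divr_gt0 ?mulr_gt0 ?exprn_gt0.
have [d [d0 Hd]] := dl e' e'0.
exists (d / 2); split=> [|x y w v w_0 v_0 xx yy xw yv wd vd asp hpr]; first by lra.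
have vE : v = w * r by rewrite rE mulrA -asp mulfK// gt_eqF.
pose aff z := (g p - l * p) + l * z.
pose rem z := g z + (-1) * aff z.
have cont_aff z : ccont aff z.
  by apply: ccontD; [exact: ccont_cst|apply: ccontM; [exact: ccont_cst|exact: ccont_id]].
have cgr := subc x y w v w_0 v_0 xx yy xw yv.
have bg : bcont g x y w v by apply: bcontP; [lra|lra|move=> z [+ _]; exact: cgr].
have baff : bcont aff x y w v by apply: bcontP; [lra|lra|].
have brem : bcont rem x y w v.
  apply: bcontP; [lra|lra|move=> z [hz _]]; apply: ccontD; first exact: cgr.
  by apply: ccontM; [exact: ccont_cst|].
have -> : contour g x y w v = contour rem x y w v.
  have -> : g = (fun z => rem z + aff z).
    by apply/funext => z; rewrite /rem; ring.
  rewrite contourD// [contour aff _ _ _ _]contour_affine ?addr0 ?ltW//.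
have -> : e * (w * v) = 4 * (e' * (w + v)) * (w + v).
  rewrite /e' vE; field; lra.
apply: contour_bound; [lra|lra|done|move=> z [hz _]].
have zp : cabs (z - p) <= w + v.
  apply: (le_trans (cabs_le_ReIm _)); rewrite creB cimB.
  move: hz hpr => [/andP[? ?] /andP[? ?]] [/andP[? ?] /andP[? ?]].
  by apply: lerD; rewrite ler_norml; lra.
have -> : rem z = g z - g p - l * (z - p) by rewrite /rem /aff; ring.
apply: (le_trans (Hd z _)); first by rewrite (le_lt_trans zp)//; lra.
by rewrite ler_wpM2l// ltW.
Qed.

Lemma rint_ge (f : R -> R) a b m : a <= b -> icont f a b ->
  (forall t, a <= t <= b -> m <= f t) -> m * (b - a) <= rint f a b.
Proof.
move=> ab cf fm; rewrite -rint_cst//; apply: le_Rintegral => //.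
- by apply: (@icont_integrable _ (fun _ => m)) => x _; exact: cst_continuous.
- exact: icont_integrable.
Qed.

(** The exact value is 2 pi, but 4 is enough. On each side the relevant part of the integrand is, up
    to sign, h / (s^2 + h^2) >= 1 / (2 h), so each of the four sides of length 2 h contributes at
    least 1. *)
Lemma Im_contour_inv a b h : 0 < h ->
  4 <= complex.Im (contour (fun z => (z - (a +i* b)%C)^-1) (a - h) (b - h) (h + h) (h + h)).
Proof.
move=> h0; pose z0 : C := (a +i* b)%C.
have cq z : z != z0 -> ccont (fun z => (z - z0)^-1) z.
  move=> zz0; apply: ccontV; first by rewrite subr_eq0.
  by apply: ccontB; [exact: ccont_id|exact: ccont_cst].
have ReV (x y : R) : complex.Re ((x +i* y)%C : C)^-1 = x / (x ^+ 2 + y ^+ 2) by [].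
have ImV (x y : R) : complex.Im ((x +i* y)%C : C)^-1 = - (y / (x ^+ 2 + y ^+ 2)) by [].
have key (s : R) : - h <= s <= h -> (h + h)^-1 <= h / (s ^+ 2 + h ^+ 2).
  move=> hs; rewrite -[leLHS]mul1r ler_pdivlMr; last first.
    by rewrite ltr_wpDl ?sqr_ge0// exprn_gt0.
  rewrite mulrAC mul1r ler_pdivrMr; last by lra.
  by nra.
have hh : (h + h)^-1 * (h + h) = 1 by rewrite mulVf// gt_eqF//; lra.
have E1 : a - h + (h + h) = a + h by ring.
have E2 : b - h + (h + h) = b + h by ring.
rewrite /contour E1 E2 !cimB cimD !cimM /= !mul0r !add0r !mul1r.
have T1 : 1 <= rint (fun t => complex.Im ((t +i* (b - h))%C - z0)^-1) (a - h) (a + h).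
  rewrite -[leLHS]hh (_ : (h + h)^-1 * (h + h) = (h + h)^-1 * (a + h - (a - h))); last by congr (_ * _); ring.
  apply: rint_ge; first lra.
    have [|_] := @lcont_h (fun z => (z - z0)^-1) (a - h) (a + h) (b - h).
      by move=> t _; apply: cq; rewrite eq_complex /=; apply/nandP; right; apply/eqP; lra.
    exact.
  move=> t ht; rewrite (_ : (t +i* (b - h))%C - z0 = ((t - a) +i* (- h))%C); last by ceq.
  by rewrite ImV mulNr opprK sqrrN key//; lra.
have T2 : 1 <= rint (fun t => complex.Re (((a + h) +i* t)%C - z0)^-1) (b - h) (b + h).
  rewrite -[leLHS]hh (_ : (h + h)^-1 * (h + h) = (h + h)^-1 * (b + h - (b - h))); last by congr (_ * _); ring.
  apply: rint_ge; first lra.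
    have [|+ _] := @lcont_v (fun z => (z - z0)^-1) (b - h) (b + h) (a + h).
      by move=> t _; apply: cq; rewrite eq_complex /=; apply/nandP; left; apply/eqP; lra.
    exact.
  move=> t ht; rewrite (_ : ((a + h) +i* t)%C - z0 = (h +i* (t - b))%C); last by ceq.
  by rewrite ReV [h ^+ 2 + _]addrC key//; lra.
have T3 : rint (fun t => complex.Im ((t +i* (b + h))%C - z0)^-1) (a - h) (a + h) <= -1.
  rewrite lerNr -[- rint _ _ _]mulN1r -rintZ; last first.
    have [|_] := @lcont_h (fun z => (z - z0)^-1) (a - h) (a + h) (b + h).
      by move=> t _; apply: cq; rewrite eq_complex /=; apply/nandP; right; apply/eqP; lra.
    exact.
  rewrite -[leLHS]hh (_ : (h + h)^-1 * (h + h) = (h + h)^-1 * (a + h - (a - h))); last by congr (_ * _); ring.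
  apply: rint_ge; first lra.
    have [|_ c] := @lcont_h (fun z => (z - z0)^-1) (a - h) (a + h) (b + h).
      by move=> t _; apply: cq; rewrite eq_complex /=; apply/nandP; right; apply/eqP; lra.
    by move=> t ht; apply: cvgM; [exact: cvg_cst|exact: c].
  move=> t ht; rewrite (_ : (t +i* (b + h))%C - z0 = ((t - a) +i* h)%C); last by ceq.
  by rewrite ImV mulN1r opprK key//; lra.
have T4 : rint (fun t => complex.Re (((a - h) +i* t)%C - z0)^-1) (b - h) (b + h) <= -1.
  rewrite lerNr -[- rint _ _ _]mulN1r -rintZ; last first.
    have [|+ _] := @lcont_v (fun z => (z - z0)^-1) (b - h) (b + h) (a - h).
      by move=> t _; apply: cq; rewrite eq_complex /=; apply/nandP; left; apply/eqP; lra.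
    exact.
  rewrite -[leLHS]hh (_ : (h + h)^-1 * (h + h) = (h + h)^-1 * (b + h - (b - h))); last by congr (_ * _); ring.
  apply: rint_ge; first lra.
    have [|c _] := @lcont_v (fun z => (z - z0)^-1) (b - h) (b + h) (a - h).
      by move=> t _; apply: cq; rewrite eq_complex /=; apply/nandP; left; apply/eqP; lra.
    by move=> t ht; apply: cvgM; [exact: cvg_cst|exact: c].
  move=> t ht; rewrite (_ : ((a - h) +i* t)%C - z0 = ((- h) +i* (t - b))%C); last by ceq.
  by rewrite ReV mulN1r mulNr opprK sqrrN [h ^+ 2 + _]addrC key//; lra.
rewrite -/z0; lra.
Qed.

End Goursat.

(** * Maximum principle *)

Section MaximumPrinciple.
Variable R : realType.
Local Notation C := (R[i]).

Definition sqr (a b h : R) : set C := rect (a - h) (b - h) (h + h) (h + h).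
Definition bsqr (a b h : R) : set C := bdry (a - h) (b - h) (h + h) (h + h).

Lemma bsqr_ge a b h z : 0 <= h -> bsqr a b h z -> h <= cabs (z - (a +i* b)%C).
Proof.
move=> h0 [_]; case=> e.
- by apply: le_trans (Re_le_cabs _); rewrite creB e /=; rewrite (_ : _ - _ - _ = - h) ?normrN ?ger0_norm//; ring.
- by apply: le_trans (Re_le_cabs _); rewrite creB e /=; rewrite (_ : _ - _ = h) ?ger0_norm//; ring.
- by apply: le_trans (Im_le_cabs _); rewrite cimB e /=; rewrite (_ : _ - _ - _ = - h) ?normrN ?ger0_norm//; ring.
- by apply: le_trans (Im_le_cabs _); rewrite cimB e /=; rewrite (_ : _ - _ = h) ?ger0_norm//; ring.
Qed.

Lemma sqr_le a b h z : sqr a b h z -> cabs (z - (a +i* b)%C) <= h + h.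
Proof.
move=> [/andP[? ?] /andP[? ?]]; apply: (le_trans (cabs_le_ReIm _)).
by rewrite creB cimB /=; apply: lerD; rewrite ler_norml; lra.
Qed.

Lemma bsqr_neq a b h z : 0 < h -> bsqr a b h z -> z != (a +i* b)%C.
Proof.
move=> h0 /(bsqr_ge (ltW h0)) hz; apply/eqP => zE; move: hz.
by rewrite zE subrr cabs0; lra.
Qed.

(** If [a > b > 0], Bernoulli's inequality makes [(a / b) ^+ n] exceed [K]. Used on powers of a
    holomorphic function, this turns an estimate with a constant into one without. *)
Lemma pow_trick (a b K : R) : 0 <= a -> 0 <= b -> 0 <= K ->
  (forall n, a ^+ n <= K * b ^+ n) -> a <= b.
Proof.
move=> a0 b0 K0 H; rewrite leNgt; apply/negP => ba.
have {}b0 : 0 < b.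
  rewrite lt_def b0 andbT; apply/eqP => bE; have := H 1%N.
  by rewrite !expr1 bE mulr0; move: ba; rewrite bE; lra.
pose x := a / b - 1.
have x0 : 0 < x by rewrite subr_gt0 ltr_pdivlMr// mul1r.
have bern n : 1 + n%:R * x <= (a / b) ^+ n.
  rewrite (_ : a / b = 1 + x); last by rewrite /x; ring.
  elim: n => [|n IH]; first by rewrite expr0 mul0r addr0.
  rewrite exprS -natr1; apply: (@le_trans _ _ ((1 + x) * (1 + n%:R * x))).
    have : 0 <= n%:R * x by rewrite mulr_ge0// ltW.
    move=> ?; nra.
  by rewrite ler_wpM2l//; lra.
pose n := (Num.Def.truncn (K / x)).+1.
have hn : K / x < n%:R by exact: truncnS_gt.
have := H n; rewrite -ler_pdivrMr ?exprn_gt0// -expr_div_n => hK.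
have := le_trans (bern n) hK; move: hn; rewrite ltr_pdivrMr//; lra.
Qed.

Lemma has_cd_dq (g : C -> C) z0 z l : z != z0 -> has_cd g z l ->
  exists m, has_cd (fun z => (g z - g z0) * (z - z0)^-1) z m.
Proof.
move=> zz0 dg; eexists; apply: has_cdM.
  by apply: has_cdB; [exact: dg|exact: has_cd_cst].
apply: has_cdV; first by rewrite subr_eq0.
by apply: has_cdB; [exact: has_cd_id|exact: has_cd_cst].
Qed.

(** Cauchy's formula as an inequality. The difference quotient [q] has zero integral, so [g z0]
    times the integral of 1 / (z - z0), which has modulus at least 4, equals the integral of g z /
    (z - z0), which has modulus at most [16 * B]. *)
Lemma square_cauchy (g : C -> C) a b h B : 0 < h ->
  (forall z, sqr a b h z -> exists l, has_cd g z l) ->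
  (forall z, bsqr a b h z -> cabs (g z) <= B) ->
  cabs (g (a +i* b)%C) <= 4 * B.
Proof.
move=> h0 dg gB; set z0 := (a +i* b)%C.
pose q z := (g z - g z0) * (z - z0)^-1.
have dq z : sqr a b h z -> z != z0 -> exists m, has_cd q z m.
  by move=> /dg[l dl] zz0; exact: (has_cd_dq zz0 dl).
have cq z : sqr a b h z -> z != z0 -> ccont q z.
  by move=> hz zz0; have [m /has_cd_ccont] := dq z hz zz0.
have neqz0 (x y : R) : x != a \/ y != b -> (x +i* y)%C != z0.
  by move=> xy; rewrite eq_complex /=; apply/nandP.
(* The frame between the two squares is cut into a left and a right strip and the pieces below and
   above the small square. None of them contains [z0], so [goursat] removes all four. *)
have shrink k : 0 < k -> k < h ->
    contour q (a - h) (b - h) (h + h) (h + h) =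
    contour q (a - k) (b - k) (k + k) (k + k).
  move=> k0 kh.
  have g0 x y w v : 0 < w -> 0 < v -> rect x y w v `<=` sqr a b h ->
      (forall z, rect x y w v z -> z != z0) -> contour q x y w v = 0.
    move=> w0 v0 sub nz; apply: goursat => // z hz; apply: dq; first exact: sub.
    exact: nz.
  have hk0 : 0 < h - k by lra.
  have hk1 : 0 <= h - k by lra.
  have kk1 : 0 <= k + k by lra.
  have hk2 : 0 <= k + k + (h - k) by lra.
  have E : h + h = (h - k) + ((k + k) + (h - k)) by ring.
  rewrite [in X in contour _ _ _ X _]E contour_hsplit//; last 2 first.
  - move=> t ht; apply: cq; first by split=> /=; lra.
    by apply: neqz0; right; apply/eqP; lra.
  - move=> t ht; apply: cq; first by split=> /=; lra.
    by apply: neqz0; right; apply/eqP; lra.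
  rewrite (g0 (a - h)) ?add0r; [|lra|lra| |]; last 2 first.
  - by move=> z [/andP[? ?] /andP[? ?]]; split; lra.
  - case=> x y [/andP[/= ? ?] /andP[/= ? ?]].
    by apply: neqz0; left; apply/eqP; lra.
  rewrite contour_hsplit//; last 2 first.
  - move=> t ht; apply: cq; first by split=> /=; lra.
    by apply: neqz0; right; apply/eqP; lra.
  - move=> t ht; apply: cq; first by split=> /=; lra.
    by apply: neqz0; right; apply/eqP; lra.
  rewrite (g0 (a - h + (h - k) + (k + k))) ?addr0; [|lra|lra| |]; last 2 first.
  - by move=> z [/andP[? ?] /andP[? ?]]; split; lra.
  - case=> x y [/andP[/= ? ?] /andP[/= ? ?]].
    by apply: neqz0; left; apply/eqP; lra.
  rewrite (_ : a - h + (h - k) = a - k); last by ring.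
  rewrite [in X in contour _ _ _ _ X]E contour_vsplit//; last 2 first.
  - move=> t ht; apply: cq; first by split=> /=; lra.
    by apply: neqz0; left; apply/eqP; lra.
  - move=> t ht; apply: cq; first by split=> /=; lra.
    by apply: neqz0; left; apply/eqP; lra.
  rewrite (g0 (a - k) (b - h)) ?add0r; [|lra|lra| |]; last 2 first.
  - by move=> z [/andP[? ?] /andP[? ?]]; split; lra.
  - case=> x y [/andP[/= ? ?] /andP[/= ? ?]].
    by apply: neqz0; right; apply/eqP; lra.
  rewrite contour_vsplit//; last 2 first.
  - move=> t ht; apply: cq; first by split=> /=; lra.
    by apply: neqz0; left; apply/eqP; lra.
  - move=> t ht; apply: cq; first by split=> /=; lra.
    by apply: neqz0; left; apply/eqP; lra.
  rewrite (g0 (a - k) (b - h + (h - k) + (k + k))) ?addr0; [|lra|lra| |]; last 2 first.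
  - by move=> z [/andP[? ?] /andP[? ?]]; split; lra.
  - case=> x y [/andP[/= ? ?] /andP[/= ? ?]].
    by apply: neqz0; right; apply/eqP; lra.
  by rewrite (_ : b - h + (h - k) = b - k)//; ring.
have cq0 : contour q (a - h) (b - h) (h + h) (h + h) = 0.
  apply/eqP; rewrite -cabs_eq0; apply: contrapT => /negP c0.
  set c := contour _ _ _ _ _ in c0 shrink *.
  have {}c0 : 0 < cabs c by rewrite lt_def c0 cabs_ge0.
  have [|l dl] := dg z0; first by split=> /=; lra.
  have [d [d0 Hd]] := dl 1 ltr01.
  pose L := cabs l + 1; have L0 : 0 < L by rewrite ltr_wpDl ?cabs_ge0.
  (* Near [z0] the quotient is at most [L], so the integral over the small square is at most
     [16 * L * k], hence at most half of [cabs c]. *)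
  pose k := Num.min (h / 2) (Num.min (d / 3) (cabs c / (32 * L))).
  have [k1 k2 k3] : [/\ k <= h / 2, k <= d / 3 & k <= cabs c / (32 * L)].
    by rewrite /k; split; rewrite !ge_min lexx ?orbT.
  have k0 : 0 < k.
    by rewrite /k !lt_min !divr_gt0 ?mulr_gt0.
  have kh : k < h by lra.
  have kb z : bsqr a b k z -> sqr a b h z.
    by move=> [[/andP[? ?] /andP[? ?]] _]; split; lra.
  have : cabs c <= 4 * L * (k + k + (k + k)).
    rewrite (shrink k k0 kh); apply: contour_bound; [lra|lra| |].
      apply: bcontP; [lra|lra|] => z hz; apply: cq; first exact: kb.
      exact: bsqr_neq hz.
    move=> z hz; have zz0 := bsqr_neq k0 hz.
    have zd : cabs (z - z0) < d.
      by have [hz' _] := hz; have := sqr_le hz'; lra.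
    have zp : 0 < cabs (z - z0) by rewrite cabs_gt0 subr_eq0.
    rewrite /q cabsM cabsV ler_pdivrMr//.
    have := Hd z zd; rewrite mul1r => hz2.
    have := cabsD (g z - g z0 - l * (z - z0)) (l * (z - z0)).
    by rewrite subrK cabsM /L mulrDl mul1r; lra.
  move: k3; rewrite ler_pdivlMr ?mulr_gt0// => k3.
  by nra.
pose u z := (z - z0)^-1.
have cu z : z != z0 -> ccont u z.
  move=> zz0; apply: ccontV; first by rewrite subr_eq0.
  by apply: ccontB; [exact: ccont_id|exact: ccont_cst].
have hh0 : 0 <= h + h by lra.
have bq : bcont q (a - h) (b - h) (h + h) (h + h).
  by apply: bcontP => // z hz; apply: cq; [case: hz|exact: bsqr_neq hz].
have bu : bcont u (a - h) (b - h) (h + h) (h + h).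
  by apply: bcontP => // z hz; apply: cu; exact: bsqr_neq hz.
have bzu : bcont (fun z => g z0 * u z) (a - h) (b - h) (h + h) (h + h).
  apply: bcontP => // z hz; apply: ccontM; first exact: ccont_cst.
  by apply: cu; exact: bsqr_neq hz.
have E : contour (fun z => g z * u z) (a - h) (b - h) (h + h) (h + h) =
    g z0 * contour u (a - h) (b - h) (h + h) (h + h).
  have -> : (fun z => g z * u z) = (fun z => q z + g z0 * u z).
    by apply/funext => z; rewrite /q /u; ring.
  by rewrite (contourD bq bzu) cq0 add0r (contourZ _ bu).
have B0 : 0 <= B.
  apply: le_trans (gB ((a - h) +i* b)%C _); first exact: cabs_ge0.
  by split; [split=> /=; lra|apply: Or41].
have : cabs (contour (fun z => g z * u z) (a - h) (b - h) (h + h) (h + h)) <=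
    4 * (B / h) * (h + h + (h + h)).
  apply: contour_bound => //.
    apply: bcontP => // z hz; apply: ccontM; last by apply: cu; exact: bsqr_neq hz.
    by have [hz' _] := hz; have [l /has_cd_ccont] := dg z hz'.
  move=> z hz; rewrite cabsM cabsV; apply: ler_pM; rewrite ?invr_ge0 ?cabs_ge0 ?gB//.
  rewrite lef_pV2 ?posrE// ?(bsqr_ge (ltW h0))//.
  by rewrite cabs_gt0 subr_eq0; exact: bsqr_neq hz.
rewrite E cabsM (_ : 4 * (B / h) * (h + h + (h + h)) = 16 * B); last by field; lra.
have := Im_contour_inv a b h0; rewrite -/z0 -/u => i4.
have := Im_le_cabs (contour u (a - h) (b - h) (h + h) (h + h)) => i5.
have i6 := ler_norm (complex.Im (contour u (a - h) (b - h) (h + h) (h + h))).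
have := cabs_ge0 (g z0); nra.
Qed.

Lemma square_max (g : C -> C) a b h B : 0 < h ->
  (forall z, sqr a b h z -> exists l, has_cd g z l) ->
  (forall z, bsqr a b h z -> cabs (g z) <= B) ->
  cabs (g (a +i* b)%C) <= B.
Proof.
move=> h0 dg gB.
have B0 : 0 <= B.
  apply: le_trans (gB ((a - h) +i* b)%C _); first exact: cabs_ge0.
  by split; [split=> /=; lra|apply: Or41].
apply: (@pow_trick _ _ 4); rewrite ?cabs_ge0// => n.
rewrite -cabsX; apply: (@square_cauchy (fun z => g z ^+ n) _ _ h) => //.
  by move=> z /dg[l dl]; eexists; exact: has_cdX dl.
by move=> z /gB hz; rewrite cabsX lerXn2r// nnegrE cabs_ge0.
Qed.

End MaximumPrinciple.

Lemma pos_min2 (R : realType) (a b : R) : 0 < a -> 0 < b ->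
  exists h, [/\ 0 < h, h <= a & h <= b].
Proof.
move=> a0 b0; exists (Num.min a b).
by rewrite lt_min a0 b0 !ge_min !lexx ?orbT.
Qed.

(** * Compactness of closed discs *)

Section Compactness.
Variable R : realType.
Local Notation C := (R[i]).

(** Heine-Borel as an induction principle: a property of sets that passes to subsets and to unions
    of two, and that holds near every point, holds on closed discs. It is bisection applied to
    [Q (rect x y w v)]. *)
Lemma compact_induction (Q : set C -> Prop) (B : R) :
  (forall A A', A `<=` A' -> Q A' -> Q A) ->
  (forall A A', Q A -> Q A' -> Q (A `|` A')) ->
  (forall p, exists d, 0 < d /\ Q (cball p d)) ->
  Q [set z | cabs z <= B].
Proof.
move=> mono uni loc.
have [b [b0 Bb]] : exists b, 0 < b /\ B <= b.
  by exists (Num.max 1 B); rewrite lt_max ltr01 le_max lexx orbT.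
apply: (mono _ (rect (- b) (- b) (b + b) (b + b))).
  move=> z /= zB; have := Re_le_cabs z; have := Im_le_cabs z.
  rewrite !ler_norml => /andP[? ?] /andP[? ?]; split; lra.
apply: (@rect_induction _ (fun x y w v => Q (rect x y w v))); [lra|lra| |].
  move=> x y w v w0 v0 _ _ _ _ q1 q2 q3 q4.
  apply: mono (uni _ _ (uni _ _ q1 q2) (uni _ _ q3 q4)).
  move=> z [/andP[a1 a2] /andP[a3 a4]].
  have [h1|h1] := leP (complex.Re z) (x + w / 2);
  have [h2|h2] := leP (complex.Im z) (y + v / 2).
  - by left; left; split; lra.
  - by right; left; split; lra.
  - by left; right; split; lra.
  - by right; right; split; lra.
move=> p _; have [d [d0 Qd]] := loc p; exists (d / 2); split; first by lra.
move=> x y w v w0 v0 _ _ _ _ wd vd _ [/andP[? ?] /andP[? ?]].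
apply: mono Qd => z [/andP[? ?] /andP[? ?]].
rewrite /cball /=; apply: (le_lt_trans (cabs_le_ReIm _)); rewrite creB cimB.
apply: (@le_lt_trans _ _ (w + v)); last by lra.
by apply: lerD; rewrite ler_norml; lra.
Qed.

Definition cclosed (K : set C) := forall z, ~ K z ->
  exists d, 0 < d /\ forall w, cabs (w - z) < d -> ~ K w.

Lemma cclosedI K L : cclosed K -> cclosed L -> cclosed (K `&` L).
Proof.
move=> cK cL z /not_andP[/cK|/cL] [d [d0 H]]; exists d; split=> // w /H h []//.
Qed.

Lemma cclosed_ge (u : C -> R) c (L : R) : 0 < L ->
  (forall z w, u w <= u z + L * cabs (w - z)) -> cclosed [set z | c <= u z].
Proof.
move=> L0 H z /negP; rewrite -ltNge => uz; exists ((c - u z) / L).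
split=> [|w wz]; first by rewrite divr_gt0// subr_gt0.
apply/negP; rewrite -ltNge (le_lt_trans (H z w))//.
by rewrite -ltrBrDl mulrC -ltr_pdivlMr.
Qed.

(** Two compactness inductions: the first bounds [u] on [K]; if the supremum [m] were not attained,
    the second would produce an upper bound strictly below [m]. *)
Lemma closed_max (K : set C) (u : C -> R) B :
  K !=set0 -> (forall z, K z -> cabs z <= B) -> cclosed K ->
  (forall z, K z -> forall e, 0 < e -> exists d, 0 < d /\
     forall w, K w -> cabs (w - z) < d -> u w < u z + e) ->
  exists z, K z /\ forall w, K w -> u w <= u z.
Proof.
move=> [z1 Kz1] KB Kc uc.
have [s hs] : exists s, forall w, K w -> u w <= s.
  suff [s hs] : exists s, forall w, [set z | cabs z <= B] w -> K w -> u w <= s.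
    by exists s => w Kw; apply: hs => //; exact: KB.
  apply: (@compact_induction (fun A => exists s, forall w, A w -> K w -> u w <= s)).
  - by move=> A A' AA' [s hs]; exists s => w /AA'; exact: hs.
  - move=> A A' [s hs] [s' hs']; exists (Num.max s s') => w [Aw|Aw] Kw.
      by rewrite le_max hs.
    by rewrite le_max hs' ?orbT.
  - move=> p; have [Kp|/Kc[d [d0 H]]] := pselect (K p).
      have [d [d0 H]] := uc p Kp 1 ltr01; exists d; split=> //.
      by exists (u p + 1) => w wp Kw; apply/ltW/H.
    by exists d; split=> //; exists 0 => w /H.
pose m := sup [set u z | z in K].
have Km w : K w -> u w <= m.
  by move=> Kw; apply: ub_le_sup; [exists s => _ [v Kv <-]; exact: hs|exists w].
apply: contrapT => /forallNP nz.
have lt_m z : K z -> u z < m.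
  move=> Kz; rewrite lt_def Km// andbT; apply/eqP => mz.
  by apply: (nz z); split=> // w /Km; rewrite mz.
suff [s' [s'm hs']] : exists s', s' < m /\ forall w, [set z | cabs z <= B] w -> K w -> u w <= s'.
  have : m <= s'.
    apply: ge_sup; first by exists (u z1), z1.
    by move=> _ [v Kv <-]; apply: hs' => //; exact: KB.
  by rewrite leNgt s'm.
apply: (@compact_induction (fun A => exists s', s' < m /\ forall w, A w -> K w -> u w <= s')).
- by move=> A A' AA' [s' [? hs']]; exists s'; split=> // w /AA'; exact: hs'.
- move=> A A' [s1 [m1 h1]] [s2 [m2 h2]]; exists (Num.max s1 s2).
  split; first by rewrite gt_max m1 m2.
  move=> w [Aw|Aw] Kw; rewrite le_max; first by rewrite h1.
  by rewrite (h2 w) ?orbT.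
- move=> p; have [Kp|/Kc[d [d0 H]]] := pselect (K p).
    have um := lt_m p Kp.
    have [|d [d0 H]] := uc p Kp ((m - u p) / 2); first by lra.
    exists d; split=> //; exists (u p + (m - u p) / 2); split; first by lra.
    by move=> w wp Kw; apply/ltW/H.
  exists d; split=> //; exists (m - 1); split; first by lra.
  by move=> w /H.
Qed.

Lemma ccont_cabs_usc (g : C -> C) z : ccont g z -> forall e, 0 < e -> exists d, 0 < d /\
   forall w, cabs (w - z) < d -> cabs (g w) < cabs (g z) + e.
Proof.
move=> cg e /cg[d [d0 H]]; exists d; split=> // w /H.
have := cabsB_ge (g w) (g z); lra.
Qed.

End Compactness.

(** * Maximum modulus on bounded open sets *)

Section MaxPrinciple.
Variable R : realType.
Local Notation C := (R[i]).

Definition ccl (W : set C) : set C :=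
  [set z | forall d, 0 < d -> exists w, W w /\ cabs (w - z) < d].

Lemma ccl_sub (W : set C) : W `<=` ccl W.
Proof. by move=> z Wz d d0; exists z; rewrite subrr cabs0. Qed.

Lemma ccl_closed (W : set C) : cclosed (ccl W).
Proof.
move=> z /existsNP[d /not_implyP[d0 /forallNP H]].
exists (d / 2); split=> [|w wz]; first by lra.
move=> /(_ (d / 2)) []; first by lra.
move=> v [Wv vw]; apply: (H v); split=> //.
by rewrite (le_lt_trans (cabs_tri _ w _))//; lra.
Qed.

Lemma ccl_bounded (W : set C) B : (forall z, W z -> cabs z <= B) ->
  forall z, ccl W z -> cabs z <= B + 1.
Proof.
move=> WB z /(_ 1 ltr01)[w [/WB wB wz]].
by have := cabsB_ge z w; rewrite cabsBC; lra.
Qed.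

Lemma sqrD (z w : C) : cabs (z + w) ^+ 2 = cabs z ^+ 2 +
  2 * (complex.Re z * complex.Re w + complex.Im z * complex.Im w) + cabs w ^+ 2.
Proof.
have sq (v : C) : cabs v ^+ 2 = complex.Re v ^+ 2 + complex.Im v ^+ 2.
  by rewrite /cabs sqr_sqrtr// addr_ge0 ?sqr_ge0.
by rewrite !sq creD cimD; ring.
Qed.

(* Among the points where |g| is maximal take z0 farthest from q. Multiplying g by
   1 + e * conj (z0 - q) * (z - z0) with e small makes z0 a strict maximum on
   small squares, against square_max. *)
Lemma max_principle0 (W : set C) (g : C -> C) B B0 :
  copen W -> (forall z, W z -> cabs z <= B0) ->
  (forall z, ccl W z -> ccont g z) ->
  (forall z, W z -> exists l, has_cd g z l) ->
  (forall z, ccl W z -> ~ W z -> cabs (g z) <= B) ->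
  forall z, W z -> cabs (g z) <= B.
Proof.
move=> Wo WB cg dg gB z1 Wz1; rewrite leNgt; apply/negP => gz1.
have clB := ccl_bounded WB.
have [||zm [clzm zmM]] := closed_max (u := fun z => cabs (g z)) _ clB (@ccl_closed W).
- by exists z1; exact: ccl_sub.
- by move=> z /cg/ccont_cabs_usc H e /H[d [d0 Hd]]; exists d; split=> // w _; exact: Hd.
set m := cabs (g zm) in zmM.
have mB : B < m by rewrite (lt_le_trans gz1)// zmM//; exact: ccl_sub.
pose E := [set z | ccl W z /\ m <= cabs (g z)].
have EB z : E z -> cabs z <= B0 + 1 by case=> /clB.
have Ec : cclosed E.
  move=> z nE; have [clz|/(@ccl_closed W)[d [d0 H]]] := pselect (ccl W z); last first.
    by exists d; split=> // w /H h [].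
  have gm : cabs (g z) < m by rewrite ltNge; apply/negP => ?; exact: nE.
  have [|d [d0 Hd]] := ccont_cabs_usc (cg z clz) (e := m - cabs (g z)); first by lra.
  by exists d; split=> // w /Hd gw [_]; lra.
(* A point away from the closure of [W], so that [c = z0 - q] has modulus at least 1. *)
pose q : C := (B0 + 3)%:C%C.
have [||z0 [[clz0 mz0] z0q]] := closed_max (u := fun z => cabs (z - q)) _ EB Ec.
- by exists zm.
- move=> z _ e e0; exists e; split=> // w _ wz.
  by have := cabs_tri w z q; lra.
have Wz0 : W z0 by apply: contrapT => /(gB _ clz0); lra.
have B00 : 0 <= B0 + 1 by apply: le_trans (clB _ clz0); exact: cabs_ge0.
pose c := z0 - q.
have c1 : 1 <= cabs c.
  have := cabsB_ge q z0; rewrite cabsBC -/c cabsr ger0_norm; last by lra.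
  by have := clB _ clz0; lra.
have [r [r0 rW]] := Wo z0 Wz0.
have [|h [h0 hr h1]] := @pos_min2 R (r / 4) 1 _ ltr01; first by lra.
(* The scalar product of [c] and [z - z0]. It governs both the distance from [z] to [q] and the
   modulus of the factor [p e z], whose value at [z0] is 1. *)
pose cr (z : C) := complex.Re c * complex.Re (z - z0) + complex.Im c * complex.Im (z - z0).
pose p (e : R) (z : C) : C := 1 + e%:C%C * (c^*)%C * (z - z0).
have cabsJ (z : C) : cabs (z^*)%C = cabs z by case: z => x y; rewrite /cabs /= sqrrN.
have p2 e z : cabs (p e z) ^+ 2 = 1 + 2 * e * cr z + (e * cabs c * cabs (z - z0)) ^+ 2.
  rewrite /p sqrD cabs1 !cabsM cabsJ cabsr !exprMn real_normK ?num_real//.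
  rewrite expr1n; congr (_ + _ + _); rewrite /cr.
  case: (z - z0) => [x y]; case: (c) => [u v] /=; ring.
have sqW z : cabs (z - z0) <= h + h -> W z.
  by move=> hz; apply: rW; rewrite /cball /=; lra.
have le_m z : cabs (z - z0) <= h + h -> cabs (g z) <= m.
  by move=> /sqW/ccl_sub/zmM.
(* The part of the ring h <= |z - z0| <= 2 h where |z - q|^2 = |c|^2 + 2 cr z + |z - z0|^2 >= |c|^2
   + h^2 / 2. Its points are farther from [q] than [z0], so |g| < m there, with a uniform gap by
   compactness. On the rest of the ring [cr] is so negative that |p e z| < 1 for small [e]. *)
pose K2 := [set z | h <= cabs (z - z0)] `&` ([set z | - (h + h) <= - cabs (z - z0)] `&`
   [set z | - h ^+ 2 / 4 <= cr z]).
have [m' [m'0 m'm Hm']] : exists m', [/\ 0 <= m', m' < m & forall z, K2 z -> cabs (g z) <= m'].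
  (* If |g z1| were 0, then [B < 0] and [W] would equal its closure; a point of [W] with largest
     real part then contradicts openness. *)
  have m0 : 0 < m.
    apply: (@lt_le_trans _ _ (cabs (g z1))); last by rewrite zmM//; exact: ccl_sub.
    rewrite lt_def cabs_ge0 andbT; apply/eqP => g10; move: gz1; rewrite g10 => B0'.
    have : (forall z, ccl W z -> W z).
      by move=> z clz; apply: contrapT => /(gB _ clz); have := cabs_ge0 (g z); lra.
    move=> clW.
    have [||zz [clzz zzM]] := closed_max (u := fun z => complex.Re z) _ clB (@ccl_closed W).
    - by exists z1; exact: ccl_sub.
    - move=> z _ e e0; exists e; split=> // w _ wz.
      have := Re_le_cabs (w - z); rewrite creB ler_norml => /andP[_ ?]; lra.
    have [rr [rr0 rrW]] := Wo zz (clW zz clzz).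
    have := zzM (zz + (rr / 2)%:C%C).
    rewrite creD /= => H.
    have : complex.Re zz + rr / 2 <= complex.Re zz.
      apply: H; apply: ccl_sub; apply: rrW; rewrite /cball /= [_ + _ - _]addrAC subrr add0r.
      by rewrite cabsr ger0_norm; lra.
    by lra.
  have [nK2|] := pselect (K2 !=set0); last first.
    by move=> n; exists 0; split=> // z K2z; exfalso; apply: n; exists z.
  have [|||zk [K2k zkM]] := closed_max (K := K2) (u := fun z => cabs (g z)) (B := B0 + 1) nK2.
  - move=> z [_ [/= hz _]]; apply: clB; apply: ccl_sub; apply: sqW; lra.
  - apply: cclosedI.
      apply: (@cclosed_ge _ _ _ 1) => // z w.
      by have := cabs_tri w z z0; lra.
    apply: cclosedI.
      apply: (@cclosed_ge _ _ _ 1) => // z w.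
      by have := cabs_tri z w z0; rewrite (cabsBC z w); lra.
    apply: (@cclosed_ge _ _ _ (2 * cabs c)); first by lra.
    move=> z w.
    have -> : cr w = cr z + (complex.Re c * complex.Re (w - z) + complex.Im c * complex.Im (w - z)).
      by rewrite /cr !creB !cimB; ring.
    rewrite lerD2l mulr2n !mulrDl !mul1r lerD//; apply: (le_trans (ler_norm _)); rewrite normrM.
      by rewrite ler_pM ?Re_le_cabs.
    by rewrite ler_pM ?Im_le_cabs.
  - move=> z [_ [/= hz _]] e e0.
    have [||d [d0 Hd]] := @ccont_cabs_usc _ g z _ e => //.
      by apply: cg; apply: ccl_sub; apply: sqW; lra.
    by exists d; split=> // w _; exact: Hd.
  exists (cabs (g zk)); split=> //; first exact: cabs_ge0.
  rewrite ltNge; apply/negP => mk; have [/= k1 [/= k2 k3]] := K2k.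
  have Ezk : E zk by split=> //; apply: ccl_sub; apply: sqW; lra.
  have := z0q zk Ezk.
  have : cabs (z0 - q) ^+ 2 < cabs (zk - q) ^+ 2.
    rewrite (_ : zk - q = c + (zk - z0)); last by rewrite /c; ring.
    rewrite -/c sqrD -/(cr zk).
    have : h ^+ 2 <= cabs (zk - z0) ^+ 2 by rewrite lerXn2r ?nnegrE ?cabs_ge0// ltW.
    have : 0 < h ^+ 2 by rewrite exprn_gt0.
    by move: k3; lra.
  by move=> lt le; move: lt; rewrite ltNge lerXn2r ?nnegrE ?cabs_ge0.
have m0 : 0 < m by lra.
have cc0 : 0 < cabs c by lra.
(* The first bound keeps the square term of [p2] below e h^2 / 4, half of what a negative [cr]
   gains; the second keeps [m'] times |p e z| below [m] on [K2]. *)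
have [||e [e0 e1 e2]] := @pos_min2 R (1 / (16 * cabs c ^+ 2)) ((m - m') / (4 * m * cabs c)).
- by rewrite divr_gt0 ?mulr_gt0 ?exprn_gt0.
- by rewrite divr_gt0 ?mulr_gt0 ?subr_gt0.
move: e1 e2; rewrite ler_pdivlMr ?mulr_gt0 ?exprn_gt0// ler_pdivlMr ?mulr_gt0// => e1 e2.
have pz0 : p e z0 = 1 by rewrite /p subrr mulr0 addr0.
have bound z : bsqr (complex.Re z0) (complex.Im z0) h z ->
    cabs (g z * p e z) <= Num.max (m * (1 - e * h ^+ 2 / 8)) (m' * (1 + e * cabs c * (2 * h))).
  move=> hz.
  have zz0 : ((complex.Re z0 +i* complex.Im z0)%C : C) = z0 by case: (z0).
  have := bsqr_ge (ltW h0) hz; rewrite zz0 => zl.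
  have := sqr_le (proj1 hz); rewrite zz0 => zu.
  rewrite cabsM le_max; have [K2z|nK2z] := pselect (K2 z).
    apply/orP; right; apply: ler_pM; rewrite ?cabs_ge0 ?Hm'//.
    rewrite /p (le_trans (cabsD _ _))// cabs1 lerD2l !cabsM cabsJ cabsr (gtr0_norm e0).
    have ec0 : 0 <= e * cabs c by rewrite mulr_ge0 ?cabs_ge0// ltW.
    by rewrite ler_wpM2l//; lra.
  have crz : cr z < - h ^+ 2 / 4.
    by rewrite ltNge; apply/negP => crz; apply: nK2z; split=> //; split=> //=; lra.
  apply/orP; left; apply: ler_pM; rewrite ?cabs_ge0 ?le_m//.
  have hh0 : 0 < h ^+ 2 by rewrite exprn_gt0.
  have hh1 : h ^+ 2 <= 1 by rewrite expr_le1// ltW.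
  have ele : e <= 1.
    have : 1 <= cabs c ^+ 2 by rewrite exprn_ege1.
    by move: e1 (e0); clear; move: (cabs c ^+ 2) => C2; nra.
  have eh : 0 <= 1 - e * h ^+ 2 / 8 by nra.
  rewrite -(@ler_pXn2r _ 2)// ?nnegrE ?cabs_ge0// p2.
  have : (e * cabs c * cabs (z - z0)) ^+ 2 <= e * h ^+ 2 / 4.
    have -> : e * h ^+ 2 / 4 = (e * (1 / 16)) * (4 * h ^+ 2) by field.
    rewrite exprMn ler_pM ?sqr_ge0//.
      by rewrite exprMn expr2 -mulrA ler_wpM2l ?(ltW e0)//; lra.
    rewrite (_ : 4 * h ^+ 2 = (h + h) ^+ 2); last by ring.
    by rewrite lerXn2r ?nnegrE ?cabs_ge0//; lra.
  have : e * cr z <= e * (- h ^+ 2 / 4) by rewrite ler_wpM2l ?ltW.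
  have : 0 <= (e * h ^+ 2 / 8) ^+ 2 by rewrite sqr_ge0.
  rewrite [X in _ -> _ -> _ -> _ <= X](_ : _ = 1 - e * h ^+ 2 / 4 + (e * h ^+ 2 / 8) ^+ 2); last by field.
  lra.
have := @square_max _ (fun z => g z * p e z) (complex.Re z0) (complex.Im z0) h _ h0 _ bound.
have -> : ((complex.Re z0 +i* complex.Im z0)%C : C) = z0 by case: (z0).
rewrite pz0 mulr1 => H.
have : cabs (g z0) <= Num.max (m * (1 - e * h ^+ 2 / 8)) (m' * (1 + e * cabs c * (2 * h))).
  apply: H => z hz.
  have := sqr_le hz; have -> : ((complex.Re z0 +i* complex.Im z0)%C : C) = z0 by case: (z0).
  move=> /sqW/dg[l dl]; eexists; apply: has_cdM; first exact: dl.
  apply: has_cdD; first exact: has_cd_cst.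
  apply: has_cdM; first exact: has_cd_cst.
  by apply: has_cdB; [exact: has_cd_id|exact: has_cd_cst].
have hh0 : 0 < h ^+ 2 by rewrite exprn_gt0.
have eh0 : 0 < e * h ^+ 2 by rewrite mulr_gt0.
rewrite le_max => /orP[].
  by move=> ?; have := mulr_gt0 m0 eh0; lra.
move=> ?.
have : m' * (e * cabs c * (2 * h)) <= m * (e * cabs c * 2).
  have ec0 : 0 <= e * cabs c by rewrite mulr_ge0 ?cabs_ge0// ltW.
  apply: ler_pM => //; [|exact: ltW|].
    by rewrite mulr_ge0//; lra.
  by rewrite ler_wpM2l//; lra.
lra.
Qed.

End MaxPrinciple.

(** * Cauchy-type estimates from the maximum principle *)

Section Estimates.
Variable R : realType.
Local Notation C := (R[i]).

Lemma has_cd_mul_vanish (H : C -> C) p : ccont H p ->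
  has_cd (fun z => H z * (z - p)) p (H p).
Proof.
move=> cH e /cH[d [d0 Hd]]; exists d; split=> // w /Hd /ltW hw.
rewrite subrr mulr0 subr0 -mulrBl cabsM.
by rewrite ler_wpM2r ?cabs_ge0.
Qed.

(* Points where g is merely continuous are harmless: g^n * (z - p) is
   differentiable at p, and the factor z - p disappears as n grows. *)
Lemma max_principle (S : seq C) (W : set C) (g : C -> C) B B0 :
  copen W -> (forall z, W z -> cabs z <= B0) ->
  (forall z, ccl W z -> ccont g z) ->
  (forall z, W z -> z \notin S -> exists l, has_cd g z l) ->
  0 <= B -> (forall z, ccl W z -> ~ W z -> cabs (g z) <= B) ->
  forall z, W z -> cabs (g z) <= B.
Proof.
move=> Wo WB; elim: S g B => [|p S IH] g B cg dg B_0 gB.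
  apply: (max_principle0 Wo WB cg _ gB) => z Wz; exact: dg.
have offp z : W z -> z != p -> cabs (g z) <= B.
  move=> Wz zp; have D0 : 0 < cabs (z - p) by rewrite cabs_gt0 subr_eq0.
  have clD v : ccl W v -> cabs (v - p) <= B0 + 1 + cabs p.
    by move=> /(ccl_bounded WB) vB; rewrite (le_trans (cabsB_le _ _))// lerD2r.
  have D1 : 0 <= B0 + 1 + cabs p.
    by apply: le_trans (clD z _); [exact: cabs_ge0|exact: ccl_sub].
  apply: (@pow_trick _ _ _ ((B0 + 1 + cabs p) / cabs (z - p))); rewrite ?cabs_ge0//.
    by rewrite divr_ge0 ?cabs_ge0.
  move=> n; rewrite mulrAC ler_pdivlMr// -cabsX -cabsM.
  apply: (IH (fun z => g z ^+ n * (z - p))) => //.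
  - move=> v clv; apply: ccontM; first by apply: ccontX; exact: cg.
    by apply: ccontB; [exact: ccont_id|exact: ccont_cst].
  - move=> v Wv vS; have [vp|vp] := eqVneq v p.
      exists (g p ^+ n); rewrite vp; apply: (@has_cd_mul_vanish (fun z => g z ^+ n)).
      by apply: ccontX; apply: cg; rewrite -vp; exact: ccl_sub.
    have [|l dl] := dg v Wv; first by rewrite inE negb_or vp.
    eexists; apply: has_cdM; first exact: has_cdX dl.
    by apply: has_cdB; [exact: has_cd_id|exact: has_cd_cst].
  - by rewrite mulr_ge0// exprn_ge0.
  - move=> v clv nWv; rewrite cabsM cabsX mulrC ler_pM ?exprn_ge0 ?cabs_ge0 ?clD//.
    by rewrite lerXn2r ?nnegrE ?cabs_ge0 ?gB.
move=> z Wz; have [zp|zp] := eqVneq z p; last exact: offp.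
(* At [p] itself the bound follows by continuity from the nearby points [z + h / 2]. *)
rewrite leNgt; apply/negP => Bz.
have [|d [d0 Hd]] := cg z (ccl_sub Wz) (cabs (g z) - B); first by lra.
have [r [r0 Wr]] := Wo z Wz.
have [h [h0 hd hr]] := pos_min2 d0 r0.
have hz : cabs (z + (h / 2)%:C%C - z) = h / 2.
  by rewrite addrAC subrr add0r cabsr ger0_norm//; lra.
have := offp (z + (h / 2)%:C%C); rewrite -zp -subr_eq0 -cabs_gt0 hz => H.
have : cabs (g (z + (h / 2)%:C%C)) <= B.
  by apply: H; [apply: Wr; rewrite /cball /= hz; lra|lra].
have := Hd (z + (h / 2)%:C%C); rewrite hz => H2.
have : cabs (g (z + (h / 2)%:C%C) - g z) < cabs (g z) - B by apply: H2; lra.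
have := cabsB_ge (g z) (g (z + (h / 2)%:C%C)); rewrite cabsBC; lra.
Qed.

(** If [g] had no zero, its inverse would break the maximum principle. This takes the place of
    Rouche's theorem: preimages under [f] are found as zeros in this way. *)
Lemma min_principle (W : set C) (g : C -> C) m B0 z0 :
  copen W -> (forall z, W z -> cabs z <= B0) ->
  (forall z, ccl W z -> ccont g z) ->
  (forall z, W z -> exists l, has_cd g z l) ->
  0 < m -> (forall z, ccl W z -> ~ W z -> m <= cabs (g z)) ->
  W z0 -> cabs (g z0) < m -> exists z, W z /\ g z = 0.
Proof.
move=> Wo WB cg dg m0 gm Wz0 gz0; apply: contrapT => /forallNP nz.
have g0 z : ccl W z -> g z != 0.
  move=> clz; have [Wz|/(gm _ clz)] := pselect (W z).
    by apply/eqP => gz; exact: (nz z).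
  by rewrite -cabs_gt0; apply: lt_le_trans.
have : cabs (g z0)^-1 <= m^-1.
  apply: (@max_principle [::] W (fun z => (g z)^-1) m^-1 B0) => //.
  - by move=> z clz; apply: ccontV; [exact: g0|exact: cg].
  - move=> z Wz _; have [l dl] := dg z Wz; eexists.
    by apply: has_cdV; [apply: g0; exact: ccl_sub|exact: dl].
  - by rewrite invr_ge0 ltW.
  - move=> z clz nWz; rewrite cabsV lef_pV2 ?posrE ?gm//.
    by rewrite cabs_gt0 g0.
rewrite cabsV lef_pV2 ?posrE//; last by rewrite cabs_gt0 g0//; exact: ccl_sub.
by rewrite leNgt gz0.
Qed.

Lemma cball_open a (r : R) : copen (cball a r : set C).
Proof.
move=> z; rewrite /cball /= => zr; exists (r - cabs (z - a)); split; first by lra.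
by move=> w; rewrite /cball /= => wz; have := cabs_tri w z a; lra.
Qed.

Lemma ccl_cball a r z : ccl (cball a r : set C) z -> cabs (z - a) <= r.
Proof.
move=> clz; rewrite leNgt; apply/negP => rz.
have [|w [wr wz]] := clz (cabs (z - a) - r); first by lra.
rewrite /cball /= in wr.
by have := cabs_tri z w a; rewrite (cabsBC z w); lra.
Qed.

Lemma cball_bounded (a : C) r z : cball a r z -> cabs z <= cabs a + r.
Proof. by rewrite /cball /= => zr; have := cabsB_ge z a; lra. Qed.

Lemma disc_max (S : seq C) (g : C -> C) a r B : 0 <= B ->
  (forall z, cabs (z - a) <= r -> ccont g z) ->
  (forall z, cabs (z - a) < r -> z \notin S -> exists l, has_cd g z l) ->
  (forall z, cabs (z - a) = r -> cabs (g z) <= B) ->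
  forall z, cabs (z - a) <= r -> cabs (g z) <= B.
Proof.
move=> B0 cg dg gB z; rewrite le_eqVlt => /predU1P[|zr]; first exact: gB.
apply: (@max_principle S (cball a r) g B (cabs a + r)) => //.
- exact: cball_open.
- exact: cball_bounded.
- by move=> v /ccl_cball; exact: cg.
- move=> v /ccl_cball vr /negP; rewrite -leNgt => rv.
  by apply: gB; apply/eqP; rewrite eq_le vr.
Qed.

Lemma disc_zero (g : C -> C) a r m z0 : 0 < m ->
  (forall z, cabs (z - a) <= r -> exists l, has_cd g z l) ->
  (forall z, cabs (z - a) = r -> m <= cabs (g z)) ->
  cabs (z0 - a) < r -> cabs (g z0) < m -> exists z, cabs (z - a) < r /\ g z = 0.
Proof.
move=> m0 dg gm z0r gz0.
apply: (@min_principle (cball a r) g m (cabs a + r) z0) => //.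
- exact: cball_open.
- exact: cball_bounded.
- by move=> v /ccl_cball/dg[l /has_cd_ccont].
- by move=> z /ltW/dg.
- move=> v /ccl_cball vr /negP; rewrite -leNgt => rv.
  by apply: gm; apply/eqP; rewrite eq_le vr.
Qed.

(** The difference quotient, completed by [l] on the diagonal. Only its continuity is shown at [y];
    this is why [max_principle] admits a list [S] of points without differentiability. *)
Definition dquot (g : C -> C) (l y x : C) : C :=
  if x == y then l else (g x - g y) * (x - y)^-1.

Lemma dquot_mul g l y x : dquot g l y x * (x - y) = g x - g y.
Proof.
rewrite /dquot; case: eqVneq => [->|xy]; first by rewrite !subrr mulr0.
by rewrite mulfVK// subr_eq0.
Qed.

Lemma dquot_near g l y x0 : x0 != y -> exists r, 0 < r /\
  forall w, cabs (w - x0) < r -> (g w - g y) * (w - y)^-1 = dquot g l y w.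
Proof.
move=> xy; exists (cabs (x0 - y)); rewrite cabs_gt0 subr_eq0; split=> // w.
by rewrite /dquot; case: eqVneq => // ->; rewrite cabsBC ltxx.
Qed.

Lemma dquot_cd g l y x k : x != y -> has_cd g x k ->
  exists m, has_cd (dquot g l y) x m.
Proof.
move=> xy dg; have [r [r0 H]] := dquot_near g l xy.
have [m dm] := has_cd_dq xy dg.
by exists m; exact: has_cd_ext r0 H dm.
Qed.

Lemma dquot_cont g l y : has_cd g y l -> ccont (dquot g l y) y.
Proof.
move=> dg e e0; have [|d [d0 Hd]] := dg (e / 2); first by lra.
exists d; split=> // w wd; rewrite {2}/dquot eqxx.
rewrite /dquot; case: eqVneq => [_|wy]; first by rewrite subrr cabs0.
have wp : 0 < cabs (w - y) by rewrite cabs_gt0 subr_eq0.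
rewrite -(ltr_pM2r wp) -cabsM mulrBl mulfVK ?subr_eq0//.
apply: le_lt_trans (Hd w wd) _; rewrite ltr_pM2r//; lra.
Qed.

Lemma dquot_ccont g l y x k : has_cd g y l -> has_cd g x k -> ccont (dquot g l y) x.
Proof.
move=> dy dx; have [->|xy] := eqVneq x y; first exact: dquot_cont.
by have [m /has_cd_ccont] := dquot_cd l xy dx.
Qed.

Lemma dist_half (a y x : C) s : cabs (y - a) <= s / 2 -> cabs (x - a) = s ->
  s / 2 <= cabs (x - y).
Proof. by move=> ya xa; have := cabs_tri x y a; lra. Qed.

Section OnDisc.
Variables (H : C -> C) (H' : C -> C) (a : C) (s B : R).
Hypotheses (s0 : 0 < s) (B0 : 0 <= B).
Hypothesis dH : forall z, cabs (z - a) <= s -> has_cd H z (H' z).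
Hypothesis HB : forall z, cabs (z - a) <= s -> cabs (H z) <= B.

Let Q y x := dquot H (H' y) y x.

(** On the circle |x - a| = s the denominator is at least s / 2 and the numerator at most 2 B. The
    maximum principle carries the bound 4 B / s inside, with exceptional point [y]. *)
Lemma disc_dquot_bound y x : cabs (y - a) <= s / 2 -> cabs (x - a) <= s ->
  cabs (Q y x) <= 4 * B / s.
Proof.
move: (s0) (B0) => sp Bp.
move=> ya; have ys : cabs (y - a) <= s by lra.
apply: (@disc_max [:: y] (Q y) a s).
- by rewrite divr_ge0 ?mulr_ge0// ltW.
- by move=> z /dH; apply: dquot_ccont; exact: dH.
- by move=> z /ltW/dH dz; rewrite inE => zy; exact: dquot_cd zy dz.
- move=> z zs; have zy := dist_half ya zs; have p0 : 0 < cabs (z - y) by lra.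
  have : z != y by rewrite -subr_eq0 -cabs_gt0.
  rewrite /Q /dquot => /negbTE ->; rewrite cabsM cabsV ler_pdivrMr//.
  apply: (@le_trans _ _ (2 * B)).
    rewrite (le_trans (cabsB_le _ _))// mulr2n mulrDl !mul1r lerD// HB//; lra.
  rewrite mulrAC ler_pdivlMr//; nra.
Qed.

Lemma disc_lipschitz y x : cabs (y - a) <= s / 2 -> cabs (x - a) <= s ->
  cabs (H x - H y) <= 4 * B / s * cabs (x - y).
Proof.
move: (s0) (B0) => sp Bp.
move=> ya xa; rewrite -(dquot_mul H (H' y)) cabsM.
by rewrite ler_wpM2r ?cabs_ge0// disc_dquot_bound.
Qed.

Lemma disc_deriv_bound y : cabs (y - a) <= s / 2 -> cabs (H' y) <= 4 * B / s.
Proof.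
move: (s0) (B0) => sp Bp.
move=> ya; have -> : H' y = Q y y by rewrite /Q /dquot eqxx.
by apply: disc_dquot_bound => //; lra.
Qed.

(** The same argument for the quotient of [Q y], now with two exceptional points: (8 B / s) / (s /
    2) = 16 B / s^2. The base point [u] must differ from [y] for [Q y] to be known differentiable
    there, so [x] and [x'] are exchanged when [x' = y]. *)
Lemma disc_dquot_lipschitz y x x' : cabs (y - a) <= s / 2 ->
  cabs (x - a) <= s / 2 -> cabs (x' - a) <= s / 2 ->
  cabs (Q y x - Q y x') <= 16 * B / s ^+ 2 * cabs (x - x').
Proof.
move: (s0) (B0) => sp Bp.
move=> ya; have ys : cabs (y - a) <= s by lra.
have main u v : u != y -> cabs (u - a) <= s / 2 -> cabs (v - a) <= s / 2 ->
    cabs (Q y v - Q y u) <= 16 * B / s ^+ 2 * cabs (v - u).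
  move=> uy ua va; have us : cabs (u - a) <= s by lra.
  have [k dk] := dquot_cd (H' y) uy (dH us).
  rewrite -(dquot_mul (Q y) k) cabsM ler_wpM2r ?cabs_ge0//.
  apply: (@disc_max [:: u; y] (dquot (Q y) k u) a s); last by lra.
  - by rewrite divr_ge0 ?exprn_ge0 ?mulr_ge0// ltW.
  - move=> z zs; have [->|zu] := eqVneq z u; first exact: dquot_cont.
    have [r [r0 Hr]] := dquot_near (Q y) k zu.
    apply: ccont_ext r0 Hr _; apply: ccontM.
      apply: ccontB; last exact: ccont_cst.
      by apply: dquot_ccont (dH zs); exact: dH.
    apply: ccontV; first by rewrite subr_eq0.
    by apply: ccontB; [exact: ccont_id|exact: ccont_cst].
  - move=> z /ltW zs; rewrite !inE negb_or => /andP[zu zy].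
    have [k' dk'] := dquot_cd (H' y) zy (dH zs).
    exact: dquot_cd zu dk'.
  - move=> z zs; have zu := dist_half ua zs; have p0 : 0 < cabs (z - u) by lra.
    have : z != u by rewrite -subr_eq0 -cabs_gt0.
    rewrite {1}/dquot => /negbTE ->; rewrite cabsM cabsV ler_pdivrMr//.
    apply: (@le_trans _ _ (8 * B / s)).
      rewrite (le_trans (cabsB_le _ _))//.
      have := disc_dquot_bound ya us; have : cabs (z - a) <= s by lra.
      move=> /(disc_dquot_bound ya); lra.
    have -> : 16 * B / s ^+ 2 * cabs (z - u) = (16 * B * cabs (z - u) / s) / s.
      by field; lra.
    rewrite ler_pM2r ?invr_gt0// ler_pdivlMr//; nra.
move=> xa x'a; have [xy|xy] := eqVneq x' y; last exact: main.
have [->|xy'] := eqVneq x x'; first by rewrite !subrr cabs0 mulr0.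
by rewrite cabsBC (cabsBC x); apply: main => //; rewrite -xy.
Qed.

(** By the symmetry [Q y a = Q a y], the quotient [Q y x] goes to [H' a = Q a a] in two moves, one
    variable at a time. This bound plays the role of a distortion theorem. *)
Lemma disc_second_order x y : cabs (x - a) <= s / 2 -> cabs (y - a) <= s / 2 ->
  cabs (H x - H y - H' a * (x - y)) <=
  16 * B / s ^+ 2 * (cabs (x - a) + cabs (y - a)) * cabs (x - y).
Proof.
move: (s0) (B0) => sp Bp.
move=> xa ya; rewrite -(dquot_mul H (H' y)) -mulrBl cabsM ler_wpM2r ?cabs_ge0//.
have aa : cabs (a - a) <= s / 2 by rewrite subrr cabs0; lra.
have sym : Q y a = Q a y.
  rewrite /Q /dquot eq_sym; case: eqVneq => [->//|_].
  by rewrite -(opprB (H y)) -(opprB y) invrN mulrNN.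
have -> : dquot H (H' y) y x - H' a = (Q y x - Q y a) + (Q a y - Q a a).
  by rewrite sym subrKA /Q /(dquot _ _ a a) eqxx.
rewrite (le_trans (cabsD _ _))// mulrDr lerD//.
  exact: disc_dquot_lipschitz.
exact: disc_dquot_lipschitz.
Qed.

End OnDisc.

End Estimates.

(** * Large values occur only near poles *)

Section Meromorphic.
Variable R : realType.
Local Notation C := (R[i]).
Variable f : C -> option C.
Hypothesis merf : meromorphic f.

Lemma fv_some z w : f z = Some w -> fv f z = w.
Proof. by rewrite /fv => ->. Qed.

Lemma some_fv z : f z <> None -> f z = Some (fv f z).
Proof. by rewrite /fv; case: (f z). Qed.

Lemma mero_regular z : f z <> None -> exists r, 0 < r /\
  forall w, cabs (w - z) < r -> f w <> None /\ exists l, has_cd (fv f) w l.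
Proof.
move=> fz; have [[r [r0 H]]|[m [_ [fN _]]]] := merf z; last by [].
exists r; split=> // w /H[fw dw]; split=> //; eexists; exact: derivable_has_cd.
Qed.

Lemma mero_cd z : f z <> None -> exists l, has_cd (fv f) z l.
Proof.
by move=> /mero_regular[r [r0 H]]; have [|] := H z; rewrite ?subrr ?cabs0.
Qed.

Lemma mero_cderiv z : f z <> None -> has_cd (fv f) z (cderiv (fv f) z).
Proof. by move=> /mero_cd[l dl]; have [_ ->] := has_cd_derivable dl. Qed.

Lemma mero_ccont z : f z <> None -> ccont (fv f) z.
Proof. by move=> /mero_cd[l /has_cd_ccont]. Qed.

Lemma mero_pole a : f a = None -> exists m, pole_of_order f a m.
Proof.
move=> fa; have [[r [r0 H]]|//] := merf a.
by have [|] := H a; rewrite /cball /= ?subrr ?cabs0.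
Qed.

Lemma pole_large a K : f a = None -> exists r, 0 < r /\ forall z,
  cabs (z - a) < r -> z != a -> f z <> None /\ K < cabs (fv f z).
Proof.
move=> /mero_pole[m [m0 [_ [r [r0 [g [hg [ga H]]]]]]]].
have cg : ccont g a.
  apply: has_cd_ccont (derivable_has_cd _); apply: hg.
  by rewrite /cball /= subrr cabs0.
have ga0 : 0 < cabs (g a) by rewrite cabs_gt0.
have [|d [d0 Hd]] := cg (cabs (g a) / 2); first by lra.
have K0 : 0 < `|K| + 1 by rewrite ltr_wpDl.
have [h1 [h10 h1r h1d]] := pos_min2 r0 d0.
have [||h [h0 hh hK]] := @pos_min2 _ (Num.min h1 1) (cabs (g a) / 2 / (`|K| + 1)).
- by rewrite lt_min h10 ltr01.
- by rewrite !divr_gt0.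
move: hh; rewrite le_min => /andP[hh1 h_1].
exists h; split=> // z za zna.
have zr : cball a r z by rewrite /cball /=; lra.
have fz := H z zr zna.
split; first by rewrite fz.
rewrite (fv_some fz) cabsM cabsV cabsX.
have p0 : 0 < cabs (z - a) by rewrite cabs_gt0 subr_eq0.
rewrite ltr_pdivlMr ?exprn_gt0//.
have zd : cabs (z - a) < d by lra.
have gz : cabs (g a) / 2 < cabs (g z).
  by have := Hd z zd; have := cabsB_ge (g a) (g z); rewrite cabsBC; lra.
apply: (le_lt_trans _ gz); apply: (@le_trans _ _ ((`|K| + 1) * cabs (z - a))).
  apply: (@le_trans _ _ ((`|K| + 1) * cabs (z - a) ^+ m)).
    by rewrite ler_wpM2r ?exprn_ge0 ?cabs_ge0// (le_trans (ler_norm _))// lerDl.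
  rewrite ler_pM2l// -[leRHS]expr1; case: m m0 {H fz} => // m _.
  by rewrite exprS expr1 ler_piMr ?cabs_ge0// exprn_ile1 ?cabs_ge0//; lra.
by move: hK; rewrite ler_pdivlMr// => hK; nra.
Qed.

Lemma poles_finite B : finite_set [set a | f a = None /\ cabs a <= B].
Proof.
suff : finite_set ([set z | cabs z <= B] `&` [set a | f a = None]).
  by apply: sub_finite_set => z [].
apply: (@compact_induction R (fun A => finite_set (A `&` [set a | f a = None]))).
- by move=> A A' AA'; apply: sub_finite_set => z [/AA' ? ?].
- by move=> A A' ? ?; rewrite setIUl finite_setU.
- move=> p; have [fp|fp] := pselect (f p = None).
    have [r [r0 H]] := pole_large 0 fp; exists r; split=> //.
    apply: (@sub_finite_set _ _ [set p]); last exact: finite_set1.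
    move=> z [zp fz]; apply: contrapT => /eqP zn.
    by have [] := H z zp zn.
  have [r [r0 H]] := mero_regular fp; exists r; split=> //.
  apply: (@sub_finite_set _ _ set0); last exact: finite_set0.
  by move=> z [/H[nz _] fz].
Qed.

(** Poles count as points of infinite modulus, which makes the set open. Its path components are the
    tracts over infinity. *)
Definition Om (K : R) : set C := [set z | f z = None \/ K < cabs (fv f z)].

Lemma Om_mono K K' : K <= K' -> Om K' `<=` Om K.
Proof. by move=> KK' z [fz|fz]; [left|right; exact: le_lt_trans fz]. Qed.

Lemma Om_open K : copen (Om K).
Proof.
move=> z Oz; have [fz|fz] := pselect (f z = None).
  have [r [r0 H]] := pole_large K fz; exists r; split=> // w wz.
  have [->|wn] := eqVneq w z; first by left.
  by right; have [] := H w wz wn.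
case: Oz => // Kz; have [|d [d0 Hd]] := mero_ccont fz (e := cabs (fv f z) - K).
  by lra.
exists d; split=> // w /Hd hw; right.
by have := cabsB_ge (fv f z) (fv f w); rewrite cabsBC; lra.
Qed.

End Meromorphic.

(** * Paths and path components *)

Section Paths.
Variable R : realType.
Local Notation C := (R[i]).

Definition pcont (u : R -> C) := forall t e, 0 < e -> exists d, 0 < d /\
  forall s, `|s - t| < d -> cabs (u s - u t) < e.

Lemma pcont_continuous u : pcont u -> continuous (u : R -> C^o).
Proof.
move=> cu t; apply/(@cvgrPdist_lt _ C^o) => e /ltC_split[r r0 ->].
have [d [d0 H]] := cu t r r0; rewrite near_simpl; apply/nbhs_ballP.
exists d => //= s; rewrite /ball /= => st; rewrite normE ltcR cabsBC.
by apply: H; rewrite distrC.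
Qed.

Lemma pcont_comp u (phi : R -> R) L : 0 < L ->
  (forall s t, `|phi s - phi t| <= L * `|s - t|) -> pcont u -> pcont (u \o phi).
Proof.
move=> L0 hphi cu t e e0; have [d [d0 H]] := cu (phi t) e e0.
exists (d / L); rewrite divr_gt0//; split=> // s st; apply: H.
by rewrite (le_lt_trans (hphi _ _))// mulrC -ltr_pdivlMr.
Qed.

Lemma pcont_cst c : pcont (fun _ => c).
Proof. by move=> t e e0; exists 1; split=> // s _; rewrite subrr cabs0. Qed.

Lemma pcontD u v : pcont u -> pcont v -> pcont (fun t => u t + v t).
Proof.
move=> cu cv t e e0; have [|d [d0 H]] := cu t (e / 2); first by lra.
have [|r [r0 Hr]] := cv t (e / 2); first by lra.
have [h [h0 hd hr]] := pos_min2 d0 r0; exists h; split=> // s st.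
have -> : u s + v s - (u t + v t) = (u s - u t) + (v s - v t) by ring.
rewrite (le_lt_trans (cabsD _ _))//.
have := H s (lt_le_trans st hd); have := Hr s (lt_le_trans st hr); lra.
Qed.

Lemma pcont_line (z w : C) : pcont (fun t => z + t%:C%C * w).
Proof.
move=> t e e0; have w0 : 0 < cabs w + 1 by rewrite ltr_wpDl ?cabs_ge0.
exists (e / (cabs w + 1)); rewrite divr_gt0//; split=> // s st.
have -> : z + s%:C%C * w - (z + t%:C%C * w) = (s - t)%:C%C * w by rewrite rmorphB /=; ring.
rewrite cabsM cabsr; move: st; rewrite ltr_pdivlMr//; apply: le_lt_trans.
by rewrite ler_wpM2l// lerDl.
Qed.

(** Freezing paths outside [0, 1] allows concatenation as a sum: while one summand moves the others
    are constant, so continuity needs no case distinction. *)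
Definition clamp (t : R) : R := Num.max 0 (Num.min 1 t).

Lemma clamp_lip s t : `|clamp s - clamp t| <= `|s - t|.
Proof.
have h (x : R) : clamp x = if x <= 0 then 0 else if x <= 1 then x else 1.
  rewrite /clamp; case: (leP x 0) => x0; case: (leP 1 x) => x1 //.
  - by exfalso; lra.
  - by rewrite max_l.
  - by rewrite max_r//; case: ifPn => // ?; lra.
  - by rewrite max_r ?(ltW x1) ?(ltW x0)//.
rewrite !h; case: (leP s 0) => s0; case: (leP t 0) => t0;
  case: (leP s 1) => s1; case: (leP t 1) => t1; rewrite ?subrr ?normr0//;
  rewrite ler_norml; apply/andP; split;
  (have [st|st] := lerP 0 (s - t); [rewrite (ger0_norm st)|rewrite (ltr0_norm st)]); lra.
Qed.

Lemma clamp0 t : t <= 0 -> clamp t = 0.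
Proof. by move=> t0; rewrite /clamp max_l// ge_min t0 orbT. Qed.
Lemma clamp1 t : 1 <= t -> clamp t = 1.
Proof. by move=> t0; rewrite /clamp min_l// max_r. Qed.
Lemma clampid t : 0 <= t <= 1 -> clamp t = t.
Proof. by move=> /andP[? ?]; rewrite /clamp min_r// max_r. Qed.
Lemma clamp_itv t : 0 <= clamp t <= 1.
Proof. by rewrite /clamp le_max lexx ge_max ler01 ge_min lexx. Qed.

Definition conn (O : set C) (z w : C) := exists u, [/\ pcont u, u 0 = z, u 1 = w &
  forall t, 0 <= t <= 1 -> O (u t)].

Lemma conn_refl (O : set C) z : O z -> conn O z z.
Proof. by move=> Oz; exists (fun _ => z); split=> //; exact: pcont_cst. Qed.

Lemma conn_mono (O O' : set C) z w : O `<=` O' -> conn O z w -> conn O' z w.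
Proof. by move=> OO' [u [? ? ? H]]; exists u; split=> // t /H/OO'. Qed.

Lemma conn_trans O z w v : conn O z w -> conn O w v -> conn O z v.
Proof.
move=> [u [cu u0 u1 Ou]] [y [cy y0 y1 Oy]].
exists (fun t => u (clamp (2 * t)) + (y (clamp (2 * t - 1)) + (- w))); split.
- apply: pcontD.
    apply: (@pcont_comp u (fun t => clamp (2 * t)) 2) => // s t.
    by rewrite (le_trans (clamp_lip _ _))// -mulrBr normrM gtr0_norm.
  apply: pcontD; last exact: pcont_cst.
  apply: (@pcont_comp y (fun t => clamp (2 * t - 1)) 2) => // s t.
  rewrite (le_trans (clamp_lip _ _))//.
  have -> : 2 * s - 1 - (2 * t - 1) = 2 * (s - t) by ring.
  by rewrite normrM gtr0_norm.
- by rewrite !clamp0 ?u0 ?y0 ?subrr ?addr0//; lra.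
- by rewrite !clamp1 ?u1 ?y1//; [ring|lra|lra].
- move=> t ht; have [t2|t2] := leP (2 * t) 1.
    by rewrite [clamp (_ - _)]clamp0 ?y0 ?subrr ?addr0; [apply: Ou; exact: clamp_itv|lra].
  rewrite clamp1 ?u1; last by lra.
  by rewrite addrCA subrr addr0; apply: Oy; exact: clamp_itv.
Qed.

Lemma conn_ball O z r w : cball z r `<=` O -> cball z r w -> conn O z w.
Proof.
rewrite /cball /= => zO wr; exists (fun t => z + t%:C%C * (w - z)); split.
- exact: pcont_line.
- by rewrite mul0r addr0.
- by rewrite mul1r addrCA subrr addr0.
- move=> t /andP[t0 t1]; apply: zO; rewrite /= addrAC subrr add0r cabsM cabsr ger0_norm//.
  by apply: le_lt_trans wr; rewrite ler_piMl ?cabs_ge0.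
Qed.

Lemma conn_sym O z w : conn O z w -> conn O w z.
Proof.
move=> [u [cu u0 u1 Ou]]; exists (fun t => u (1 - t)); split.
- apply: (@pcont_comp u (fun t => 1 - t) 1) => // s t.
  have -> : 1 - s - (1 - t) = t - s by ring.
  by rewrite mul1r distrC.
- by rewrite subr0.
- by rewrite subrr.
- by move=> t ht; apply: Ou; lra.
Qed.

Lemma conn_path O z (u : R -> C) t : pcont u -> u 0 = z -> 0 <= t <= 1 ->
  (forall s, 0 <= s <= 1 -> O (u s)) -> conn O z (u t).
Proof.
move=> cu u0 /andP[t0 t1] Ou; exists (fun s => u (t * s)); split.
- apply: (@pcont_comp u (fun s => t * s) 1) => // s s'.
  by rewrite -mulrBr normrM ger0_norm// ler_wpM2r.
- by rewrite mulr0.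
- by rewrite mulr1.
- move=> s /andP[s0 s1]; apply: Ou; rewrite mulr_ge0//=.
  by rewrite mulr_ile1.
Qed.

Lemma conn_cross O z a r : conn O z a -> 0 < r -> r <= cabs (z - a) ->
  exists w, O w /\ cabs (w - a) = r.
Proof.
move=> [u [cu u0 u1 Ou]] r0 rz.
have cv : continuous (fun t => cabs (u t - a)).
  move=> t; apply/cvgrPdist_lt => e e0; have [d [d0 H]] := cu t e e0.
  rewrite near_simpl; apply/nbhs_ballP; exists d => //= s; rewrite /ball /= => st.
  have := H s; rewrite distrC => /(_ st) us.
  rewrite ltr_norml; have := cabs_tri (u t) (u s) a; have := cabs_tri (u s) (u t) a.
  by rewrite (cabsBC (u t) (u s)); lra.
have [||c] := @IVT R (fun t => cabs (u t - a)) 0 1 r ler01.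
- exact: continuous_subspaceT.
- by rewrite u0 u1 subrr cabs0 min_r ?cabs_ge0// max_l ?cabs_ge0// (ltW r0).
rewrite in_itv /= => c01 <-; exists (u c); split=> //; exact: Ou.
Qed.

End Paths.

Section Tracts.
Variable R : realType.
Local Notation C := (R[i]).
Variable f : C -> option C.
Hypothesis merf : meromorphic f.
Hypothesis tranf : transcendental f.

(** Liouville's theorem. On the disc of radius [L + cabs x] the Lipschitz estimate bounds |f x - f
    0| by 4 B |x| / (L + |x|), and [L] is chosen to make this smaller than a supposed nonzero
    difference [c]. *)
Lemma bounded_entire_rational B : (forall z, f z <> None /\ cabs (fv f z) <= B) ->
  rational_fun f.
Proof.
move=> H.
have B0 : 0 <= B by apply: le_trans (proj2 (H 0)); exact: cabs_ge0.
have cst x : fv f x = fv f 0.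
  apply/eqP; rewrite -subr_eq0 -cabs_eq0; apply: contrapT => /negP c0.
  have {}c0 : 0 < cabs (fv f x - fv f 0) by rewrite lt_def c0 cabs_ge0.
  set c := cabs _ in c0; set L := 8 * (B + 1) * (cabs x + 1) / c.
  have x0 := cabs_ge0 x.
  have L0 : 0 < L + cabs x.
    by rewrite ltr_wpDr// divr_gt0// !mulr_gt0//; lra.
  have := @disc_lipschitz _ (fv f) (cderiv (fv f)) 0 (L + cabs x) B L0 B0 _ _ 0 x.
  rewrite -/c !subr0 cabs0 => H1.
  have : c <= 4 * B / (L + cabs x) * cabs x.
    apply: H1; [|by move=> z _; have [] := H z|by lra|].
      by move=> z _; apply: mero_cderiv => //; have [] := H z.
    by rewrite lerDr divr_ge0 ?mulr_ge0//; lra.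
  rewrite mulrAC ler_pdivlMr// mulrDr.
  have -> : c * L = 8 * (B + 1) * (cabs x + 1) by rewrite /L; field; lra.
  have : 0 <= c * cabs x by rewrite mulr_ge0// ltW.
  by nra.
exists (fv f 0)%:P, 1; rewrite oner_neq0; split=> // z _.
by rewrite !hornerE divr1 (some_fv (proj1 (H z))) cst.
Qed.

(* Phragmen-Lindelof: at a boundary point p of the tract |f| is at most K, and
   f^n / (z - p) is small on large circles. *)
Lemma tract_unbounded K z0 : 0 < K -> Om f K z0 ->
  (forall w, conn (Om f K) z0 w -> f w <> None) ->
  forall B, exists w, conn (Om f K) z0 w /\ B < cabs (fv f w).
Proof.
move=> K0 Oz0 npole B1; apply: contrapT => /forallNP nw.
pose U := conn (Om f K) z0.
have Uz0 : U z0 by exact: conn_refl.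
pose B := Num.max B1 K.
have UB w : U w -> cabs (fv f w) <= B.
  move=> Uw; rewrite le_max; apply/orP; left; rewrite leNgt; apply/negP => ?.
  by apply: (nw w); split.
have BK : K <= B by rewrite le_max lexx orbT.
have UO w : U w -> Om f K w by move=> [u [_ _ <- H]]; apply: H; lra.
have Uopen : copen U.
  move=> z Uz; have [r [r0 rO]] := Om_open merf (UO z Uz).
  by exists r; split=> // w wr; apply: conn_trans Uz _; exact: conn_ball wr.
have clO p : ccl U p -> Om f K p -> U p.
  move=> clp Op; have [r [r0 rO]] := Om_open merf Op.
  have [w [Uw wp]] := clp r r0; apply: conn_trans Uw _; apply: conn_sym.
  exact: conn_ball wp.
have clf p : ccl U p -> f p <> None.
  move=> clp fp; apply: (npole p) => //; apply: clO => //; by left.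
have bdK p : ccl U p -> ~ U p -> cabs (fv f p) <= K.
  move=> clp nU; rewrite leNgt; apply/negP => Kp; apply: nU; apply: clO => //.
  by right.
(* A tract filling the plane would make [f] bounded and entire, which transcendence excludes. *)
have [all|/existsNP[p1 np1]] := pselect (forall p, U p).
  apply: tranf; apply: (@bounded_entire_rational B) => z.
  by split; [exact: npole (all z)|exact: UB].
(* A point of the complement nearest to [z0]: points of the segment from it towards [z0] are nearer,
   hence in [U]. *)
have [p [nUp clp]] : exists p, ~ U p /\ ccl U p.
  pose D := [set z | ~ U z] `&` [set z | - cabs (p1 - z0) <= - cabs (z - z0)].
  have [||||p [[nUp _] pmin]] :=
    @closed_max R D (fun z => - cabs (z - z0)) (cabs z0 + cabs (p1 - z0)).
  - by exists p1; split=> /=.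
  - by move=> z [_ /=]; have := cabsB_ge z z0; lra.
  - apply: cclosedI.
      move=> z nn; have Uz : U z by apply: contrapT => ?; exact: nn.
      have [r [r0 rU]] := Uopen z Uz.
      by exists r; split=> // w /rU ? /=; apply.
    apply: (@cclosed_ge _ _ _ 1) => // z w.
    by have := cabs_tri z w z0; rewrite (cabsBC z w); lra.
  - move=> z _ e e0; exists e; split=> // w _ wz.
    by have := cabs_tri z w z0; rewrite (cabsBC z w); lra.
  exists p; split=> // d d0.
  have pz : 0 < cabs (p - z0).
    by rewrite cabs_gt0 subr_eq0; apply/eqP => pz; apply: nUp; rewrite pz.
  have [|t [t0 td t1]] := @pos_min2 R (d / 2 / cabs (p - z0)) 1 _ ltr01.
    by rewrite !divr_gt0.
  pose w := p + t%:C%C * (z0 - p); exists w.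
  have wp : cabs (w - p) < d.
    rewrite /w addrAC subrr add0r cabsM cabsr ger0_norm; last by lra.
    by rewrite (cabsBC z0); move: td; rewrite ler_pdivlMr//; lra.
  split=> //; apply: contrapT => nUw.
  have wz : cabs (w - z0) = (1 - t) * cabs (p - z0).
    rewrite (_ : w - z0 = (1 - t)%:C%C * (p - z0)).
      by rewrite cabsM cabsr ger0_norm//; lra.
    by rewrite /w rmorphB rmorph1; ring.
  have wlt : cabs (w - z0) < cabs (p - z0).
    by rewrite wz; nra.
  have p1z : cabs (p - z0) <= cabs (p1 - z0) by have := pmin p1; rewrite lerN2; apply; split=> /=.
  by have := pmin w; rewrite lerN2 leNgt wlt => H; have : false by apply: H; split=> //=; lra.
have small e : 0 < e -> forall z1, U z1 -> cabs (fv f z1) <= K + e.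
  move=> e0 z1 Uz1.
  have pK := bdK p clp nUp.
  have [d0 [d00 Hd0]] := ccont_cabs_usc (mero_ccont merf (clf p clp)) e0.
  have [z1d|z1d] := ltP (cabs (z1 - p)) d0; first by have := Hd0 z1 z1d; lra.
  pose d := d0 / 2; have d_0 : 0 < d by rewrite /d; lra.
  have dd : d < d0 by rewrite /d; lra.
  have Ke : 0 < K + e by lra.
  apply: (@pow_trick _ _ _ (cabs (z1 - p) / d)); [exact: cabs_ge0|lra| |].
    by rewrite divr_ge0 ?cabs_ge0// ltW.
  move=> n.
  have Bn : 0 < B ^+ n by rewrite exprn_gt0//; lra.
  have Kn : 0 < (K + e) ^+ n by rewrite exprn_gt0.
  (* An outer radius for which the crude bound [B ^+ n / rho] is at most [(K + e) ^+ n / d]. It may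
     depend on [n], since the bound obtained at [z1] does not contain it. *)
  pose rho := cabs (z1 - p) + 1 + B ^+ n * d / (K + e) ^+ n.
  have rho1 : cabs (z1 - p) < rho.
    by rewrite /rho -addrA ltrDl ltr_wpDr// !mulr_ge0 ?invr_ge0// ltW.
  have rho2 : B ^+ n * d / (K + e) ^+ n <= rho.
    by rewrite /rho lerDr addr_ge0 ?cabs_ge0.
  pose W := U `&` [set z | d < cabs (z - p) < rho].
  have Wo : copen W.
    move=> z [Uz /= /andP[h1 h2]]; have [r [r0 rU]] := Uopen z Uz.
    have [||s [s0 s1 s2]] := @pos_min2 R (cabs (z - p) - d) (rho - cabs (z - p)); [lra|lra|].
    have [s' [s'0 s'1 s'2]] := pos_min2 s0 r0.
    exists s'; split=> // w; rewrite /cball /= => ws; split.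
      by apply: rU; rewrite /cball /=; lra.
    rewrite /=; have := cabs_tri w z p; have := cabs_tri z w p.
    by rewrite (cabsBC z w); lra.
  have clW z : ccl W z -> ccl U z /\ d <= cabs (z - p) <= rho.
    move=> clz; split; first by move=> s /clz[w [[Uw _] ws]]; exists w.
    apply/andP; split; rewrite leNgt; apply/negP => zd.
      have [|w [[_ /= /andP[? ?]] ws]] := clz (d - cabs (z - p)); first by lra.
      by have := cabs_tri w z p; lra.
    have [|w [[_ /= /andP[? ?]] ws]] := clz (cabs (z - p) - rho); first by lra.
    by have := cabs_tri z w p; rewrite (cabsBC z w); lra.
  have nzp z : d <= cabs (z - p) -> z - p != 0.
    by move=> h; rewrite -cabs_gt0; lra.
  have : cabs (fv f z1 ^+ n * (z1 - p)^-1) <= (K + e) ^+ n / d.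
    apply: (@max_principle _ [::] W (fun z => fv f z ^+ n * (z - p)^-1) _ (cabs p + rho)) => //.
    - by move=> z [_ /= /andP[_ ?]]; have := cabsB_ge z p; lra.
    - move=> z /clW[clz /andP[h1 _]]; apply: ccontM.
        by apply: ccontX; apply: mero_ccont => //; exact: clf.
      apply: ccontV; first exact: nzp.
      by apply: ccontB; [exact: ccont_id|exact: ccont_cst].
    - move=> z Wz _; have [clz /andP[h1 _]] := clW z (ccl_sub Wz).
      have [l dl] := mero_cd merf (clf z clz).
      eexists; apply: has_cdM; first exact: has_cdX dl.
      apply: has_cdV; first exact: nzp.
      by apply: has_cdB; [exact: has_cd_id|exact: has_cd_cst].
    - by rewrite divr_ge0// ltW.
    - move=> z /clW[clz /andP[h1 h2]] nWz; rewrite cabsM cabsV cabsX.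
      have zp0 : 0 < cabs (z - p) by lra.
      have small1 : cabs (fv f z) <= K + e -> cabs (fv f z) ^+ n / cabs (z - p) <= (K + e) ^+ n / d.
        move=> h; apply: ler_pM; rewrite ?exprn_ge0 ?invr_ge0 ?cabs_ge0//.
          by rewrite lerXn2r ?nnegrE ?cabs_ge0// ltW.
        by rewrite lef_pV2.
      have [Uz|nUz] := pselect (U z); last by apply: small1; have := bdK z clz nUz; lra.
      have [hd|hd] := ltP (cabs (z - p)) d0; first by apply: small1; have := Hd0 z hd; lra.
      have zr : cabs (z - p) = rho.
        apply/eqP; rewrite eq_le h2 leNgt; apply/negP => h3.
        by apply: nWz; split=> //=; lra.
      rewrite zr ler_pdivrMr; last by have := cabs_ge0 (z1 - p); lra.
      apply: (@le_trans _ _ (B ^+ n)).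
        by rewrite lerXn2r ?nnegrE ?cabs_ge0 ?UB//; lra.
      move: rho2; rewrite ler_pdivrMr// => rho2.
      by rewrite mulrAC ler_pdivlMr// [leRHS]mulrC.
    - by split=> //=; lra.
  rewrite cabsM cabsV cabsX ler_pdivrMr; last by lra.
  by rewrite mulrAC [X in _ -> _ <= X]mulrC mulrA.
have : cabs (fv f z0) <= K.
  rewrite leNgt; apply/negP => h.
  by have := small ((cabs (fv f z0) - K) / 2) _ z0 Uz0; rewrite divr_gt0 ?subr_gt0//; lra.
case: Oz0 => [fz0|]; last by lra.
by exfalso; exact: (npole z0 Uz0).
Qed.

(** The path is [z 0] plus all clamped increments [u n (clamp (t - n)) - z n]. Up to time [N] only
    the first [N] of them are nonzero, so continuity is inherited from finite sums. *)
Lemma infinite_path (u : nat -> R -> C) (z : nat -> C) :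
  (forall n, pcont (u n)) -> (forall n, u n 0 = z n) -> (forall n, u n 1 = z n.+1) ->
  exists gam, pcont gam /\ forall n t, n%:R <= t <= n.+1%:R -> gam t = u n (t - n%:R).
Proof.
move=> cu u0 u1.
pose G N t := z 0%N + \sum_(n < N) (u n (clamp (t - n%:R)) + (- z n)).
have GN N N' t : t <= N%:R -> (N <= N')%N -> G N' t = G N t.
  move=> tN; elim: N' => [|N' IH]; first by rewrite leqn0 => /eqP ->.
  rewrite leq_eqVlt => /predU1P[->//|]; rewrite ltnS => NN'.
  rewrite /G big_ord_recr /= addrA -/(G N' t) IH// clamp0 ?u0 ?subrr ?addr0//.
  by rewrite subr_le0 (le_trans tN)// ler_nat.
have cG N : pcont (G N).
  elim: N => [|N IH].
    rewrite (_ : G 0%N = fun _ => z 0%N); first exact: pcont_cst.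
    by apply/funext => t; rewrite /G big_ord0 addr0.
  rewrite (_ : G N.+1 = fun t => G N t + (u N (clamp (t - N%:R)) + (- z N))).
    apply: pcontD => //; apply: pcontD; last exact: pcont_cst.
    apply: (@pcont_comp _ _ (fun t => clamp (t - N%:R)) 1) => // s t.
    by rewrite mul1r (le_trans (clamp_lip _ _))// opprB addrA subrK.
  by apply/funext => t; rewrite /G big_ord_recr /= addrA.
pose gam t := G (Num.Def.truncn t).+1 t.
have gamE N t : t <= N%:R -> gam t = G N t.
  move=> tN; rewrite /gam.
  have tt : t <= (Num.Def.truncn t).+1%:R by rewrite ltW// truncnS_gt.
  have [h|/ltnW h] := leqP (Num.Def.truncn t).+1 N; first by rewrite (GN _ _ _ tt h).
  by rewrite (GN _ _ _ tN h).
exists gam; split=> [t e e0|n t /andP[t1 t2]].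
  have tt : t + 1 <= (Num.Def.truncn t).+2%:R.
    by rewrite -natr1 lerD2r ltW// truncnS_gt.
  have [d [d0 H]] := cG (Num.Def.truncn t).+2 t e e0.
  have [h [h0 hd h1]] := pos_min2 d0 (@ltr01 R).
  exists h; split=> // s st.
  rewrite (gamE _ _ (_ : s <= (Num.Def.truncn t).+2%:R)); last first.
    by move: st; rewrite ltr_norml; lra.
  rewrite (gamE _ _ (_ : t <= (Num.Def.truncn t).+2%:R)); last by lra.
  by apply: H; lra.
rewrite (gamE n.+1)// /G big_ord_recr /= clampid; last first.
  by move: t2; rewrite -natr1; lra.
suff -> : \sum_(i < n) (u i (clamp (t - i%:R)) + (- z i)) = z n - z 0%N by ring.
elim: n t1 {t2} => [|n IH] t1; first by rewrite big_ord0 subrr.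
rewrite big_ord_recr /= IH; last by move: t1; rewrite -natr1; lra.
by rewrite clamp1 ?u1; [ring|move: t1; rewrite -natr1; lra].
Qed.

Hypothesis noinf : ~ inf_asymptotic_value f.

(** If no pole is close, a path in [Om f K] from [z0] to a pole would cross a circle on which |f| <=
    K; so the tract of [z0] has no poles. Applying [tract_unbounded] at the levels [K + n] then
    gives a path on which [f] tends to infinity, contrary to (KU1). *)
Lemma near_pole (rad : C -> R) K : 0 < K ->
  (forall a, f a = None -> 0 < rad a /\ forall z, cabs (z - a) = rad a ->
     f z <> None /\ cabs (fv f z) <= K) ->
  forall z, Om f K z -> exists a, f a = None /\ cabs (z - a) < rad a.
Proof.
move=> K0 hrad z0 Oz0; apply: contrapT => /forallNP nz.
have npole w : conn (Om f K) z0 w -> f w <> None.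
  move=> zw fw; have [r0 Hr] := hrad w fw.
  have [|v [Ov vr]] := conn_cross zw r0.
    by rewrite leNgt; apply/negP => ?; apply: (nz w).
  have [fv1 fv2] := Hr v vr.
  by case: Ov => // ?; lra.
pose Kn (n : nat) := K + n%:R.
have KnK n : K <= Kn n by rewrite lerDl.
pose S n z := conn (Om f K) z0 z /\ Om f (Kn n) z.
have stepS n z : exists w, S n z -> conn (Om f (Kn n)) z w /\ S n.+1 w.
  have [[cz Oz]|nS] := pselect (S n z); last by exists z.
  have Kn0 : 0 < Kn n by rewrite (lt_le_trans K0).
  have [|w [zw fw]] := tract_unbounded Kn0 Oz _ (Kn n.+1).
    move=> w zw; apply: npole; apply: conn_trans cz _.
    exact: conn_mono (Om_mono (KnK n)) zw.
  exists w => _; split=> //; split; last by right.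
  by apply: conn_trans cz _; exact: conn_mono (Om_mono (KnK n)) zw.
have /choice[F HF] : forall nz : nat * C, exists w, S nz.1 nz.2 ->
    conn (Om f (Kn nz.1)) nz.2 w /\ S nz.1.+1 w by case=> n z; exact: stepS.
pose fix z n := if n is k.+1 then F (k, z k) else z0.
have Sz n : S n (z n).
  elim: n => [|n IH]; last by have [] := HF (n, z n) IH.
  by split; [exact: conn_refl|rewrite /Kn addr0].
have /choice[u Hu] n : exists u, [/\ pcont u, u 0 = z n, u 1 = z n.+1 &
    forall t, 0 <= t <= 1 -> Om f (Kn n) (u t)].
  by have [] := HF (n, z n) (Sz n).
have [gam [cgam gamE]] := @infinite_path u z (fun n => let: And4 h _ _ _ := Hu n in h)
  (fun n => let: And4 _ h _ _ := Hu n in h) (fun n => let: And4 _ _ h _ := Hu n in h).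
have gamO n t : n%:R <= t -> Om f (Kn n) (gam t) /\ conn (Om f K) z0 (gam t).
  move=> nt; pose k := Num.Def.truncn t.
  have t0 : 0 <= t by rewrite (le_trans _ nt).
  have /andP[k1 k2] := truncn_itv t0.
  have kt : k%:R <= t <= k.+1%:R by rewrite k1 ltW.
  have nk : (n <= k)%N by rewrite /k truncn_ge_nat.
  have [cu u0 u1 Ou] := Hu k.
  have tk : 0 <= t - k%:R <= 1 by move: kt; rewrite -natr1; lra.
  rewrite (gamE k t kt); split.
    by apply: (@Om_mono _ _ _ (Kn k)); [rewrite lerD2l ler_nat|exact: Ou].
  have [zk _] := Sz k; apply: conn_trans zk _.
  by apply: (conn_mono (Om_mono (KnK k))); apply: conn_path.
apply: noinf; exists gam; split.
  split; first exact: pcont_continuous.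
  move=> L.
  (* In a disc the values of [f] on a pole-free tract are bounded, so a path along which the values
     grow must leave every disc. *)
  have [B HB] : exists B, forall w, [set z | cabs z <= L] w -> conn (Om f K) z0 w ->
      cabs (fv f w) <= B.
    apply: (@compact_induction R (fun A => exists B, forall w, A w -> conn (Om f K) z0 w ->
      cabs (fv f w) <= B)).
    - by move=> A A' AA' [B HB]; exists B => w /AA'; exact: HB.
    - move=> A A' [B HB] [B' HB']; exists (Num.max B B') => w [Aw|Aw] cw; rewrite le_max.
        by rewrite HB.
      by rewrite HB' ?orbT.
    - move=> p; have [fp|fp] := pselect (f p = None).
        have [|r [r0 rO]] := Om_open merf (_ : Om f K p); first by left.
        exists r; split=> //; exists 0 => w wp cw; exfalso.
        apply: (npole p) => //; apply: conn_trans cw _; apply: conn_sym.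
        exact: conn_ball wp.
      have [d [d0 Hd]] := ccont_cabs_usc (mero_ccont merf fp) (@ltr01 R).
      by exists d; split=> //; exists (cabs (fv f p) + 1) => w /Hd/ltW.
  pose n := (Num.Def.truncn `|B|).+1.
  exists n%:R => t /ltW nt; have [[fN|ft] ct] := gamO n t nt.
    by exfalso; exact: (npole _ ct).
  rewrite ltNge; apply/negP => tL; have := HB _ tL ct; rewrite leNgt => /negP; apply.
  apply: lt_trans ft; rewrite /Kn.
  have : `|B| < n%:R by exact: truncnS_gt.
  by have := ler_norm B; lra.
move=> L; pose n := (Num.Def.truncn `|L|).+1; exists n%:R => t /ltW nt v fE.
have [[fN|ft] ct] := gamO n t nt; first by rewrite fN in fE.
rewrite -(fv_some fE); apply: lt_trans ft; rewrite /Kn.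
have : `|L| < n%:R by exact: truncnS_gt.
by have := ler_norm L; lra.
Qed.

End Tracts.

(** * Counting poles *)

Section Counting.
Variable R : realType.
Local Notation C := (R[i]).
Variable f : C -> option C.
Hypothesis merf : meromorphic f.
Local Notation mu := (@lebesgue_measure R).

Lemma mult_pole a : f a = None -> pole_of_order f a (mult f a).
Proof. by move=> fa; apply: xgetPex; exact: mero_pole. Qed.

Lemma mult_gt0 a : f a = None -> (0 < mult f a)%N.
Proof. by move=> /mult_pole[]. Qed.

Lemma npolesE r t : t <= r -> npoles f t =
  (\sum_(a <- fset_set [set a | f a = None /\ (cabs a <= r)%R] | (cabs a <= t)%R)
     mult f a)%N.
Proof.
move=> tr; rewrite /npoles fsbig_finite; last exact: poles_finite.
rewrite -[RHS]big_filter; apply: perm_big; apply: uniq_perm.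
- exact: fset_uniq.
- by apply: filter_uniq; exact: fset_uniq.
move=> a; rewrite mem_filter !in_fset_set; try exact: poles_finite.
apply/idP/andP => [/set_mem[fa at_]|[at_ /set_mem[fa _]]].
  by split=> //; apply/mem_set; split=> //; exact: le_trans at_ tr.
by apply/mem_set.
Qed.

Lemma npoles_mono s t : s <= t -> (npoles f s <= npoles f t)%N.
Proof.
move=> st; rewrite (npolesE st) (npolesE (lexx t)).
rewrite [leqLHS]big_mkcond [leqRHS]big_mkcond /=.
by apply: leq_sum => a _; case: ifPn => // as_; rewrite (le_trans as_ st).
Qed.

Lemma size_npoles (s : seq C) t : uniq s ->
  (forall a, a \in s -> f a = None /\ cabs a <= t) -> (size s <= npoles f t)%N.
Proof.
move=> us hs; rewrite /npoles fsbig_finite; last exact: poles_finite.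
apply: (@leq_trans (size (fset_set [set a | f a = None /\ cabs a <= t]))).
  apply: uniq_leq_size => // a /hs ha.
  by rewrite in_fset_set; [exact: mem_set|exact: poles_finite].
rewrite -sum1_size big_seq [leqRHS]big_seq; apply: leq_sum => a.
rewrite in_fset_set; last exact: poles_finite.
by move=> /set_mem[/mult_gt0].
Qed.

(** Makes the integrand of [count_fn] vanish near 0, so that there the division by [t] can be
    replaced by one by [d]. *)
Lemma npoles_gap : exists d, 0 < d /\ forall t, t < d -> (npoles f t <= npoles f 0)%N.
Proof.
have [d [d0 H]] : exists d, 0 < d /\ forall z, cabs z < d -> z != 0 -> f z <> None.
  have [f0|f0] := pselect (f 0 = None).
    have [r [r0 H]] := pole_large merf 0 f0; exists r; split=> // z zr z0.
    by have [] := H z; rewrite ?subr0.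
  have [r [r0 H]] := mero_regular merf f0; exists r; split=> // z zr z0.
  by have [] := H z; rewrite ?subr0.
exists d; split=> // t td; have [t0|t0] := leP t 0; first exact: npoles_mono.
rewrite (npolesE (lexx t)) (npolesE (ltW t0)).
rewrite big_seq_cond [leqRHS]big_seq_cond big_mkcond [leqRHS]big_mkcond /=.
apply: leq_sum => a _; case: ifPn => // /andP[aF at_]; rewrite aF /=.
move: aF; rewrite in_fset_set; last exact: poles_finite.
move=> /set_mem[fa _]; case: ifPn => //; rewrite -ltNge cabs_gt0 => a0.
by exfalso; apply: (H a) => //; exact: le_lt_trans at_ td.
Qed.

(** Serves to choose circles without poles, on which the proximity function is seen to be finite. *)
Lemma avoid_seq (L : seq R) (a b : R) : a < b -> exists r, a < r < b /\ r \notin L.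
Proof.
elim: L a b => [|c L IH] a b ab; first by exists ((a + b) / 2); split=> //; lra.
have [hc|hc] := leP c ((a + b) / 2).
  have [|r [rab rL]] := IH ((a + b) / 2) b; first by lra.
  exists r; split; first by lra.
  by rewrite inE negb_or rL andbT; apply/eqP => rc; move: rab; rewrite rc; lra.
have [|r [rab rL]] := IH a ((a + b) / 2); first by lra.
exists r; split; first by lra.
by rewrite inE negb_or rL andbT; apply/eqP => rc; move: rab; rewrite rc; lra.
Qed.

Lemma cabs_circ (r th : R) : 0 <= r -> cabs (circ r th) = r.
Proof.
move=> r0; rewrite /cabs /circ /= !exprMn -mulrDr cos2Dsin2 mulr1.
by rewrite sqrtr_sqr ger0_norm.
Qed.

Lemma prox_fin r : 0 <= r -> (forall a, f a = None -> cabs a <> r) ->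
  prox f r \is a fin_num /\ (0 <= prox f r)%E.
Proof.
move=> r0 nr; have fN th : f (circ r th) <> None.
  by move=> h; apply: (nr _ h); exact: cabs_circ.
pose h th : R := ln (Num.max 1 (cabs (fv f (circ r th)))).
have lE th : logplus (f (circ r th)) = (h th)%:E.
  rewrite (some_fv (fN th)) /logplus /h; congr EFin.
  have x0 := cabs_ge0 (fv f (circ r th)).
  have [x1|x1] := leP (cabs (fv f (circ r th))) 1.
    by rewrite ln1 max_l// ln_le0.
  by rewrite max_r// ln_ge0// ltW.
have cabsc : continuous (fun th => cabs (fv f (circ r th))).
  move=> th; apply/cvgrPdist_lt => e e0.
  have [d [d0 Hd]] := mero_ccont merf (fN th) e0.
  have cc : continuous (fun t : R => r * cos t).
    by move=> t; apply: cvgM; [exact: cvg_cst|exact: continuous_cos].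
  have cs : continuous (fun t : R => r * sin t).
    by move=> t; apply: cvgM; [exact: cvg_cst|exact: continuous_sin].
  have d20 : 0 < d / 2 by lra.
  have /cvgrPdist_lt/(_ _ d20) h1 := cc th.
  have /cvgrPdist_lt/(_ _ d20) h2 := cs th.
  near=> s.
  have s1 : `|r * cos th - r * cos s| < d / 2 by near: s.
  have s2 : `|r * sin th - r * sin s| < d / 2 by near: s.
  have : cabs (circ r s - circ r th) < d.
    apply: (le_lt_trans (cabs_le_ReIm _)); rewrite /circ /=.
    by rewrite distrC (distrC (r * sin s)); lra.
  move=> /Hd hd; rewrite ltr_norml.
  have := cabsB_ge (fv f (circ r th)) (fv f (circ r s)).
  have := cabsB_ge (fv f (circ r s)) (fv f (circ r th)).
  by rewrite (cabsBC (fv f (circ r th))); lra.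
have ch : continuous h.
  move=> th.
  have cm : {for th, continuous ((fun _ : R => 1 : R^o) \max (fun t => cabs (fv f (circ r t))))}.
    by apply: continuous_max; [exact: cst_continuous|exact: cabsc].
  have cl : {for Num.max 1 (cabs (fv f (circ r th))), continuous (@ln R)}.
    by apply: continuous_ln; rewrite lt_max ltr01.
  exact: (continuous_comp cm cl).
have Ih : mu.-integrable `[0, 2 * pi] (EFin \o h).
  apply: continuous_compact_integrable; first exact: segment_compact.
  exact: continuous_subspaceT.
have pE : prox f r = ((2 * pi)^-1%:E * \int[mu]_(th in `[0%R, (2 * pi)%R]) (h th)%:E)%E.
  rewrite /prox; congr (_ * _)%E; apply: eq_integral => th _; exact: lE.
have c0 : (0 <= (2 * pi : R)^-1) by rewrite invr_ge0 mulr_ge0// pi_ge0.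
rewrite pE; split; first by rewrite fin_numM// integrable_fin_num.
apply: mule_ge0; first by rewrite lee_fin.
apply: integral_ge0 => th _; rewrite lee_fin ln_ge0// le_max lexx//.
Unshelve. all: by end_near. Qed.

Lemma count_fn_bound x r : 0 < x -> 1 <= r -> 2 * x <= r ->
  count_fn f r \is a fin_num /\
  ((npoles f x - npoles f 0)%N%:R / 2 <= fine (count_fn f r)).
Proof.
move=> x0 r1 xr; have [d [d0 gap]] := npoles_gap.
pose n0 := npoles f 0.
pose N t : R := (npoles f t - n0)%N%:R.
pose h t := N t * (Num.max d t)^-1.
have r0 : 0 < r by lra.
have hE t : N t / t = h t.
  rewrite /h; have [td|//] := ltP t d.
  have -> : N t = 0 by rewrite /N; move: (gap t td); rewrite -subn_eq0 => /eqP ->.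
  by rewrite !mul0r.
have md t : 0 < Num.max d t by rewrite lt_max d0.
have N0 t : 0 <= N t by rewrite ler0n.
have Nm s t : s <= t -> N s <= N t.
  by move=> st; rewrite ler_nat leq_sub2r// npoles_mono.
have mh D : measurable D -> measurable_fun D h.
  move=> mD; apply: measurable_funM; first by apply: nondecreasing_measurable => // s t; exact: Nm.
  apply: nonincreasing_measurable => // s t st.
  by rewrite lef_pV2 ?posrE// ge_max le_max lexx /= le_max st orbT.
have h0 t : 0 <= h t by rewrite mulr_ge0// invr_ge0 ltW.
have hB t : t <= r -> h t <= N r / d.
  move=> tr; apply: ler_pM => //; first by rewrite invr_ge0 ltW.
    exact: Nm.
  by rewrite lef_pV2 ?posrE// le_max lexx.
have Ih : mu.-integrable `[0, r] (EFin \o h).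
  apply: measurable_bounded_integrable => //.
  - by rewrite /= lebesgue_measure_itv /= lte_fin r0 ltry.
  - exact: mh.
  - exists (N r / d); split; first by rewrite num_real.
    move=> B HB t /=; rewrite in_itv /= => /andP[_ tr].
    by rewrite ger0_norm// (le_trans (hB t tr))// ltW.
have cE : count_fn f r = (\int[mu]_(t in `[0%R, r]) (h t)%:E + (n0%:R * ln r)%:E)%E.
  by rewrite /count_fn; congr (_ + _)%E; apply: eq_integral => t _; rewrite -hE.
have fI : (\int[mu]_(t in `[0%R, r]) (h t)%:E)%E \is a fin_num.
  exact: integrable_fin_num Ih.
(* On [x, r] the integrand is at least N x / r, and r - x >= r / 2. *)
have low : ((N x / 2)%:E <= \int[mu]_(t in `[0%R, r]) (h t)%:E)%E.
  apply: (@le_trans _ _ (\int[mu]_(t in `[x, r]) (h t)%:E)%E); last first.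
    apply: ge0_subset_integral => //.
    - by apply/measurable_EFinP; exact: mh.
    - by move=> t _; rewrite lee_fin.
    - by apply: subset_itv; rewrite bnd_simp// ltW.
  have -> : ((N x / 2)%:E = \int[mu]_(t in `[x, r]) (N x / 2 / (r - x))%:E)%E.
    rewrite integral_cst//= lebesgue_measure_itv /= lte_fin.
    have xr' : x < r by lra.
    rewrite xr' -EFinB -EFinM; congr EFin; field; lra.
  have rx : 0 < r - x by lra.
  apply: ge0_le_integral => //.
  - by move=> t _; rewrite lee_fin !divr_ge0// ltW.
  - by apply/measurable_EFinP; exact: mh.
  - move=> t /=; rewrite in_itv /= => /andP[xt tr]; rewrite lee_fin -hE.
    have t0 : 0 < t by lra.
    rewrite -mulrA; apply: ler_pM => //; first by rewrite mulr_ge0 ?invr_ge0// ltW.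
      exact: Nm.
    by rewrite -invfM lef_pV2 ?posrE ?mulr_gt0//; lra.
rewrite cE; split; first by rewrite fin_numD fI.
rewrite fineD//= -[leLHS]addr0 lerD//; last by rewrite mulr_ge0// ln_ge0.
by rewrite -lee_fin fineK.
Qed.

(** Apart from the poles at 0, the counting function at [x] is at most twice the characteristic at a
    pole-free radius between 2 x and 3 x, and that is at most r^sigma for large [x]. The order
    controls only the logarithm, so the case of characteristic at most 1 is separate; [K] absorbs
    small [x]. *)
Lemma order_count (rho sigma : R) : has_order f rho -> rho < sigma -> 0 < sigma ->
  exists K, 0 < K /\ forall x (s : seq C), 1 <= x -> uniq s ->
    (forall a, a \in s -> f a = None /\ cabs a <= x) -> (size s)%:R <= K * x `^ sigma.
Proof.
move=> ho rs s0.
have [V [M [Mr HM]] VM] : exists2 V, (pinfty_nbhs R) V &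
    forall r, V r -> ln (fine (nev_T f r)) / ln r < sigma.
  have : (limf_esup (fun r : R => (ln (fine (nev_T f r)) / ln r)%:E) (pinfty_nbhs R) < sigma%:E)%E.
    by rewrite ho lte_fin.
  rewrite limf_esupE => /ereal_inf_lt[_ [V hV <-]] sV; exists V => // r Vr.
  rewrite -lte_fin; apply: le_lt_trans sV; apply: ereal_sup_ubound; by exists r.
pose x0 := Num.max 1 M.
have x01 : 1 <= x0 by rewrite le_max lexx.
pose n0 := npoles f 0.
have big x : x0 <= x -> (npoles f x)%:R <= n0%:R + 2 * (3 `^ sigma * x `^ sigma).
  move=> xx; have x1 : 1 <= x by lra.
  have [|r [/andP[r2 r3] rL]] := @avoid_seq [seq cabs a | a <-
      fset_set [set a | f a = None /\ cabs a <= 3 * x]] (2 * x) (3 * x); first by lra.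
  have nr a : f a = None -> cabs a <> r.
    move=> fa ar; move: rL => /negP; apply; rewrite -ar; apply: map_f.
    rewrite in_fset_set; last exact: poles_finite.
    by apply/mem_set; split=> //; rewrite ar ltW.
  have r_1 : 1 < r by lra.
  have [pf p0] := @prox_fin r (ltW (lt_trans ltr01 r_1)) nr.
  have [|||cf c0] := @count_fn_bound x r; [lra|lra|lra|].
  have Tge : (npoles f x - n0)%N%:R / 2 <= fine (nev_T f r).
    rewrite /nev_T fineD// (le_trans c0)// lerDr fine_ge0//.
  have Tle : fine (nev_T f r) <= Num.max 1 (r `^ sigma).
    have [T1|T1] := leP (fine (nev_T f r)) 1; first by rewrite le_max T1.
    rewrite le_max; apply/orP; right.
    have lr : 0 < ln r by rewrite ln_gt0.
    have T0 : 0 < fine (nev_T f r) by lra.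
    have : ln (fine (nev_T f r)) / ln r < sigma.
      apply: VM; apply: HM; apply: (@le_lt_trans _ _ x0); last by lra.
      by rewrite /x0 le_max lexx orbT.
    rewrite ltr_pdivrMr// => hT.
    have r0 : 0 < r by lra.
    have rs0 : 0 < r `^ sigma by rewrite powR_gt0.
    by rewrite -ler_ln ?posrE// ln_powR ltW.
  have r1s : 1 <= r `^ sigma.
    by rewrite -[leLHS](powRr0 r) ler_powR//; lra.
  have r3s : r `^ sigma <= 3 `^ sigma * x `^ sigma.
    rewrite -powRM; [|lra|lra].
    by apply: ge0_ler_powR; rewrite ?nnegrE ?(ltW s0)//; lra.
  move: Tle; rewrite max_r// => Tle.
  have : (npoles f x)%:R = (npoles f x - n0)%N%:R + n0%:R :> R.
    by rewrite -natrD subnK// npoles_mono//; lra.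
  by lra.
pose K : R := n0%:R + 2 * 3 `^ sigma + (npoles f x0)%:R + 1.
have t0 : 0 <= (3 : R) `^ sigma by exact: powR_ge0.
have K0 : 0 < K by rewrite /K; have := ler0n R n0; have := ler0n R (npoles f x0); lra.
exists K; split=> // x s x1 us hs.
have : (size s)%:R <= (npoles f x)%:R :> R by rewrite ler_nat; exact: size_npoles.
have xs : 1 <= x `^ sigma by rewrite -[leLHS](powRr0 x) ler_powR// ltW.
have [xx|xx] := leP x0 x.
  move=> /le_trans; apply; apply: (le_trans (big x xx)).
  have := ler0n R n0; have := ler0n R (npoles f x0); rewrite /K; nra.
move=> /le_trans; apply.
have : (npoles f x)%:R <= (npoles f x0)%:R :> R by rewrite ler_nat npoles_mono// ltW.
have := ler0n R n0; have := ler0n R (npoles f x0); rewrite /K; nra.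
Qed.

End Counting.

(** * Geometry of a pole *)

Lemma rootK (R : realType) (x : R) m : (0 < m)%N -> 0 <= x -> (x ^+ m) `^ m%:R^-1 = x.
Proof.
move=> m0 x0; rewrite -powR_mulrn// -powRrM mulfV ?powRr1//.
by rewrite pnatr_eq0 -lt0n.
Qed.

Lemma root_le (R : realType) (x c : R) m : (0 < m)%N -> 0 <= x -> x ^+ m <= c -> x <= c `^ m%:R^-1.
Proof.
move=> m0 x0 h; rewrite -[leLHS](rootK m0 x0); apply: ge0_ler_powR => //.
- by rewrite nnegrE exprn_ge0.
- by rewrite nnegrE (le_trans _ h)// exprn_ge0.
Qed.

Section OnePole.
Variable R : realType.
Local Notation C := (R[i]).
Variables (f : C -> option C) (a : C) (m M : nat) (b K Rdag : R).
Hypothesis merf : meromorphic f.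
Hypothesis fa : f a = None.
Hypothesis Rdag0 : 0 < Rdag.
Hypothesis iso : forall z, cabs (z - a) < Rdag -> z != a -> f z <> None.
Hypothesis m_gt0 : (0 < m)%N.
Hypothesis m_le : (m <= M)%N.
Hypothesis b_gt0 : 0 < b.
Hypothesis K1 : 1 <= K.
Hypothesis est : forall z, cabs (z - a) < Rdag -> z != a ->
  [/\ K^-1 * (b / cabs (z - a) ^+ m) <= cabs (fv f z),
      cabs (fv f z) <= K * (b / cabs (z - a) ^+ m),
      K^-1 * (m%:R * b / cabs (z - a) ^+ m.+1) <= cabs (cderiv (fv f) z) &
      cabs (cderiv (fv f) z) <= K * (m%:R * b / cabs (z - a) ^+ m.+1)].

(** Chosen so that [128 * K * 2 ^+ M * eta = (2 * K)^-1] (see [etaE]): in [pole_second_order] the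
    left side multiplies b / s^(m+1) in the error, and half the lower bound of the derivative is m
    times the right side. *)
Definition eta (K : R) (M : nat) : R := (256 * K ^+ 2 * 2 ^+ M)^-1.

Local Notation et := (eta K M).

Lemma K_gt0 : 0 < K. Proof. exact: lt_le_trans ltr01 K1. Qed.

Lemma two_M : 1 <= (2 : R) ^+ M. Proof. by rewrite exprn_ege1// ler1n. Qed.

Lemma eta_den : 0 < 256 * K ^+ 2 * 2 ^+ M.
Proof.
apply: mulr_gt0; last by rewrite exprn_gt0.
by apply: mulr_gt0; [rewrite ltr0n|rewrite exprn_gt0// K_gt0].
Qed.

Lemma eta_gt0 : 0 < et.
Proof. rewrite invr_gt0; exact: eta_den. Qed.

Lemma eta_le : et <= 1 / 4.
Proof.
rewrite /eta -[leLHS]mul1r ler_pdivrMr; last exact: eta_den.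
have := two_M; have : 1 <= K ^+ 2 by rewrite exprn_ege1.
move: (K ^+ 2) (2 ^+ M) => k t k1 t1; nra.
Qed.

Lemma etaE : 128 * K * 2 ^+ M * et = (2 * K)^-1.
Proof.
have := K_gt0; have := two_M => t1 k0.
by rewrite /eta; field; rewrite !gt_eqF//; lra.
Qed.

(** [disc_second_order] on the disc of radius s / 2 about [z0], where |f| <= K b (2 / s)^m. The
    permitted radius is proportional to the distance to the pole, with a factor common to all
    poles. *)
Lemma pole_second_order z0 x y : z0 != a -> cabs (z0 - a) <= Rdag / 2 ->
  cabs (x - z0) <= et * cabs (z0 - a) -> cabs (y - z0) <= et * cabs (z0 - a) ->
  cabs (fv f x - fv f y - cderiv (fv f) z0 * (x - y)) <=
  cabs (cderiv (fv f) z0) / 2 * cabs (x - y).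
Proof.
move: (Rdag0) K_gt0 eta_gt0 eta_le etaE => Rd0 k0 e0 e4 eE zna zs xz yz.
set s := cabs (z0 - a) in zs xz yz *.
have s0 : 0 < s by rewrite cabs_gt0 subr_eq0.
have b0 := b_gt0.
have m1 := m_gt0.
have near z : cabs (z - z0) <= s / 2 -> [/\ s / 2 <= cabs (z - a), cball a Rdag z & z != a].
  move=> hz; have h1 := cabs_tri z z0 a; have h2 := cabs_tri z0 z a.
  rewrite (cabsBC z0 z) -/s in h2; rewrite -/s in h1.
  split; [lra|by rewrite /cball /=; lra|].
  by rewrite -subr_eq0 -cabs_gt0; lra.
pose B := K * (b / (s / 2) ^+ m).
have B0 : 0 <= B by rewrite /B mulr_ge0 ?divr_ge0 ?exprn_ge0// ?ltW//; lra.
have s20 : 0 < s / 2 by lra.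
have := @disc_second_order _ (fv f) (cderiv (fv f)) z0 (s / 2) B s20 B0 _ _ x y.
move=> /(_ _ _ _ _)H.
have : cabs (fv f x - fv f y - cderiv (fv f) z0 * (x - y)) <=
    16 * B / (s / 2) ^+ 2 * (cabs (x - z0) + cabs (y - z0)) * cabs (x - y).
  apply: H.
  - move=> z /near[_ zR zn]; apply: mero_cderiv => //; exact: (iso zR zn).
  - move=> z /near[sz zR zn]; have [_ h _ _] := est zR zn.
    apply: (le_trans h); rewrite /B ler_pM2l// ler_pM2l//.
    have p0 : 0 < cabs (z - a) by lra.
    have h3 : (s / 2) ^+ m <= cabs (z - a) ^+ m by apply: lerXn2r; rewrite ?nnegrE; lra.
    by rewrite lef_pV2 ?posrE ?exprn_gt0.
  - by nra.
  - by nra.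
move=> /le_trans; apply; rewrite ler_wpM2r ?cabs_ge0//.
have z0R : cabs (z0 - a) < Rdag by rewrite -/s; lra.
have [_ _ dlow _] := est z0R zna; rewrite -/s in dlow.
apply: (@le_trans _ _ (K^-1 * (m%:R * b / s ^+ m.+1) / 2)); last by lra.
apply: (@le_trans _ _ (16 * B / (s / 2) ^+ 2 * (2 * et * s))).
  have B16 : 0 <= 16 * B / (s / 2) ^+ 2.
    by apply: divr_ge0; [exact: mulr_ge0|exact: sqr_ge0].
  by rewrite ler_wpM2l//; lra.
have sm : 0 < s ^+ m by rewrite exprn_gt0.
have -> : 16 * B / (s / 2) ^+ 2 * (2 * et * s) = 128 * K * 2 ^+ m * et * (b / (s ^+ m * s)).
  by rewrite /B expr_div_n; field; rewrite !gt_eqF ?exprn_gt0.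
have -> : K^-1 * (m%:R * b / s ^+ m.+1) / 2 = (2 * K)^-1 * m%:R * (b / (s ^+ m * s)).
  by rewrite exprSr; field; rewrite !gt_eqF.
have q0 : 0 <= b / (s ^+ m * s) by rewrite ltW// divr_gt0// mulr_gt0.
have m1R : 1 <= m%:R :> R by rewrite ler1n.
have KMe : 0 <= 128 * K * 2 ^+ M * et by rewrite ltW// mulr_gt0// !mulr_gt0// exprn_gt0.
rewrite -eE ler_wpM2r//.
apply: (@le_trans _ _ (128 * K * 2 ^+ M * et)).
  rewrite ler_pM2r// ler_pM2l; last by lra.
  by rewrite ler_weXn2l// ler1n.
by rewrite ler_peMr.
Qed.

Lemma pole_expand z0 x y : z0 != a -> cabs (z0 - a) <= Rdag / 2 ->
  cabs (x - z0) <= et * cabs (z0 - a) -> cabs (y - z0) <= et * cabs (z0 - a) ->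
  cabs (cderiv (fv f) z0) / 2 * cabs (x - y) <= cabs (fv f x - fv f y).
Proof.
move=> zna zs xz yz; have := pole_second_order zna zs xz yz.
have := cabsB_ge (cderiv (fv f) z0 * (x - y)) (fv f x - fv f y).
by rewrite cabsM (cabsBC (cderiv (fv f) z0 * (x - y))); lra.
Qed.

Lemma pole_contract z0 x y : z0 != a -> cabs (z0 - a) <= Rdag / 2 ->
  cabs (x - z0) <= et * cabs (z0 - a) -> cabs (y - z0) <= et * cabs (z0 - a) ->
  cabs (fv f x - fv f y) <= cabs (cderiv (fv f) z0) * 2 * cabs (x - y).
Proof.
move=> zna zs xz yz; have := pole_second_order zna zs xz yz.
have := cabsB_ge (fv f x - fv f y) (cderiv (fv f) z0 * (x - y)).
have : 0 <= cabs (cderiv (fv f) z0) * cabs (x - y) by rewrite mulr_ge0 ?cabs_ge0.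
by rewrite cabsM; lra.
Qed.

Lemma pole_radius_le z V : z != a -> cabs (z - a) < Rdag -> 0 < V -> V <= cabs (fv f z) ->
  cabs (z - a) ^+ m <= K * b / V /\ cabs (z - a) <= (K * b / V) `^ m%:R^-1.
Proof.
move=> zna za V0 Vz; have [_ h _ _] := est za zna.
have s0 : 0 < cabs (z - a) by rewrite cabs_gt0 subr_eq0.
have h1 : cabs (z - a) ^+ m <= K * b / V.
  rewrite ler_pdivlMr// mulrC -ler_pdivlMr ?exprn_gt0//.
  by rewrite -mulrA; exact: le_trans Vz h.
by split=> //; apply: root_le => //; exact: ltW.
Qed.

Lemma pole_radius_ge z W : z != a -> cabs (z - a) < Rdag -> cabs (fv f z) <= W ->
  b / cabs (z - a) ^+ m <= K * W /\ (cabs (z - a))^-1 <= (K * W / b) `^ m%:R^-1.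
Proof.
move=> zna za Wz; have [h _ _ _] := est za zna.
have s0 : 0 < cabs (z - a) by rewrite cabs_gt0 subr_eq0.
have k0 := K_gt0; have b0 := b_gt0.
have h1 : b / cabs (z - a) ^+ m <= K * W.
  by rewrite -ler_pdivrMl//; exact: le_trans h Wz.
split=> //; apply: root_le; [exact: m_gt0|by rewrite invr_ge0 ltW|].
by rewrite exprVn ler_pdivlMr// mulrC.
Qed.

Definition lipC : R := 2 * K ^+ 2 * M%:R + 2 / et.

Lemma lipC_gt0 : 0 < lipC.
Proof.
have k0 := K_gt0; have e0 := eta_gt0.
have h1 : 0 <= 2 * K ^+ 2 * M%:R by rewrite mulr_ge0// mulr_ge0// exprn_ge0// ltW.
have h2 : 0 < 2 / et by rewrite divr_gt0.
by rewrite /lipC; lra.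
Qed.

(** Two regimes give the two terms of [lipC]. Points at distance at most [eta * s] satisfy the
    derivative bound; for farther ones the trivial bound 2 W on the difference is compared with |x -
    y| > eta s. In both, [T] bounds 1 / s. *)
Lemma pole_lipschitz x y W : x != a -> y != a ->
  cabs (x - a) <= Rdag / 2 -> cabs (y - a) <= Rdag / 2 ->
  0 < W -> cabs (fv f x) <= W -> cabs (fv f y) <= W ->
  cabs (fv f x - fv f y) <= lipC * W * (K * W / b) `^ m%:R^-1 * cabs (x - y).
Proof.
move: (Rdag0) K_gt0 eta_gt0 (b_gt0) => Rd0 k0 e0 b0 xna yna xR yR W0 Wx Wy.
have xR' : cabs (x - a) < Rdag by lra.
have [h1 h2] := pole_radius_ge xna xR' Wx.
set T := _ `^ _ in h2 *; set s := cabs (x - a) in h1 h2.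
have s0 : 0 < s by rewrite cabs_gt0 subr_eq0.
have T0 : 0 <= T by rewrite powR_ge0.
have xy0 := cabs_ge0 (x - y).
have [near|far] := leP (cabs (x - y)) (et * s).
  have := @pole_contract x x y xna xR; rewrite subrr cabs0 (cabsBC y) => H.
  have {}H : cabs (fv f x - fv f y) <= cabs (cderiv (fv f) x) * 2 * cabs (x - y).
    by apply: H => //; rewrite mulr_ge0// ltW.
  apply: (le_trans H); rewrite ler_wpM2r//.
  have [_ _ _ hd] := est xR' xna; rewrite -/s in hd.
  apply: (@le_trans _ _ (2 * K ^+ 2 * M%:R * W * T)); last first.
    rewrite ler_wpM2r// ler_wpM2r ?(ltW W0)// /lipC lerDl divr_ge0// ltW//.
  have mM' : m%:R <= M%:R :> R by rewrite ler_nat m_le.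
  have hb : m%:R * b / s ^+ m.+1 <= M%:R * (K * W * T).
    have -> : m%:R * b / s ^+ m.+1 = m%:R * ((b / s ^+ m) * s^-1).
      by rewrite exprSr; field; rewrite !gt_eqF ?exprn_gt0.
    apply: ler_pM => //; first by rewrite mulr_ge0 ?divr_ge0 ?exprn_ge0 ?invr_ge0// ltW.
    by apply: ler_pM; rewrite ?divr_ge0 ?exprn_ge0 ?invr_ge0// ltW.
  apply: (@le_trans _ _ (K * (M%:R * (K * W * T)) * 2)); last by rewrite le_eqVlt; apply/orP; left; apply/eqP; ring.
  by rewrite ler_pM2r// (le_trans hd)// ler_pM2l.
apply: (@le_trans _ _ (2 * W)).
  by rewrite (le_trans (cabsB_le _ _))//; lra.
apply: (@le_trans _ _ (2 / et * W * T * cabs (x - y))); last first.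
  rewrite ler_wpM2r// ler_wpM2r// ler_wpM2r ?(ltW W0)// /lipC lerDr !mulr_ge0 ?exprn_ge0// ltW//.
have : 1 <= T * s by rewrite mulrC -ler_pdivrMl// mulr1.
have -> : 2 / et * W * T * cabs (x - y) = 2 * W * (T * (cabs (x - y) / et)).
  by field; rewrite gt_eqF.
move=> Ts; rewrite ler_peMr//; first by lra.
apply: (le_trans Ts); rewrite ler_wpM2l// ler_pdivlMr// mulrC ltW//.
Qed.

(** From |f'| >= |f| / (K^2 |x - a|), |f x| >= V and the resulting upper bound [T] for |x - a|. The
    factor has order b^(1/m) V^(-1-1/m), the inverse of the expansion in one step. *)
Lemma pole_expand_far x y V : x != a -> cabs (x - a) <= Rdag / 2 ->
  0 < V -> V <= cabs (fv f x) -> cabs (x - y) <= et * cabs (x - a) ->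
  cabs (x - y) <= 2 * K ^+ 2 / V * (K * b / V) `^ m%:R^-1 * cabs (fv f x - fv f y).
Proof.
move: (Rdag0) K_gt0 eta_gt0 (b_gt0) => Rd0 k0 e0 b0 xna xR V0 Vx xy.
have xR' : cabs (x - a) < Rdag by lra.
have [h1 h2] := pole_radius_le xna xR' V0 Vx.
set T := _ `^ _ in h2 *; set s := cabs (x - a) in h1 h2 xy.
have s0 : 0 < s by rewrite cabs_gt0 subr_eq0.
have := @pole_expand x x y xna xR; rewrite subrr cabs0 (cabsBC y) => H.
have {}H : cabs (cderiv (fv f) x) / 2 * cabs (x - y) <= cabs (fv f x - fv f y).
  by apply: H => //; rewrite mulr_ge0// ltW.
have [_ hf hd _] := est xR' xna; rewrite -/s in hd hf.
have m1 : 1 <= m%:R :> R by rewrite ler1n m_gt0.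
have hd2 : V / (K ^+ 2 * T) <= cabs (cderiv (fv f) x).
  apply: le_trans hd.
  have -> : K^-1 * (m%:R * b / s ^+ m.+1) = m%:R * (K ^+ 2)^-1 * ((K * (b / s ^+ m)) / s).
    by rewrite exprSr; field; rewrite !gt_eqF ?exprn_gt0.
  have -> : V / (K ^+ 2 * T) = (K ^+ 2)^-1 * (V / T).
    by field; rewrite !gt_eqF//; apply: lt_le_trans h2.
  apply: ler_pM; rewrite ?invr_ge0 ?exprn_ge0 ?(ltW k0)//.
  - by rewrite divr_ge0 ?powR_ge0// ltW.
  - by rewrite ler_peMl// invr_ge0 exprn_ge0// ltW.
  - apply: ler_pM; rewrite ?invr_ge0 ?powR_ge0 ?(ltW V0)//.
      exact: le_trans Vx hf.
    by rewrite lef_pV2// posrE//; exact: lt_le_trans h2.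
have T0 : 0 < T by exact: lt_le_trans h2.
have VT : 0 < V / (K ^+ 2 * T) by rewrite divr_gt0// mulr_gt0// exprn_gt0.
have -> : 2 * K ^+ 2 / V * T * cabs (fv f x - fv f y) =
    (2 * cabs (fv f x - fv f y)) / (V / (K ^+ 2 * T)).
  by field; rewrite !gt_eqF.
rewrite ler_pdivlMr//; apply: (@le_trans _ _ (cabs (x - y) * cabs (cderiv (fv f) x))).
  by rewrite ler_wpM2l ?cabs_ge0.
lra.
Qed.

Lemma pole_inverse_cd : exists H : C -> C,
  [/\ (forall z, cabs (z - a) < Rdag -> exists l, has_cd H z l), H a = 0 &
      forall z, cabs (z - a) < Rdag -> z != a -> H z = (fv f z)^-1].
Proof.
pose H z := if z == a then 0 else (fv f z)^-1.
exists H; split; [|by rewrite /H eqxx|by move=> z _ /negbTE zna; rewrite /H zna].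
move=> z zR; have [->|zna] := eqVneq z a.
  have [k [k0 [_ [r [r0 [g [hg [ga Hg]]]]]]]] := mero_pole merf fa.
  have dg : exists l, has_cd g a l.
    by eexists; apply: derivable_has_cd; apply: hg; rewrite /cball /= subrr cabs0.
  have [l dg'] := dg.
  eexists; apply: (@has_cd_ext _ (fun z => (z - a) ^+ k * (g z)^-1) _ _ _ r r0); last first.
    apply: has_cdM; last by apply: has_cdV => //; exact: dg'.
    by apply: has_cdX; apply: has_cdB; [exact: has_cd_id|exact: has_cd_cst].
  move=> w wr; rewrite /H; case: eqVneq => [->|wna].
    by rewrite subrr expr0n gtn_eqF// mul0r.
  by rewrite (fv_some (Hg w wr wna)) invfM invrK mulrC.
have fz := iso zR zna.
have f0 : fv f z != 0.
  have [h _ _ _] := est zR zna; rewrite -cabs_gt0; apply: lt_le_trans h.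
  have s0 : 0 < cabs (z - a) by rewrite cabs_gt0 subr_eq0.
  by rewrite mulr_gt0 ?invr_gt0 ?divr_gt0 ?exprn_gt0 ?K_gt0 ?b_gt0.
have [l dl] := mero_cd merf fz.
eexists; apply: (@has_cd_ext _ (fun z => (fv f z)^-1) _ _ _ (cabs (z - a))).
- by rewrite cabs_gt0 subr_eq0.
- by move=> w wz; rewrite /H; case: eqVneq => // wa; move: wz; rewrite wa cabsBC ltxx.
- exact: has_cdV dl.
Qed.

(** The base 1 + 2 / Rdag exceeds both 1 and 2 / Rdag, so its [M]-th power dominates (2 / Rdag)^m
    for every [m <= M]. Thus [Wmin] is more than twice the maximum of |f| on the circle of radius
    Rdag / 2 when [b <= 1]. *)
Definition Wmin : R := 2 * K * (1 + 2 / Rdag) ^+ M + 1.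

(** A zero of 1/f - 1/w is sought, where 1/f is extended by 0 at the pole: at the centre the modulus
    is 1/|w|, and on the circle it is larger because |w| is at least [Wmin]. *)
Lemma pole_value w : b <= 1 -> Wmin <= cabs w ->
  exists z, [/\ cabs (z - a) < Rdag / 2, z != a & fv f z = w].
Proof.
move: (Rdag0) K_gt0 (b_gt0) => Rd0 k0 b0 b1 wW.
have [H [dH Ha HE]] := pole_inverse_cd.
pose q := 1 + 2 / Rdag.
have q1 : 1 <= q by rewrite lerDl divr_ge0// ltW.
have qM : 1 <= q ^+ M by rewrite exprn_ege1.
have w0 : 0 < cabs w by apply: lt_le_trans wW; rewrite /Wmin -/q; nra.
have wn0 : w != 0 by rewrite -cabs_gt0.
have KqM : 0 < K * q ^+ M by rewrite mulr_gt0// (lt_le_trans ltr01 qM).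
pose m0 := (K * q ^+ M)^-1 - (cabs w)^-1.
have wlt : (cabs w)^-1 < m0.
  have h1 : 2 * (K * q ^+ M) < cabs w by apply: lt_le_trans wW; rewrite /Wmin -/q; lra.
  have h2 : (cabs w)^-1 < (2 * (K * q ^+ M))^-1 by rewrite ltf_pV2 ?posrE// mulr_gt0.
  by rewrite invfM in h2; rewrite /m0; lra.
have m00 : 0 < m0 by apply: lt_trans wlt; rewrite invr_gt0.
have [||||z [zR Hz]] := @disc_zero _ (fun z => H z - w^-1) a (Rdag / 2) m0 a m00.
- move=> z zR; have [|l dl] := dH z; first by lra.
  by eexists; apply: has_cdB; [exact: dl|exact: has_cd_cst].
- move=> z zR; have zna : z != a by rewrite -subr_eq0 -cabs_gt0 zR; lra.
  have zR' : cabs (z - a) < Rdag by lra.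
  apply: (le_trans _ (cabsB_ge _ _)); rewrite cabsV /m0 lerD2r HE// cabsV.
  have [hl hu _ _] := est zR' zna; rewrite zR in hl hu.
  have fz0 : 0 < cabs (fv f z).
    apply: lt_le_trans hl; have rr0 : 0 < Rdag / 2 by lra.
    by rewrite mulr_gt0 ?invr_gt0// divr_gt0// exprn_gt0.
  rewrite lef_pV2 ?posrE//; apply: (le_trans hu); rewrite ler_pM2l//.
  apply: (@le_trans _ _ (1 * q ^+ m)).
    apply: ler_pM => //; first exact: ltW.
      by rewrite invr_ge0 exprn_ge0// divr_ge0// ltW.
    rewrite -exprVn lerXn2r ?nnegrE//.
    + by rewrite invr_ge0 divr_ge0// ltW.
    + lra.
    + by rewrite invf_div /q lerDr.
  by rewrite mul1r ler_weXn2l// m_le.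
- by rewrite subrr cabs0; lra.
- by rewrite Ha sub0r cabsN cabsV.
have zna : z != a.
  apply/eqP => za; move: Hz; rewrite za Ha sub0r => /eqP; rewrite oppr_eq0 invr_eq0.
  by rewrite (negbTE wn0).
exists z; split=> //; have zR' : cabs (z - a) < Rdag by lra.
move/eqP: Hz; rewrite subr_eq0 HE// => /eqP /(congr1 GRing.inv).
by rewrite !invrK.
Qed.

Lemma pole_deriv_ge z : z != a -> cabs (z - a) < Rdag ->
  cabs (fv f z) / K ^+ 2 / cabs (z - a) <= cabs (cderiv (fv f) z).
Proof.
move: K_gt0 (b_gt0) => k0 b0 zna zR.
set s := cabs (z - a); have s0 : 0 < s by rewrite cabs_gt0 subr_eq0.
have [_ hf hd _] := est zR zna; rewrite -/s in hd hf.
have m1 : 1 <= m%:R :> R by rewrite ler1n m_gt0.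
apply: le_trans hd.
have -> : K^-1 * (m%:R * b / s ^+ m.+1) = m%:R * ((K * (b / s ^+ m)) / K ^+ 2 / s).
  by rewrite exprSr; field; rewrite !gt_eqF ?exprn_gt0.
have h3 : cabs (fv f z) / K ^+ 2 / s <= K * (b / s ^+ m) / K ^+ 2 / s.
  by rewrite ler_pM2r ?invr_gt0// ler_pM2r ?invr_gt0 ?exprn_gt0.
apply: (le_trans h3); rewrite ler_peMl//.
by rewrite !mulr_ge0 ?invr_ge0 ?exprn_ge0// ltW.
Qed.

(** Expansion moves the circle of radius [eta * s] about [z0] at least [D] away from [w], so
    [disc_zero] solves f = w' for |w' - w| < D / 2. As |f' z0| >= |w| / (K^2 s), the factor [s]
    cancels and the solvable disc has radius proportional to |w|. *)
Lemma pole_branch w : b <= 1 -> Wmin <= cabs w ->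
  exists z0, [/\ cabs (z0 - a) < Rdag / 2, z0 != a, fv f z0 = w,
     cabs (z0 - a) ^+ m <= K / cabs w &
     forall w', cabs (w' - w) < et / (4 * K ^+ 2) * cabs w ->
       exists z, cabs (z - z0) < et * cabs (z0 - a) /\ fv f z = w'].
Proof.
move: (Rdag0) K_gt0 (b_gt0) eta_gt0 eta_le => Rd0 k0 b0 e0 e4 b1 wW.
have [z0 [z0R z0na z0w]] := pole_value b1 wW.
have w0 : 0 < cabs w.
  apply: lt_le_trans wW; rewrite /Wmin.
  have : 0 <= 2 * K * (1 + 2 / Rdag) ^+ M.
    by rewrite !mulr_ge0 ?exprn_ge0 ?addr_ge0 ?divr_ge0// ltW.
  lra.
have z0R' : cabs (z0 - a) < Rdag by lra.
set s := cabs (z0 - a); have s0 : 0 < s by rewrite cabs_gt0 subr_eq0.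
exists z0; split=> //.
  have [|h _] := @pole_radius_le z0 (cabs w) z0na z0R' w0; first by rewrite z0w.
  apply: (le_trans h); rewrite ler_pM2r ?invr_gt0//.
  by rewrite ler_piMr// ltW.
move=> w' ww'.
have dlow := pole_deriv_ge z0na z0R'; rewrite z0w -/s in dlow.
pose D := cabs (cderiv (fv f) z0) / 2 * (et * s).
have ww2 : cabs (w' - w) < D / 2.
  apply: (lt_le_trans ww').
  have -> : et / (4 * K ^+ 2) * cabs w = (cabs w / K ^+ 2 / s) / 2 * (et * s) / 2.
    by field; rewrite !gt_eqF.
  by rewrite /D ler_pM2r// ler_pM2r ?mulr_gt0// ler_pM2r.
have es0 : 0 < et * s by rewrite mulr_gt0.
have := @disc_zero _ (fun z => fv f z - w') z0 (et * s) (D - cabs (w' - w)) z0.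
have D0 : 0 <= cabs (w' - w) by exact: cabs_ge0.
case.
- by lra.
- move=> z zs.
  have h1 := cabs_tri z z0 a; have h2 := cabs_tri z0 z a.
  rewrite (cabsBC z0 z) -/s in h2; rewrite -/s in h1.
  have es : et * s <= s / 4 by rewrite mulrC ler_pM2l//; lra.
  have zna : z != a by rewrite -subr_eq0 -cabs_gt0; lra.
  have zR : cabs (z - a) < Rdag by rewrite -/s in z0R; lra.
  have fz := iso zR zna.
  have [l dl] := mero_cd merf fz.
  by eexists; apply: has_cdB; [exact: dl|exact: has_cd_cst].
- move=> z zs.
  have := @pole_expand z0 z z0 z0na (ltW z0R); rewrite subrr cabs0 zs -/s => H.
  have {}H : D <= cabs (fv f z - fv f z0) by apply: H; rewrite ?(ltW es0).
  rewrite z0w in H; have := cabs_tri (fv f z) w' w; lra.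
- by rewrite subrr cabs0.
- by rewrite z0w cabsBC; lra.
- move=> z [zs fz]; exists z; split=> //.
  by apply/eqP; rewrite -subr_eq0 fz.
Qed.

(** [K < cabs w * d ^+ M] forces the preimage [z0] within [d <= 1] of the pole; with |w| >= 4 K^2
    the derivative is then at least 4, whence the contraction by 1/2. Images are open because [f] is
    continuous and injective near [z0]; [univ_pullback] asks for an open domain. *)
Lemma pole_univalent w D d : b <= 1 -> Wmin <= cabs w -> 4 * K ^+ 2 <= cabs w ->
  0 < d <= 1 -> K < cabs w * d ^+ M -> D <= et / (4 * K ^+ 2) * cabs w ->
  exists phi : C -> C,
   [/\ (forall y, cabs (y - w) < D ->
         [/\ cabs (phi y - a) < 2 * d, phi y != a & f (phi y) = Some y]),
       (forall y y', cabs (y - w) < D -> cabs (y' - w) < D ->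
         cabs (phi y - phi y') <= cabs (y - y') / 2) &
       (forall V, copen V -> V `<=` cball w D -> copen (phi @` V))].
Proof.
move: (Rdag0) K_gt0 (b_gt0) eta_gt0 eta_le => Rd0 k0 b0 e0 e4 b1 wW w4 /andP[d0 d1] wd DW.
have [z0 [z0R z0na z0w zm br]] := pole_branch b1 wW.
have z0R' : cabs (z0 - a) < Rdag by lra.
have := pole_deriv_ge z0na z0R'; rewrite z0w => dlow.
have [s sE] : exists s, s = cabs (z0 - a) by eexists.
have s0 : 0 < s by rewrite sE cabs_gt0 subr_eq0.
rewrite -!sE in z0R z0R' zm br dlow.
have w0 : 0 < cabs w.
  by apply: lt_le_trans w4; rewrite mulr_gt0// exprn_gt0.
have sd : s < d.
  rewrite ltNge; apply/negP => ds.
  have h1 : d ^+ M <= s ^+ m.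
    apply: (@le_trans _ _ (d ^+ m)); first by apply: ler_wiXn2l => //; exact: ltW.
    by apply: lerXn2r => //; rewrite nnegrE ltW.
  have : K < K.
    apply: (lt_le_trans wd); rewrite mulrC -ler_pdivlMr//.
    exact: le_trans h1 zm.
  by rewrite ltxx.
have es : et * s <= s / 4 by rewrite mulrC ler_pM2l//; lra.
have df4 : 4 <= cabs (cderiv (fv f) z0).
  apply: le_trans dlow; rewrite ler_pdivlMr// ler_pdivlMr ?exprn_gt0//.
  apply: le_trans w4; rewrite -mulrA ler_pM2l// ler_piMl ?exprn_ge0 ?(ltW k0)//.
  lra.
have ex y : exists z, cabs (y - w) < D -> cabs (z - z0) < et * s /\ fv f z = y.
  have [yD|yD] := ltP (cabs (y - w)) D; last by exists 0.
  by have [z hz] := br y (lt_le_trans yD DW); exists z.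
have [phi Hphi] := choice ex.
have near z : cabs (z - z0) < et * s ->
    [/\ cabs (z - a) < 2 * d, z != a & f z = Some (fv f z)].
  move=> hz; have h1 := cabs_tri z z0 a; have h2 := cabs_tri z0 z a.
  rewrite (cabsBC z0 z) -sE in h2; rewrite -sE in h1.
  have zna : z != a by rewrite -subr_eq0 -cabs_gt0; lra.
  have zR : cabs (z - a) < Rdag by lra.
  by split=> //; [lra|apply: some_fv; exact: iso].
have expd x y : cabs (x - z0) < et * s -> cabs (y - z0) < et * s ->
    2 * cabs (x - y) <= cabs (fv f x - fv f y).
  move=> /ltW hx /ltW hy; have := @pole_expand z0 x y z0na.
  rewrite -sE => /(_ (ltW z0R) hx hy); have := cabs_ge0 (x - y).
  by move: (cabs (cderiv _ _)) (cabs (x - y)) (cabs (_ - _)) df4 => u v t; nra.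
exists phi; split.
- move=> y /Hphi[h1 h2]; have [h3 h4 h5] := near _ h1; split=> //.
  by rewrite h5 h2.
- move=> y y' /Hphi[h1 h2] /Hphi[h1' h2'].
  by have := expd _ _ h1 h1'; rewrite h2 h2'; lra.
move=> V oV VD _ [y Vy <-].
have [h1 h2] := Hphi _ (VD _ Vy).
have [_ _ h5] := near _ h1.
have [r [r0 rV]] := oV _ Vy.
have fy : f (phi y) <> None by rewrite h5.
have [d2 [d20 Hd2]] := mero_ccont merf fy r0.
have es1 : 0 < et * s - cabs (phi y - z0) by rewrite subr_gt0.
have [h [h0 hd he]] := pos_min2 d20 es1.
exists h; split=> // z; rewrite /cball /= => zh.
have zU : cabs (z - z0) < et * s by have := cabs_tri z (phi y) z0; lra.
have Vz : V (fv f z).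
  by apply: rV; rewrite /cball /= -h2; apply: Hd2; exact: lt_le_trans hd.
exists (fv f z) => //; have [g1 g2] := Hphi _ (VD _ Vz).
have := expd _ _ g1 zU; rewrite g2 subrr cabs0 => h6.
apply/eqP; rewrite -subr_eq0 -cabs_eq0; have := cabs_ge0 (phi (fv f z) - z).
by rewrite eq_le => ->; rewrite andbT; lra.
Qed.

Definition ncell : nat := (Num.Def.truncn (16 * K ^+ 2 / et)).+1.

(** For V <= |f| <= 4 V the distance to the pole lies between 1/T and s2, with s2 T <= 4 K^2. A grid
    of mesh eta / (2 T) over the square of half-side s2 has at most [ncell] columns, whatever the
    pole and [V], and two points of one cell are close enough for the expansion estimate. *)
Lemma pole_cells V : 0 < V -> exists cell : C -> nat,
  (forall x, x != a -> cabs (x - a) < Rdag -> V <= cabs (fv f x) -> cabs (fv f x) <= 4 * V ->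
     (cell x < ncell * ncell)%N) /\
  (forall x y, x != a -> cabs (x - a) < Rdag ->
     V <= cabs (fv f x) -> cabs (fv f x) <= 4 * V ->
     y != a -> cabs (y - a) < Rdag ->
     V <= cabs (fv f y) -> cabs (fv f y) <= 4 * V ->
     cell x = cell y -> cabs (x - y) <= et * cabs (x - a)).
Proof.
move: K_gt0 eta_gt0 (b_gt0) (K1) => k0 e0 b0 k1 V0.
have k2 : 1 <= K ^+ 2 by rewrite exprn_ege1.
have [s2 s2E] : exists s2, s2 = (K * b / V) `^ m%:R^-1 by eexists.
have [T TE] : exists T, T = (K * (4 * V) / b) `^ m%:R^-1 by eexists.
have s20 : 0 < s2 by rewrite s2E powR_gt0// divr_gt0// mulr_gt0.
have T0 : 0 < T by rewrite TE powR_gt0// divr_gt0// !mulr_gt0.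
have s2T : s2 * T <= 4 * K ^+ 2.
  rewrite s2E TE -powRM; last 2 first.
  - by rewrite divr_ge0 ?mulr_ge0// ltW.
  - by rewrite divr_ge0 ?mulr_ge0// ltW.
  have -> : K * b / V * (K * (4 * V) / b) = 4 * K ^+ 2 by field; rewrite !gt_eqF.
  rewrite -[leRHS]powRr1; last by lra.
  by rewrite ler_powR//; [lra|rewrite invf_le1 ?ltr0n// ler1n].
have [h hE] : exists h, h = et / T / 2 by eexists.
have h0 : 0 < h by rewrite hE !divr_gt0.
have s2h : 2 * s2 / h <= 16 * K ^+ 2 / et.
  have -> : 2 * s2 / h = 4 * (s2 * T) / et by rewrite hE; field; rewrite !gt_eqF.
  have ei : 0 <= et^-1 by rewrite invr_ge0 ltW.
  apply: ler_wpM2r => //; move: s2T; move: (s2 * T) (K ^+ 2) => y k; lra.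
pose ci (t : R) := Num.Def.truncn ((t + s2) / h).
have ci_lt t : - s2 <= t <= s2 -> (ci t < ncell)%N.
  move=> ht; rewrite /ci /ncell ltnS; apply: le_truncn; apply: le_trans s2h.
  by rewrite ler_pM2r ?invr_gt0//; lra.
have ci_eq t t' : - s2 <= t -> - s2 <= t' -> ci t = ci t' -> `|t - t'| <= h.
  move=> ht ht' E.
  have t1 : 0 <= t + s2 by lra.
  have t2 : 0 <= t' + s2 by lra.
  have /andP[a1 a2] := truncn_itv (divr_ge0 t1 (ltW h0)).
  have /andP[a3 a4] := truncn_itv (divr_ge0 t2 (ltW h0)).
  move: a1 a2 a3 a4; rewrite -/(ci t) -/(ci t') E -natr1.
  rewrite !ler_pdivlMr// !ltr_pdivrMr// => a1 a2 a3 a4.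
  by rewrite ler_norml; lra.
pose cell (x : C) := (ci (complex.Re (x - a)%R) * ncell + ci (complex.Im (x - a)%R))%N.
have inR (x : C) : x != a -> cabs (x - a) < Rdag -> V <= cabs (fv f x) ->
    - s2 <= complex.Re (x - a) <= s2 /\ - s2 <= complex.Im (x - a) <= s2.
  move=> xna xR Vx; have [_ h2] := pole_radius_le xna xR V0 Vx.
  rewrite -s2E in h2; rewrite -!ler_norml; split; [exact: le_trans (Re_le_cabs _) h2|exact: le_trans (Im_le_cabs _) h2].
exists cell; split.
  move=> x xna xR Vx _; have [h1 h2] := inR x xna xR Vx.
  rewrite /cell; apply: (@leq_trans ((ci (complex.Re (x - a)%R)).+1 * ncell)%N).
    by rewrite mulSn addnC ltn_add2r ci_lt.
  by rewrite leq_mul2r ci_lt// orbT.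
move=> x y xna xR Vx Wx yna yR Vy Wy E.
have [hx1 hx2] := inR x xna xR Vx; have [hy1 hy2] := inR y yna yR Vy.
have E1 : ci (complex.Re (x - a)) = ci (complex.Re (y - a)).
  have := congr1 (fun n => n %/ ncell)%N E; rewrite /cell !divnMDl//.
  by rewrite !divn_small ?ci_lt// !addn0.
have E2 : ci (complex.Im (x - a)) = ci (complex.Im (y - a)).
  have := congr1 (fun n => n %% ncell)%N E; rewrite /cell !modnMDl.
  by rewrite !modn_small ?ci_lt.
have d1 := ci_eq _ _ (proj1 (andP hx1)) (proj1 (andP hy1)) E1.
have d2 := ci_eq _ _ (proj1 (andP hx2)) (proj1 (andP hy2)) E2.
have [_ h3] := pole_radius_ge xna xR Wx; rewrite -TE in h3.
have p0 : 0 < cabs (x - a) by rewrite cabs_gt0 subr_eq0.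
apply: (@le_trans _ _ (et / T)); last first.
  by rewrite ler_pM2l// invf_ple ?posrE.
have -> : et / T = h + h by rewrite hE; field; rewrite gt_eqF.
apply: (le_trans (cabs_le_ReIm _)); apply: lerD.
  by move: d1; rewrite !creB; congr (_ <= _); congr (`|_|); ring.
by move: d2; rewrite !cimB; congr (_ <= _); congr (`|_|); ring.
Qed.

End OnePole.

(** * Hausdorff measure *)

Section Hausdorff.
Variable R : realType.
Local Notation C := (R[i]).
Implicit Types (A B U : set C) (s t d : R) (v : \bar R).

Lemma cdiam_le U d : (forall x y, U x -> U y -> cabs (x - y) <= d) -> (cdiam U <= d%:E)%E.
Proof.
by move=> H; apply: ge_ereal_sup => _ [[x y] [/= Ux Uy] <-]; rewrite lee_fin H.
Qed.

Lemma cdiam_ge U x y : U x -> U y -> ((cabs (x - y))%:E <= cdiam U)%E.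
Proof. by move=> Ux Uy; apply: ereal_sup_ubound; exists (x, y). Qed.

Lemma cdiam_fin U d x : U x -> (cdiam U <= d%:E)%E ->
  cdiam U = (fine (cdiam U))%:E /\ 0 <= fine (cdiam U).
Proof.
move=> Ux Ud; have := cdiam_ge Ux Ux; rewrite subrr cabs0 => h0.
have fin : cdiam U \is a fin_num.
  by rewrite ge0_fin_numE// (le_lt_trans Ud) ?ltry.
by rewrite fineK// fine_ge0.
Qed.

Lemma hterm_ge0 s U : (0 <= hterm s U)%E.
Proof. by rewrite /hterm; case: ifP => // _; rewrite lee_fin powR_ge0. Qed.

Lemma hterm_set0 s : hterm s (set0 : set C) = 0%E.
Proof. by rewrite /hterm asboolT. Qed.

Lemma htermE s U x : U x -> hterm s U = (fine (cdiam U) `^ s)%:E.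
Proof. by move=> Ux; rewrite /hterm asboolF// => U0; rewrite U0 in Ux. Qed.

(** An actual cover of mesh [d] and total at most [v], rather than a bound on the infimum: this is
    what can be pulled back and united in the inductions. *)
Definition hcov s d A v := exists U : nat -> set C,
  [/\ A `<=` \bigcup_i U i, forall i, (cdiam (U i) <= d%:E)%E &
      (\sum_(0 <= i <oo) hterm s (U i) <= v)%E].

Lemma haus_delta_le s d A v : hcov s d A v -> (haus_delta s d A <= v)%E.
Proof.
by move=> [U [AU Ud Uv]]; apply: le_trans Uv; apply: ereal_inf_lbound; exists U.
Qed.

Lemma haus_delta_ge0 s d A : (0 <= haus_delta s d A)%E.
Proof.
apply: le_ereal_inf_tmp => _ [U _ <-]; apply: nneseries_ge0 => n _ _.
exact: hterm_ge0.
Qed.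

Lemma hausdorff0P s A : hausdorff s A = 0%E <->
  forall d e : R, 0 < d -> 0 < e -> hcov s d A e%:E.
Proof.
split=> [h d e d0 e0|h].
  have : (haus_delta s d A < e%:E)%E.
    apply: (@le_lt_trans _ _ 0%E); last by rewrite lte_fin.
    by rewrite -h; apply: ereal_sup_ubound; exists d.
  by move=> /ereal_inf_lt[_ [U [AU Ud] <-]] /ltW ?; exists U.
apply/eqP; rewrite eq_le; apply/andP; split.
  apply: ge_ereal_sup => _ [d /= d0 <-]; apply/lee_addgt0Pr => e e0.
  by rewrite add0e; apply: haus_delta_le; exact: h.
apply: (@le_trans _ _ (haus_delta s 1 A)); first exact: haus_delta_ge0.
by apply: ereal_sup_ubound; exists 1 => //=.
Qed.

Lemma hcov_sub s d d' A B v v' : A `<=` B -> d <= d' -> (v <= v')%E ->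
  hcov s d B v -> hcov s d' A v'.
Proof.
move=> AB dd vv [U [BU Ud Uv]]; exists U; split.
- exact: subset_trans BU.
- by move=> i; apply: le_trans (Ud i) _; rewrite lee_fin.
- exact: le_trans vv.
Qed.

Lemma hcov_set0 s d : hcov s d set0 0%E.
Proof.
exists (fun _ => set0); split=> //.
- by move=> i; apply: cdiam_le.
- by rewrite eseries0// => i _ _; rewrite hterm_set0.
Qed.

Lemma hcov_single s d A : A !=set0 -> 0 <= s -> 0 <= d ->
  (forall x y, A x -> A y -> cabs (x - y) <= d) -> hcov s d A (d `^ s)%:E.
Proof.
move=> [x Ax] s0 d0 Ad.
exists (fun i => if i is 0%N then A else set0); split.
- by move=> z Az; exists 0%N.
- by case=> [|i]; apply: cdiam_le.
- rewrite (nneseries_split _ 1%N); last by move=> k _; exact: hterm_ge0.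
  rewrite add0n big_nat1 eseries0 ?adde0; last by case=> // i _ _; rewrite hterm_set0.
  rewrite (htermE _ Ax) lee_fin.
  have Adiam := cdiam_le Ad; have [E D0] := cdiam_fin Ax Adiam.
  by apply: ge0_ler_powR; rewrite ?nnegrE// -lee_fin -E.
Qed.

Lemma hcov_bigcup s d (A : nat -> set C) (v : nat -> \bar R) :
  (forall i, hcov s d (A i) (v i)) ->
  hcov s d (\bigcup_i A i) (\sum_(0 <= i <oo) v i)%E.
Proof.
move=> /choice[U HU].
have /card_esym/ppcard_eqP[e] := card_nat2.
pose W n := U (e n).1 (e n).2.
exists W; split.
- move=> z [i _ Az]; have [AU _ _] := HU i; have [j _ Uz] := AU z Az.
  exists (e^-1%FUN (i, j)) => //; rewrite /W.
  have -> : e (e^-1%FUN (i, j)) = (i, j) by rewrite invK ?inE.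
  exact: Uz.
- by move=> n; have [_ + _] := HU (e n).1; exact.
rewrite nneseries_esumT; last by move=> n; exact: hterm_ge0.
rewrite -(@reindex_esum _ _ _ [set: nat] [set: nat * nat] e (fun k => hterm s (U k.1 k.2))); last first.
  exact: bij.
rewrite (_ : [set: nat * nat] = [set: nat] `*`` (fun _ => [set: nat])); last first.
  by apply/seteqP; split=> // k.
rewrite -(@esum_esum _ _ _ _ _ (fun i j => hterm s (U i j))); last by move=> *; exact: hterm_ge0.
rewrite -nneseries_esumT; last by move=> n; apply: esum_ge0 => *; exact: hterm_ge0.
apply: lee_nneseries => [i _ _|i _]; first by apply: esum_ge0 => *; exact: hterm_ge0.
rewrite -nneseries_esumT; last by move=> n; exact: hterm_ge0.
by have [] := HU i.
Qed.

Lemma hcovU s d A B v v' : (0 <= v)%E -> (0 <= v')%E ->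
  hcov s d A v -> hcov s d B v' -> hcov s d (A `|` B) (v + v')%E.
Proof.
move=> v0 v'0 hA hB.
have := @hcov_bigcup s d (fun i => if i is 0%N then A else if i is 1%N then B else set0)
  (fun i => if i is 0%N then v else if i is 1%N then v' else 0%E).
move=> /(_ _)H; have {}H := H (fun i => match i with 0%N => hA | 1%N => hB | _ => hcov_set0 s d end).
apply: hcov_sub H => //; first by move=> z [Az|Bz]; [exists 0%N|exists 1%N].
rewrite (nneseries_split _ 2%N); last by case=> [|[]].
rewrite add0n big_nat_recr//= big_nat1 eseries0 ?adde0//.
by case=> // -[].
Qed.

Lemma hcov_big (T : eqType) s d (l : seq T) (A : T -> set C) (v : T -> R) :
  (forall a, a \in l -> 0 <= v a /\ hcov s d (A a) (v a)%:E) ->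
  hcov s d [set z | exists2 a, a \in l & A a z] (\sum_(a <- l) v a)%:E.
Proof.
elim: l => [|a l IH] H.
  rewrite big_nil; apply: hcov_sub (hcov_set0 s d) => //.
  by move=> z [a]; rewrite in_nil.
rewrite big_cons EFinD.
have [va hA] := H a (mem_head _ _).
have hl : hcov s d [set z | exists2 a, a \in l & A a z] (\sum_(a <- l) v a)%:E.
  by apply: IH => b bl; apply: H; rewrite inE bl orbT.
have := hcovU _ _ hA hl; rewrite !lee_fin => /(_ va) h.
apply: hcov_sub (h _) => //.
  move=> z [b]; rewrite inE => /predU1P[->|bl] Az; first by left.
  by right; exists b.
by rewrite big_seq; apply: sumr_ge0 => b bl; have [] := H b; rewrite ?inE ?bl ?orbT.
Qed.

Lemma hcov_lipschitz s d L A B (phi : C -> C) v : 0 <= s -> 0 <= L -> 0 <= d ->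
  (forall x, A x -> B (phi x)) ->
  (forall x y, A x -> A y -> cabs (x - y) <= L * cabs (phi x - phi y)) ->
  hcov s d B v -> hcov s (L * d) A ((L `^ s)%:E * v)%E.
Proof.
move=> s0 L0 d0 AB lip [U [BU Ud Uv]].
have dU i x y : U i x -> U i y -> cabs (x - y) <= d.
  by move=> Ux Uy; rewrite -lee_fin; exact: le_trans (cdiam_ge Ux Uy) (Ud i).
exists (fun i => [set x | A x /\ U i (phi x)]); split.
- by move=> x Ax; have [i _ Ui] := BU _ (AB x Ax); exists i.
- move=> i; apply: cdiam_le => x y [Ax Ux] [Ay Uy]; apply: (le_trans (lip _ _ Ax Ay)).
  by rewrite ler_wpM2l// (dU i).
apply: (@le_trans _ _ (\sum_(0 <= i <oo) ((L `^ s)%:E * hterm s (U i)))%E); last first.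
  rewrite nneseriesZl; last by move=> *; exact: hterm_ge0.
  by apply: lee_wpmul2l => //; rewrite lee_fin powR_ge0.
apply: lee_nneseries => [i _ _|i _]; first exact: hterm_ge0.
have [[x [Ax Ux]]|/set0P/negP] := pselect ([set x | A x /\ U i (phi x)] !=set0); last first.
  move=> /negPn/eqP ->; rewrite hterm_set0 mule_ge0 ?hterm_ge0// lee_fin powR_ge0//.
have [E D0] := cdiam_fin Ux (Ud i).
have D' : (cdiam [set x | A x /\ U i (phi x)] <= (L * fine (cdiam (U i)))%:E)%E.
  apply: cdiam_le => u w [Au Uu] [Aw Uw]; apply: (le_trans (lip _ _ Au Aw)).
  by rewrite ler_wpM2l// -lee_fin -E cdiam_ge.
have Ux' : [set x | A x /\ U i (phi x)] x by split.
have [E' D0'] := cdiam_fin Ux' D'.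
rewrite (htermE _ Ux) (htermE _ Ux') -EFinM lee_fin -powRM//.
apply: ge0_ler_powR; rewrite ?nnegrE ?mulr_ge0//.
by rewrite -lee_fin -E'.
Qed.

Lemma hausdorff0_sub s A B : A `<=` B -> hausdorff s B = 0%E -> hausdorff s A = 0%E.
Proof.
move=> AB /hausdorff0P h; apply/hausdorff0P => d e d0 e0.
exact: hcov_sub (h d e d0 e0).
Qed.

Lemma hausdorff0_bigcup s (A : nat -> set C) : (forall i, hausdorff s (A i) = 0%E) ->
  hausdorff s (\bigcup_i A i) = 0%E.
Proof.
move=> h; apply/hausdorff0P => d e d0 e0.
have H i : hcov s d (A i) (e / (2 ^ i.+1)%:R)%:E.
  have /hausdorff0P := h i; apply=> //.
  by rewrite divr_gt0// ltr0n expn_gt0.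
apply: hcov_sub (hcov_bigcup H) => //.
by apply: epsilon_trick0; exact: ltW.
Qed.

Lemma hausdorff0_lipschitz s L A B (phi : C -> C) : 0 <= s -> 0 < L ->
  (forall x, A x -> B (phi x)) ->
  (forall x y, A x -> A y -> cabs (x - y) <= L * cabs (phi x - phi y)) ->
  hausdorff s B = 0%E -> hausdorff s A = 0%E.
Proof.
move=> s0 L0 AB lip /hausdorff0P h; apply/hausdorff0P => d e d0 e0.
have Ls : 0 < L `^ s by rewrite powR_gt0.
have dL : 0 < d / L by rewrite divr_gt0.
have eL : 0 < e / L `^ s by rewrite divr_gt0.
have := hcov_lipschitz s0 (ltW L0) (ltW dL) AB lip (h _ _ dL eL).
by rewrite -EFinM mulrC mulrVK ?unitfE ?gt_eqF// mulrC mulrVK ?unitfE ?gt_eqF.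
Qed.

Lemma HD_le s A : 0 <= s -> hausdorff s A = 0%E -> HD A <= s.
Proof. by move=> s0 h; apply: ge_inf; [exists 0 => x []|]. Qed.

(** The exponent [t] guarantees that the infimum in [HD] is over a nonempty set; the infimum of the
    empty set would be 0. *)
Lemma HD_ge s t A : 0 <= t -> hausdorff t A = 0%E ->
  (forall x, 0 <= x -> x < s -> hausdorff x A <> 0%E) -> s <= HD A.
Proof.
move=> t0 h H; apply: lb_le_inf; first by exists t.
by move=> x [x0 hx]; rewrite leNgt; apply/negP => xs; exact: (H x).
Qed.

Lemma HD_mono t A B : 0 <= t -> hausdorff t B = 0%E -> A `<=` B -> HD A <= HD B.
Proof.
move=> t0 h AB; apply: lb_le_inf; first by exists t.
by move=> x [x0 hx]; exact: (HD_le x0 (hausdorff0_sub AB hx)).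
Qed.

Lemma HD_ge0 A : 0 <= HD A.
Proof.
rewrite /HD; set S := [set s | _].
have [->|/set0P [x Sx]] := eqVneq S set0; first by rewrite inf0.
by apply: lb_le_inf; [exists x|move=> y []].
Qed.

End Hausdorff.

(** * Upper bound *)

Section PoleNeighbourhoods.
Variable R : realType.
Local Notation C := (R[i]).
Variables (f : C -> option C) (Pstar : set C) (Rdag : R) (M : nat) (beta K : R).
Hypothesis merf : meromorphic f.
Hypothesis Pp : Pstar `<=` poles f.
Hypothesis finP : finite_set (poles f `\` Pstar).
Hypothesis Rdag0 : 0 < Rdag.
Hypothesis sep : forall a1 a2, poles f a1 -> poles f a2 -> a1 <> a2 ->
  cball a1 Rdag `&` cball a2 Rdag = set0.
Hypothesis beta0 : 0 <= beta.
Hypothesis mM : forall a, Pstar a -> (1 <= mult f a <= M)%N.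
Hypothesis K1 : 1 <= K.
Hypothesis est : forall a z, Pstar a -> cball a Rdag z -> z != a ->
  [/\ K^-1 * (cabs a `^ (- beta) / cabs (z - a) ^+ mult f a) <= cabs (fv f z),
      cabs (fv f z) <= K * (cabs a `^ (- beta) / cabs (z - a) ^+ mult f a),
      K^-1 * ((mult f a)%:R * cabs a `^ (- beta) / cabs (z - a) ^+ (mult f a).+1)
        <= cabs (cderiv (fv f) z) &
      cabs (cderiv (fv f) z)
        <= K * ((mult f a)%:R * cabs a `^ (- beta) / cabs (z - a) ^+ (mult f a).+1)].

Lemma pole_isolated a z : f a = None -> cabs (z - a) < Rdag -> z != a -> f z <> None.
Proof.
move=> fa za zna fz.
have E : cball a Rdag `&` cball z Rdag = set0.
  by apply: sep => //; apply/eqP; rewrite eq_sym.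
suff : (cball a Rdag `&` cball z Rdag) z by rewrite E.
by split=> //; rewrite /cball /= subrr cabs0.
Qed.

(** A power of 0 with nonzero exponent is 0, so the claim concerns a possible pole at the origin:
    there the upper estimate would force [f] to vanish near the pole. *)
Lemma ba_gt0 a : Pstar a -> 0 < cabs a `^ (- beta).
Proof.
move=> Pa; rewrite lt_def powR_ge0 andbT; apply/eqP => b0.
have fa := Pp Pa; have [r [r0 H]] := pole_large merf 0 fa.
have [h [h0 hr hR]] := pos_min2 r0 Rdag0.
pose z : C := a + (h / 2)%:C%C.
have za : cabs (z - a) = h / 2 by rewrite /z addrAC subrr add0r cabsr ger0_norm//; lra.
have zna : z != a by rewrite -subr_eq0 -cabs_gt0 za; lra.
have zR : cball a Rdag z by rewrite /cball /= za; lra.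
have [_ + _ _] := est Pa zR zna; rewrite b0 mul0r mulr0.
have [|//|_ h1 h2] := H z; first by rewrite za; lra.
by have := lt_le_trans h1 h2; rewrite ltxx.
Qed.

Lemma ba_le1 (a : C) : 1 <= cabs a -> cabs a `^ (- beta) <= 1.
Proof. by move=> a1; rewrite -(powRr0 (cabs a)) ler_powR// oppr_le0. Qed.

Lemma pole_cderiv_neq0 a z : Pstar a -> cabs (z - a) < Rdag -> z != a ->
  cderiv (fv f) z != 0.
Proof.
move=> Pa zR zna; have [_ _ + _] := est Pa zR zna.
rewrite -cabs_gt0; apply: lt_le_trans.
have s0 : 0 < cabs (z - a) by rewrite cabs_gt0 subr_eq0.
have m0 : 0 < (mult f a)%:R :> R by rewrite ltr0n; have /andP[] := mM Pa.
rewrite mulr_gt0 ?invr_gt0 ?(lt_le_trans ltr01 K1)//.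
by rewrite mulr_gt0 ?invr_gt0 ?exprn_gt0// mulr_gt0// ba_gt0.
Qed.

(** Covers the poles without uniform estimates. With f = g / (z - a)^k, the numerator of f' is g' (z
    - a) - k g; the radius s / 32 makes the first term at most |g a| / 4, while |g| >= |g a| / 2. *)
Lemma pole_good a : f a = None -> exists rB : R * R,
  [/\ 0 < rB.1 <= Rdag / 2, 0 <= rB.2,
   (forall z, cabs (z - a) = rB.1 -> cabs (fv f z) <= rB.2) &
   (forall z, cabs (z - a) < rB.1 -> z != a -> cderiv (fv f) z != 0)].
Proof.
move: (Rdag0) => Rd0 fa; have [k [k0 [_ [r [r0 [g [hg [ga H]]]]]]]] := mero_pole merf fa.
have dg z : cabs (z - a) < r -> has_cd g z (cderiv g z).
  by move=> zr; apply: derivable_has_cd; exact: hg.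
have cg : ccont g a by apply: has_cd_ccont (dg a _); rewrite subrr cabs0.
have ga0 : 0 < cabs (g a) by rewrite cabs_gt0.
have [|d [d0 Hd]] := cg (cabs (g a) / 2); first by lra.
have [s' [s'0 s'r s'd]] := pos_min2 r0 d0.
pose s := s' / 2; have s0 : 0 < s by rewrite /s; lra.
have sr : s < r by rewrite /s; lra.
have sd : s < d by rewrite /s; lra.
pose B := 2 * cabs (g a); have B0 : 0 <= B by rewrite /B; lra.
have gB z : cabs (z - a) <= s -> cabs (g z) <= B /\ cabs (g a) / 2 <= cabs (g z).
  move=> zs; have zd : cabs (z - a) < d by lra.
  have := Hd z zd; have := cabsB_ge (g a) (g z); have := cabsB_ge (g z) (g a).
  by rewrite (cabsBC (g a)) /B; lra.
have g'B y : cabs (y - a) <= s / 2 -> cabs (cderiv g y) <= 4 * B / s.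
  apply: (@disc_deriv_bound _ g (cderiv g) a s B s0 B0) => z zs; last by have [] := gB z zs.
  by apply: dg; lra.
have [||h1 [h10 h1a h1b]] := @pos_min2 R (s / 2) (Rdag / 2); [lra|lra|].
have [|h [h0 hh hs]] := @pos_min2 R h1 (s / 32) h10; first by lra.
exists (h, B / h ^+ k); split=> /=.
- by rewrite h0; lra.
- by rewrite divr_ge0// exprn_ge0// ltW.
- move=> z zh; have zs : cabs (z - a) <= s by lra.
  have zna : z != a by rewrite -subr_eq0 -cabs_gt0; lra.
  have zr : cball a r z by rewrite /cball /=; lra.
  rewrite (fv_some (H z zr zna)) cabsM cabsV cabsX zh ler_pM2r ?invr_gt0 ?exprn_gt0//.
  by have [] := gB z zs.
move=> z zh zna.
have zr : cabs (z - a) < r by lra.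
have zs : cabs (z - a) <= s by lra.
have p0 : 0 < cabs (z - a) by rewrite cabs_gt0 subr_eq0.
have za0 : z - a != 0 by rewrite subr_eq0.
have dq : has_cd (fun w => g w * ((w - a) ^+ k)^-1) z (cderiv g z * ((z - a) ^+ k)^-1 +
   g z * (- (k%:R * (z - a) ^+ k.-1 * (1 - 0)) / ((z - a) ^+ k) ^+ 2)).
  apply: has_cdM; first exact: dg.
  apply: has_cdV; first by rewrite expf_neq0.
  by apply: has_cdX; apply: has_cdB; [exact: has_cd_id|exact: has_cd_cst].
have [e [e0 ea er]] : exists e, [/\ 0 < e, e <= cabs (z - a) & e <= r - cabs (z - a)].
  by apply: pos_min2 => //; lra.
have df : has_cd (fv f) z (cderiv g z * ((z - a) ^+ k)^-1 +
   g z * (- (k%:R * (z - a) ^+ k.-1 * (1 - 0)) / ((z - a) ^+ k) ^+ 2)).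
  apply: has_cd_ext e0 _ dq => w we; rewrite (fv_some (H w _ _))//.
    by rewrite /cball /=; have := cabs_tri w z a; lra.
  by apply/eqP => wa; move: we; rewrite wa cabsBC; lra.
have [_ ->] := has_cd_derivable df.
have -> : cderiv g z * ((z - a) ^+ k)^-1 +
   g z * (- (k%:R * (z - a) ^+ k.-1 * (1 - 0)) / ((z - a) ^+ k) ^+ 2) =
   (cderiv g z * (z - a) - k%:R * g z) / (z - a) ^+ k.+1.
  case: (k) k0 => // j _ /=; rewrite subr0 mulr1 !exprS.
  by field; rewrite za0 expf_neq0.
rewrite mulf_neq0 ?invr_eq0 ?expf_neq0// subr_eq0; apply/eqP => E.
have := congr1 (@cabs R) E; rewrite !cabsM.
have kk : cabs (k%:R : C) = k%:R :> R.
  rewrite (_ : (k%:R : C) = (k%:R : R)%:C%C); last by rewrite rmorph_nat.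
  by rewrite cabsr ger0_norm.
rewrite kk => E2.
have k1 : 1 <= k%:R :> R by rewrite ler1n.
have zs2 : cabs (z - a) <= s / 2 by lra.
have h3 := g'B z zs2; have [_ h4] := gB z zs.
have : cabs (cderiv g z) * cabs (z - a) <= 4 * B / s * (s / 32).
  by apply: ler_pM; rewrite ?cabs_ge0//; lra.
have -> : 4 * B / s * (s / 32) = cabs (g a) / 4 by rewrite /B; field; lra.
have : cabs (g z) <= k%:R * cabs (g z) by rewrite ler_peMl ?cabs_ge0.
lra.
Qed.

(** Only finitely many poles lie outside [Pstar] or in the unit disc, where |a|^(-beta) <= 1 may
    fail. They use the radii of [pole_good], all others use Rdag / 2, so one bound [K0] exists. *)
Lemma pole_radii : exists (rad : C -> R) (K0 : R), 1 <= K0 /\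
  forall a, f a = None -> [/\ 0 < rad a <= Rdag / 2,
    (forall z, cabs (z - a) = rad a -> f z <> None /\ cabs (fv f z) <= K0) &
    (forall z, cabs (z - a) < rad a -> z != a -> cderiv (fv f) z != 0)].
Proof.
move: (Rdag0) (lt_le_trans ltr01 K1) => Rd0 k0.
have /choice[F HF] : forall a, exists rB : R * R, f a = None ->
  [/\ 0 < rB.1 <= Rdag / 2, 0 <= rB.2,
   (forall z, cabs (z - a) = rB.1 -> cabs (fv f z) <= rB.2) &
   (forall z, cabs (z - a) < rB.1 -> z != a -> cderiv (fv f) z != 0)].
  move=> a; have [/pole_good[rB h]|nfa] := pselect (f a = None); first by exists rB.
  by exists (0, 0).
pose Good := [set a | Pstar a /\ 1 <= cabs a].
pose Bad := [set a | f a = None /\ ~ Good a].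
have finBad : finite_set Bad.
  apply: (@sub_finite_set _ _ ((poles f `\` Pstar) `|` [set a | f a = None /\ cabs a <= 1])).
    move=> a [fa ng]; have [Pa|nP] := pselect (Pstar a); last by left.
    by right; split=> //; rewrite leNgt; apply/negP => a1; apply: ng; split=> //; exact: ltW.
  by rewrite finite_setU; split=> //; exact: poles_finite.
pose q := 1 + 2 / Rdag.
have q1 : 1 <= q by rewrite lerDl divr_ge0// ltW.
have qM : 1 <= q ^+ M by rewrite exprn_ege1.
pose S := \sum_(a <- fset_set Bad) (F a).2.
have S0 a : Bad a -> (F a).2 <= S.
  move=> Ba; have aB : a \in fset_set Bad by rewrite in_fset_set//; exact: mem_set.
  rewrite /S (big_rem a)//= lerDl big_seq sumr_ge0// => b bB.
  have : Bad b by apply: set_mem; rewrite -in_fset_set//; exact: mem_rem bB.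
  by move=> [fb _]; have [] := HF b fb.
pose K0 := Num.max 1 (Num.max S (K * q ^+ M)).
exists (fun a => if `[< Good a >] then Rdag / 2 else (F a).1), K0.
split; first by rewrite /K0 le_max lexx.
move=> a fa; case: asboolP => [[Pa a1]|ng].
  split; first by lra.
    move=> z zR; have zR' : cabs (z - a) < Rdag by lra.
    have zna : z != a by rewrite -subr_eq0 -cabs_gt0; lra.
    split; first exact: (pole_isolated fa zR' zna).
    have [_ h _ _] := est Pa zR' zna; apply: (le_trans h).
    rewrite /K0 !le_max ler_pM2l//; apply/orP; right; apply/orP; right.
    rewrite zR; apply: (@le_trans _ _ (1 * q ^+ mult f a)).
      apply: ler_pM; rewrite ?powR_ge0 ?ba_le1//.
        by rewrite invr_ge0 exprn_ge0// divr_ge0// ltW.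
      have rr : 0 < Rdag / 2 by rewrite divr_gt0.
      rewrite -exprVn lerXn2r ?nnegrE ?invr_ge0 ?(ltW rr) ?(le_trans ler01 q1)//.
      by rewrite invf_div /q lerDr.
    by rewrite mul1r ler_weXn2l//; have /andP[] := mM Pa.
  move=> z zR zna; apply: (pole_cderiv_neq0 Pa) => //.
  by apply: lt_trans zR _; rewrite ltr_pdivrMr// ltr_pMr// ltr1n.
have [h1 h2 h3 h4] := HF a fa; split=> //.
move=> z zr; have zna : z != a by rewrite -subr_eq0 -cabs_gt0 zr; case/andP: h1.
have zR' : cabs (z - a) < Rdag by rewrite zr; case/andP: h1; lra.
split; first exact: (pole_isolated fa zR' zna).
apply: (le_trans (h3 z zr)); apply: (le_trans (S0 a _)); first by split.
by rewrite /K0 !le_max lexx orbT.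
Qed.

End PoleNeighbourhoods.

(** * Sums over large poles *)

Section PoleTail.
Variable R : realType.
Local Notation C := (R[i]).
Variable f : C -> option C.
Hypothesis merf : meromorphic f.

Lemma powRXn (x u : R) n : 0 <= x -> (x ^+ n) `^ u = (x `^ u) ^+ n.
Proof. by move=> x0; rewrite -powR_mulrn// powRAC powR_mulrn// powR_ge0. Qed.

(** The poles are listed by shells lam^j r <= |a| <= lam^(j+1) r, each finite. With sigma between
    rho and tau, [order_count] bounds the j-th sum by a constant times (lam^j r)^(sigma - tau). The
    summable bounds fit a countable union of finite covers. *)
Lemma pole_tail (rho tau e : R) : has_order f rho -> 0 < rho -> rho < tau -> 0 < e ->
  exists r0, 1 <= r0 /\ forall r, r0 <= r -> exists l : nat -> seq C,
    [/\ forall j a, a \in l j -> f a = None /\ r <= cabs a,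
        forall a, f a = None -> r <= cabs a -> exists j, a \in l j &
        forall j, \sum_(a <- l j) cabs a `^ (- tau) <= e / (2 ^ j.+1)%:R].
Proof.
move=> ho rho0 rt e0; pose sigma := (rho + tau) / 2.
have s0 : 0 < sigma by rewrite /sigma; lra.
have [|Kc [Kc0 HK]] := order_count merf ho (_ : rho < sigma) s0; first by rewrite /sigma; lra.
have u0 : 0 < tau - sigma by rewrite /sigma; lra.
set u := tau - sigma in u0.
pose p := (Num.Def.truncn u^-1).+1.
have pu : 1 <= p%:R * u.
  by rewrite -ler_pdivrMr// mul1r ltW// truncnS_gt.
pose lam : R := 2 ^+ p.
have lam1 : 2 <= lam.
  by rewrite /lam -[leLHS]expr1 ler_weXn2l// ler1n.
have lam0 : 0 < lam by lra.
have lamu : lam `^ (- u) <= 2^-1.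
  rewrite /lam powRXn// -powR_mulrn ?powR_ge0// -powRrM -[leRHS]powR_inv1//.
  by rewrite ler_powR ?ler1n// mulNr lerN2 mulrC.
pose D := 2 * Kc * lam `^ sigma / e.
have ls0 : 0 < lam `^ sigma by rewrite powR_gt0.
have D0 : 0 < D by rewrite divr_gt0// !mulr_gt0.
exists (Num.max 1 (D `^ u^-1)); split; first by rewrite le_max lexx.
move=> r; rewrite ge_max => /andP[r1 rD].
have r0 : 0 < r by lra.
have ru : Kc * lam `^ sigma * r `^ (- u) <= e / 2.
  have Dr : D <= r `^ u.
    rewrite -[leLHS](@powRr1 _ D) ?(ltW D0)// -(@mulVf _ u) ?gt_eqF// powRrM.
    by apply: ge0_ler_powR; rewrite ?nnegrE ?powR_ge0 ?(ltW r0) ?(ltW u0).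
  have ru0 : 0 < r `^ u by rewrite powR_gt0.
  rewrite powRN ler_pdivrMr//; move: Dr; rewrite /D ler_pdivrMr//; lra.
pose X j : R := lam ^+ j * r.
have X0 j : 0 < X j by rewrite mulr_gt0// exprn_gt0.
have X1 j : 1 <= X j by rewrite -[leLHS]mulr1 ler_pM// exprn_ege1//; lra.
have XS j : X j.+1 = lam * X j by rewrite /X exprS mulrA.
pose A j := [set a | f a = None /\ cabs a <= X j.+1].
pose l j := [seq a <- fset_set (A j) | X j <= cabs a].
have lP j a : a \in l j -> [/\ f a = None, X j <= cabs a & cabs a <= X j.+1].
  rewrite mem_filter => /andP[Xa]; rewrite in_fset_set; last exact: poles_finite.
  by move=> /set_mem[].
exists l; split.
- move=> j a /lP[fa Xa _]; split=> //; apply: le_trans Xa.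
  by rewrite /X ler_peMl ?(ltW r0)// exprn_ege1//; lra.
- move=> a fa ra.
  have ex : exists n, cabs a < X n.
    exists (Num.Def.truncn (cabs a)).+1; apply: (lt_le_trans (truncnS_gt _)).
    apply: (@le_trans _ _ (lam ^+ (Num.Def.truncn (cabs a)).+1)); last first.
      by rewrite /X ler_peMr// exprn_ge0// ltW.
    apply: (@le_trans _ _ (2 ^+ (Num.Def.truncn (cabs a)).+1)).
      by rewrite -natrX ler_nat ltnW// ltn_expl.
    by rewrite lerXn2r ?nnegrE// ltW.
  have [n hn mn] := ex_minnP ex; case: n hn mn => [|j] hn mn.
    by move: hn; rewrite /X expr0 mul1r ltNge ra.
  exists j; rewrite mem_filter in_fset_set; last exact: poles_finite.
  apply/andP; split; last by apply/mem_set; split=> //; exact: ltW.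
  by rewrite leNgt; apply/negP => /mn; rewrite ltnn.
move=> j.
have size_l : (size (l j))%:R <= Kc * X j.+1 `^ sigma.
  apply: HK => //; first by apply: filter_uniq; exact: fset_uniq.
  by move=> a /lP[].
have tau0 : 0 < tau by lra.
apply: (@le_trans _ _ (\sum_(a <- l j) X j `^ (- tau))).
  rewrite big_seq [leRHS]big_seq; apply: ler_sum => a /lP[_ Xa _].
  rewrite !powRN lef_pV2 ?posrE ?powR_gt0//; last exact: lt_le_trans Xa.
  by apply: ge0_ler_powR; rewrite ?nnegrE ?(ltW tau0) ?cabs_ge0 ?(ltW (X0 j)).
rewrite big_const_seq count_predT iter_addr_0 -[leLHS]mulr_natl.
apply: (@le_trans _ _ (Kc * X j.+1 `^ sigma * X j `^ (- tau))).
  by rewrite ler_wpM2r ?powR_ge0.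
rewrite XS powRM ?(ltW lam0) ?(ltW (X0 j))// -!mulrA -powRD; last first.
  by apply/implyP => _; rewrite gt_eqF.
have -> : sigma + - tau = - u by rewrite /u; ring.
rewrite /X powRM ?exprn_ge0 ?(ltW lam0) ?(ltW r0)// powRXn ?(ltW lam0)//.
have -> : Kc * (lam `^ sigma * ((lam `^ (- u)) ^+ j * r `^ (- u))) =
  (lam `^ (- u)) ^+ j * (Kc * lam `^ sigma * r `^ (- u)) by ring.
have -> : e / (2 ^ j.+1)%:R = (2^-1) ^+ j * (e / 2).
  by rewrite natrX exprS exprVn; field; rewrite expf_neq0.
apply: ler_pM => //; first by rewrite exprn_ge0// powR_ge0.
  by rewrite !mulr_ge0 ?powR_ge0// ltW.
by rewrite lerXn2r ?nnegrE ?powR_ge0// invr_ge0.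
Qed.

End PoleTail.

(** * Covers of escaping orbits *)

Section UpperBound.
Variable R : realType.
Local Notation C := (R[i]).
Variables (f : C -> option C) (Pstar : set C) (Rdag : R) (M : nat) (beta K : R).
Hypothesis merf : meromorphic f.
Hypothesis Pp : Pstar `<=` poles f.
Hypothesis finP : finite_set (poles f `\` Pstar).
Hypothesis Rdag0 : 0 < Rdag.
Hypothesis sep : forall a1 a2, poles f a1 -> poles f a2 -> a1 <> a2 ->
  cball a1 Rdag `&` cball a2 Rdag = set0.
Hypothesis beta0 : 0 <= beta.
Hypothesis mM : forall a, Pstar a -> (1 <= mult f a <= M)%N.
Hypothesis K1 : 1 <= K.
Hypothesis est : forall a z, Pstar a -> cball a Rdag z -> z != a ->
  [/\ K^-1 * (cabs a `^ (- beta) / cabs (z - a) ^+ mult f a) <= cabs (fv f z),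
      cabs (fv f z) <= K * (cabs a `^ (- beta) / cabs (z - a) ^+ mult f a),
      K^-1 * ((mult f a)%:R * cabs a `^ (- beta) / cabs (z - a) ^+ (mult f a).+1)
        <= cabs (cderiv (fv f) z) &
      cabs (cderiv (fv f) z)
        <= K * ((mult f a)%:R * cabs a `^ (- beta) / cabs (z - a) ^+ (mult f a).+1)].
Hypothesis tranf : transcendental f.
Hypothesis noinf : ~ inf_asymptotic_value f.
Variable rho : R.
Hypothesis ho : has_order f rho.
Hypothesis rho0 : 0 < rho.

Local Notation bb := (- (beta / M%:R)).
Local Notation gg := (- (1 + M%:R^-1)).

(** The worst multiplicity enters here: x^(-beta) / y <= 1, so its root of order m is at most its
    root of order M. *)
Lemma expand_const (m : nat) (x y : R) : (0 < m)%N -> (m <= M)%N -> 1 <= x -> 1 <= y ->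
  2 * K ^+ 2 / (y / 2) * (K * x `^ (- beta) / (y / 2)) `^ m%:R^-1 <=
  8 * K ^+ 3 * (x `^ bb * y `^ gg).
Proof.
move: (K1) => k1 m0 mM' x1 y1.
have k0 : 0 < K by lra.
have M0 : (0 < M)%N by exact: leq_trans mM'.
pose z := x `^ (- beta) / y.
have xb0 : 0 < x `^ (- beta) by rewrite powR_gt0//; lra.
have xb1 : x `^ (- beta) <= 1 by rewrite -(powRr0 x) ler_powR// oppr_le0.
have y0 : 0 < y by lra.
have z0 : 0 < z by rewrite divr_gt0.
have z1 : z <= 1 by rewrite ler_pdivrMr// mul1r; lra.
have -> : K * x `^ (- beta) / (y / 2) = (2 * K) * z by rewrite /z; field; rewrite gt_eqF.
rewrite powRM; [|lra|lra].
have h1 : (2 * K) `^ m%:R^-1 <= 2 * K.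
  rewrite -[leRHS]powRr1; last by lra.
  by rewrite ler_powR//; [lra|rewrite invf_le1 ?ltr0n// ler1n].
have h2 : z `^ m%:R^-1 <= z `^ M%:R^-1.
  apply: ger_powR; first by rewrite z0.
  by rewrite lef_pV2 ?posrE ?ltr0n// ler_nat.
have h3 : z `^ M%:R^-1 = x `^ bb * y `^ (- M%:R^-1).
  by rewrite /z powRM ?invr_ge0 ?powR_ge0 ?(ltW y0)// -powRrM mulNr
    -(@powR_inv1 _ y) ?(ltW y0)// -powRrM mulN1r.
have h4 : y `^ gg = y^-1 * y `^ (- M%:R^-1).
  by rewrite opprD powRD ?powR_inv1 ?(ltW y0)//; apply/implyP => _; rewrite gt_eqF.
have -> : 8 * K ^+ 3 * (x `^ bb * y `^ gg) = 2 * K ^+ 2 / (y / 2) * ((2 * K) * z `^ M%:R^-1).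
  by rewrite h3 h4; field; rewrite gt_eqF.
rewrite ler_wpM2l ?divr_ge0 ?mulr_ge0 ?exprn_ge0 ?(ltW k0) ?(ltW y0)//.
by apply: ler_pM; rewrite ?powR_ge0.
Qed.

(** An escaping orbit that starts at time [k]. The system is nonautonomous, so one step of the
    covering induction moves [k] to [k.+1]. *)
Definition orb (c : nat -> C) (k : nat) (r : R) (w : nat -> C) :=
  forall j, f (w j) = Some (w j.+1 - c (k + j).+1) /\ r < cabs (w j).

Definition Eset c k r a : set C :=
  [set y | cabs (y - a) < Rdag / 2 /\ exists w, w 0%N = y /\ orb c k r w].

Definition cbound (c : nat -> C) := forall n, (0 < n)%N -> cabs (c n) < 1.

(** The numerical conditions make |a'| dominate the unit shifts and the disc radii, and make each
    pullback contract by at least 1/2. The clause on [z'] is used at [z' = z], where it gives f' z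
    != 0. *)
Definition large_radius (r : R) :=
  [/\ 1 + K <= r, 1 + Rdag / 2 <= r - Rdag / 2,
      2 + Rdag <= r - Rdag / 2, 16 * K ^+ 3 <= r - Rdag / 2 &
      forall a, f a = None -> r - Rdag / 2 <= cabs a -> Pstar a] /\
  forall z, r - 1 < cabs (fv f z) -> f z <> None ->
    exists a, f a = None /\ cabs (z - a) < Rdag / 2 /\
      (forall z', cabs (z' - a) = cabs (z - a) -> z' != a -> cderiv (fv f) z' != 0).

Lemma large_radius_near : exists r0, forall r, r0 <= r -> large_radius r.
Proof.
move: (Rdag0) (K1) => Rd0 k1.
have [rad [K0 [K01 H]]] := pole_radii merf Pp finP Rdag0 sep beta0 mM K1 est.
pose S := \sum_(a <- fset_set (poles f `\` Pstar)) cabs a.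
have HS a : f a = None -> ~ Pstar a -> cabs a <= S.
  move=> fa nP; have aF : a \in fset_set (poles f `\` Pstar).
    by rewrite in_fset_set//; apply: mem_set.
  by rewrite /S (big_rem a)//= lerDl sumr_ge0// => b _; exact: cabs_ge0.
exists (1 + K + (2 + Rdag + Rdag) + 16 * K ^+ 3 + (K0 + 1) + (S + 1)) => r hr.
have k3 : 0 <= K ^+ 3 by rewrite exprn_ge0//; lra.
have S0 : 0 <= S by rewrite sumr_ge0// => b _; exact: cabs_ge0.
split.
  split; try lra.
  move=> a fa ra; apply: contrapT => /(HS a fa); lra.
move=> z fz fzN.
have K00 : 0 < K0 by lra.
have Hrad a : f a = None -> 0 < rad a /\
    forall z, cabs (z - a) = rad a -> f z <> None /\ cabs (fv f z) <= K0.
  by move=> fa; have [/andP[h _] h2 _] := H a fa.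
have Oz : Om f K0 z by right; lra.
have [a [fa za]] := near_pole merf tranf noinf K00 Hrad Oz.
have [/andP[h1 h2] _ h3] := H a fa.
exists a; split=> //; split; first by lra.
by move=> z' zz' z'a; apply: h3 => //; rewrite zz'.
Qed.

Section FixedRadius.
Variables (r : R) (c : nat -> C).
Hypothesis hr : large_radius r.
Hypothesis hc : cbound c.

Lemma Eset_next k a y : Pstar a -> Eset c k r a y -> exists a', [/\ Pstar a',
  r - Rdag / 2 <= cabs a', Eset c k.+1 r a' (fv f y + c k.+1) & f y <> None].
Proof.
move=> Pa [_ [w [w0 wo]]].
have [fy ry] := wo 0%N; rewrite w0 addn0 in fy ry.
have [fy1 ry1] := wo 1%N; have [fy2 ry2] := wo 2%N.
rewrite addn1 in fy1.
have c2 := @hc k.+2 isT.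
have [[h1 h2 h3 h4 h5] hn] := hr.
have [||a' [fa' [a'1 _]]] := hn (w 1%N).
- by rewrite (fv_some fy1); have := cabsB_ge (w 2%N) (c k.+2); lra.
- by rewrite fy1.
have a'r : r - Rdag / 2 <= cabs a' by have := cabsB_ge (w 1%N) a'; lra.
exists a'; split=> //; first exact: h5.
  rewrite (fv_some fy) subrK; split=> //; exists (fun j => w j.+1); split=> // j.
  by have := wo j.+1; rewrite addnS addSn.
by rewrite fy.
Qed.

Lemma Eset_value k a a' y : Pstar a -> Eset c k r a y -> r - Rdag / 2 <= cabs a' ->
  Eset c k.+1 r a' (fv f y + c k.+1) ->
  [/\ y != a, cabs (y - a) < Rdag, cabs a' / 2 <= cabs (fv f y) &
      cabs (fv f y) <= 4 * (cabs a' / 2)].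
Proof.
move: (Rdag0) => Rd0 Pa [ya [w [w0 wo]]] ra' [y'a _].
have [fy _] := wo 0%N; rewrite w0 in fy.
have [[h1 h2 h3 h4 h5] _] := hr; have c1 := @hc k.+1 isT.
have yna : y != a by apply/eqP => E; move: fy; rewrite E (Pp Pa).
have A := cabs_tri (fv f y) (fv f y + c k.+1) a'.
have B : cabs (fv f y - (fv f y + c k.+1)) < 1.
  by rewrite opprD addrA subrr add0r cabsN.
have D := cabsB_ge (fv f y) a'; have E := cabsB_ge a' (fv f y).
rewrite cabsBC in E.
by split=> //; lra.
Qed.

Variable t : R.
Hypothesis t0 : 0 < t.
Variable l : nat -> seq C.
Variable e : R.
Local Notation tau := (t * (beta + M%:R + 1) / M%:R).
Local Notation N := (ncell M K * ncell M K)%N.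
Hypothesis l1 : forall j a, a \in l j -> f a = None /\ r - Rdag / 2 <= cabs a.
Hypothesis l2 : forall a, f a = None -> r - Rdag / 2 <= cabs a -> exists j, a \in l j.
Hypothesis l3 : forall j, \sum_(a <- l j) cabs a `^ (- tau) <= e / (2 ^ j.+1)%:R.
Hypothesis e0 : 0 < e.
Hypothesis eN : N%:R * (8 * K ^+ 3) `^ t * e <= 2^-1.

(** A cover for the next pole a' is pulled back with factor (8 K^3 |a|^(-beta/M) |a'|^(-1-1/M))^t.
    The weight |a|^(-t beta/M) is reproduced by this: the powers of |a'| combine to |a'|^(-tau),
    whose sum over poles is so small that the total halves at each step. *)
Lemma Eset_cov n k a : Pstar a -> r - Rdag / 2 <= cabs a ->
  hcov t (2 * 2^-1 ^+ n) (Eset c k r a) ((2^-1 ^+ n * (2 `^ t * cabs a `^ (t * bb)))%:E).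
Proof.
move: (Rdag0) (K1) (t0) hr => Rd0 k1 tp [[h1 h2 h3 h4 h5] _].
have k0 : 0 < K by lra.
elim: n k a => [|n IH] k a Pa ra; have a1 : 1 <= cabs a by lra.
  have /andP[m0 mM'] := mM Pa.
  have M0 : (0 < M)%N by exact: leq_trans mM'.
  have [ne|/set0P/negP/negPn/eqP ->] := pselect (Eset c k r a !=set0); last first.
    apply: hcov_sub (hcov_set0 t _) => //.
    by rewrite lee_fin !mulr_ge0 ?exprn_ge0 ?powR_ge0.
  have ab1 : cabs a `^ bb <= 1.
    by rewrite -[leRHS](powRr0 (cabs a)) ler_powR// oppr_le0 divr_ge0.
  (* [pole_radius_le] with [V = K], so that the constant cancels. *)
  have small y : Eset c k r a y -> cabs (y - a) <= cabs a `^ bb.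
    move=> Ey; have [ya [w [w0 wo]]] := Ey.
    have [fy _] := wo 0%N; have [_ ry] := wo 1%N; rewrite w0 addn0 in fy.
    have yna : y != a by apply/eqP => E; move: fy; rewrite E (Pp Pa).
    have yR : cabs (y - a) < Rdag by lra.
    have fK : K <= cabs (fv f y).
      rewrite (fv_some fy); have := @hc k.+1 isT.
      by have := cabsB_ge (w 1%N) (c k.+1); lra.
    have [_ h] := @pole_radius_le _ f a (mult f a) (cabs a `^ (- beta)) K Rdag m0
      (fun z zR zna => est Pa zR zna) y K yna yR k0 fK.
    apply: (le_trans h); rewrite mulrAC divff ?gt_eqF// mul1r -powRrM.
    rewrite ler_powR// mulNr lerN2 ler_wpM2l//.
    by rewrite lef_pV2 ?posrE ?ltr0n// ler_nat.
  have := @hcov_single _ t (2 * cabs a `^ bb) (Eset c k r a) ne (ltW tp).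
  rewrite expr0 mulr1 mul1r => H.
  apply: hcov_sub (H _ _) => //.
  - by lra.
  - by rewrite lee_fin powRM ?powR_ge0// -powRrM [_ * t]mulrC.
  - by rewrite mulr_ge0 ?powR_ge0.
  - move=> x y /small hx /small hy; have := cabs_tri x a y.
    by rewrite (cabsBC a y); lra.
have /andP[m0 mM'] := mM Pa.
have M0 : (0 < M)%N by exact: leq_trans mM'.
have MR : (M%:R : R) != 0 by rewrite pnatr_eq0 -lt0n.
pose L a' := 8 * K ^+ 3 * (cabs a `^ bb * cabs a' `^ gg).
pose D : R := 2^-1 ^+ n * 2 `^ t * (8 * K ^+ 3) `^ t * cabs a `^ (t * bb).
have D0 : 0 <= D by rewrite !mulr_ge0 ?exprn_ge0 ?powR_ge0.
pose V a' := D * cabs a' `^ (- tau).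
have a'1 a' : r - Rdag / 2 <= cabs a' -> 1 <= cabs a' by lra.
have L0 a' : 0 <= L a' by rewrite !mulr_ge0 ?exprn_ge0 ?powR_ge0 ?(ltW k0).
have k30 : 0 <= 8 * K ^+ 3 by rewrite mulr_ge0// exprn_ge0// ltW.
have L2 a' : r - Rdag / 2 <= cabs a' -> L a' <= 2^-1.
  move=> ra'; have a1' := a'1 a' ra'; have a0' : 0 < cabs a' by lra.
  apply: (@le_trans _ _ (8 * K ^+ 3 * (cabs a')^-1)).
    rewrite /L ler_wpM2l// -[leRHS]mul1r; apply: ler_pM; rewrite ?powR_ge0//.
      by rewrite -[leRHS](powRr0 (cabs a)) ler_powR// oppr_le0 divr_ge0.
    by rewrite -[leRHS](@powR_inv1 _ (cabs a')) ?cabs_ge0// ler_powR// lerN2 lerDl invr_ge0.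
  by rewrite ler_pdivrMr//; lra.
have LV a' : r - Rdag / 2 <= cabs a' ->
    L a' `^ t * (2^-1 ^+ n * (2 `^ t * cabs a' `^ (t * bb))) = V a'.
  move=> ra'; have a1' := a'1 a' ra'; have a0' : 0 < cabs a' by lra.
  have -> : L a' `^ t = (8 * K ^+ 3) `^ t * (cabs a `^ (t * bb) * cabs a' `^ (gg * t)).
    rewrite /L (powRM t k30 (mulr_ge0 (powR_ge0 _ _) (powR_ge0 _ _))).
    by rewrite (powRM t (powR_ge0 _ _) (powR_ge0 _ _)) -!powRrM [bb * t]mulrC.
  rewrite /V /D.
  have -> : cabs a' `^ (- tau) = cabs a' `^ (gg * t) * cabs a' `^ (t * bb).
    rewrite -powRD; last by apply/implyP => _; rewrite gt_eqF.
    by congr (_ `^ _); field.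
  by ring.
have piece a' : Pstar a' -> r - Rdag / 2 <= cabs a' ->
    hcov t (2 * 2^-1 ^+ n.+1) [set y | Eset c k r a y /\ Eset c k.+1 r a' (fv f y + c k.+1)]
      (N%:R * V a')%:E.
  (* The image lies near a', so |f| is between |a'| / 2 and 2 |a'|: this is the ring of [pole_cells]
     with V = |a'| / 2. On each of its [N] cells the map is injective with Lipschitz inverse. *)
  move=> Pa' ra'; have a1' := a'1 a' ra'.
  have V20 : 0 < cabs a' / 2 by lra.
  have [cell [cell1 cell2]] := @pole_cells _ f a (mult f a) M (cabs a `^ (- beta)) K Rdag m0
    (ba_gt0 merf Pp Rdag0 est Pa) K1 (fun z zR zna => est Pa zR zna) (cabs a' / 2) V20.
  have := @hcov_big _ _ t (2 * 2^-1 ^+ n.+1) (iota 0 N) (fun i => [set y | Eset c k r a y /\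
    Eset c k.+1 r a' (fv f y + c k.+1) /\ cell y = i]) (fun _ => V a').
  rewrite big_const_seq count_predT size_iota iter_addr_0 -[V a' *+ _]mulr_natl => H.
  apply: hcov_sub (H _) => //.
    move=> y [Ey Ey']; have [y1 y2 y3 y4] := Eset_value Pa Ey ra' Ey'.
    exists (cell y) => //; rewrite mem_iota add0n /=; exact: cell1.
  move=> i _; split; first by rewrite mulr_ge0 ?powR_ge0.
  have := @hcov_lipschitz _ t (2 * 2^-1 ^+ n) (L a') [set y | Eset c k r a y /\
    Eset c k.+1 r a' (fv f y + c k.+1) /\ cell y = i] (Eset c k.+1 r a')
    (fun y => fv f y + c k.+1) _ (ltW tp) (L0 a') _ _ _ (IH k.+1 a' Pa' ra').
  rewrite -EFinM (LV a' ra') => H2.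
  apply: hcov_sub (H2 _ _ _) => //.
  - have -> : 2 * 2^-1 ^+ n.+1 = 2^-1 * (2 * 2^-1 ^+ n) :> R by rewrite exprS; ring.
    apply: ler_wpM2r; last exact: L2.
    by rewrite mulr_ge0 ?exprn_ge0.
  - by move=> y [_ []].
  - move=> x y [Ex [Ex' cx]] [Ey [Ey' cy]].
    have [x1 x2 x3 x4] := Eset_value Pa Ex ra' Ex'.
    have [y1 y2 y3 y4] := Eset_value Pa Ey ra' Ey'.
    have xy := cell2 x y x1 x2 x3 x4 y1 y2 y3 y4 (etrans cx (esym cy)).
    have -> : fv f x + c k.+1 - (fv f y + c k.+1) = fv f x - fv f y by ring.
    have xR2 : cabs (x - a) <= Rdag / 2 by case: Ex => /ltW.
    have := @pole_expand_far _ f a (mult f a) M (cabs a `^ (- beta)) K Rdag merf Rdag0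
      (fun z zR zna => pole_isolated Rdag0 sep (Pp Pa) zR zna) m0 mM'
      (ba_gt0 merf Pp Rdag0 est Pa) K1 (fun z zR zna => est Pa zR zna)
      x y (cabs a' / 2) x1 xR2 V20 x3 xy.
    move=> /le_trans; apply; rewrite ler_wpM2r ?cabs_ge0//.
    exact: expand_const.
have layer j : hcov t (2 * 2^-1 ^+ n.+1) [set y | exists2 a', a' \in l j &
    Eset c k r a y /\ Eset c k.+1 r a' (fv f y + c k.+1)] ((N%:R * D * e) / (2 ^ j.+1)%:R)%:E.
  have := @hcov_big _ _ t (2 * 2^-1 ^+ n.+1) (l j) (fun a' => [set y | Eset c k r a y /\
    Eset c k.+1 r a' (fv f y + c k.+1)]) (fun a' => N%:R * V a') => H.
  apply: hcov_sub (H _) => //.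
    rewrite lee_fin -mulr_sumr -mulr_sumr mulrA -[_ * e / _]mulrA.
    by apply: ler_wpM2l; [exact: mulr_ge0|exact: l3].
  move=> a' /l1[fa' ra']; split.
    by apply: mulr_ge0 => //; exact: mulr_ge0 (powR_ge0 _ _).
  by apply: piece => //; exact: h5.
apply: hcov_sub (hcov_bigcup layer) => //.
  move=> y Ey; have [a' [Pa' ra' Ey' _]] := Eset_next Pa Ey.
  have [j aj] := l2 (Pp Pa') ra'.
  by exists j => //; exists a'.
have E0 : 0 <= N%:R * D * e by apply: mulr_ge0 (ltW e0); exact: mulr_ge0.
(* The layers sum to at most [N * D * e], and [eN] supplies the factor 1/2 that leads from [n] to
   [n.+1]. *)
apply: (le_trans (epsilon_trick0 xpredT E0)).
have -> : N%:R * D * e = (N%:R * (8 * K ^+ 3) `^ t * e) * (2^-1 ^+ n * (2 `^ t * cabs a `^ (t * bb))).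
  by rewrite /D; ring.
rewrite lee_fin [2^-1 ^+ n.+1]exprS -[leRHS]mulrA ler_wpM2r//.
by rewrite !mulr_ge0 ?exprn_ge0 ?powR_ge0.
Qed.

Lemma Eset_null k a : Pstar a -> r - Rdag / 2 <= cabs a -> hausdorff t (Eset c k r a) = 0%E.
Proof.
move=> Pa ra; apply/hausdorff0P => d v d0 v0.
have half0 : 0 <= 2^-1 :> R by rewrite invr_ge0.
have half1 : 2^-1 <= 1 :> R by rewrite invf_le1// ler1n.
have [n1 hn1] := halves_small 2 d0.
have [n2 hn2] := halves_small (2 `^ t * cabs a `^ (t * bb)) v0.
apply: hcov_sub (Eset_cov (maxn n1 n2) k Pa ra) => //.
  apply: (le_trans _ (ltW hn1)); rewrite -exprVn ler_pM2l//.
  by rewrite ler_wiXn2l ?leq_maxl.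
rewrite lee_fin; apply: (le_trans _ (ltW hn2)); rewrite mulrC -exprVn ler_wpM2l//.
  by rewrite mulr_ge0 ?powR_ge0.
by rewrite ler_wiXn2l ?leq_maxr.
Qed.

End FixedRadius.
End UpperBound.

(** * Preimages of null sets *)

Section LocalInverse.
Variable R : realType.
Local Notation C := (R[i]).
Variable f : C -> option C.
Hypothesis merf : meromorphic f.

Lemma local_bilipschitz z : f z <> None -> cderiv (fv f) z != 0 ->
  exists d L, [/\ 0 < d, 0 < L & forall x y, cabs (x - z) < d -> cabs (y - z) < d ->
    cabs (x - y) <= L * cabs (fv f x - fv f y)].
Proof.
move=> fz dz; have [r [r0 Hr]] := mero_regular merf fz.
have [d [d0 Hd]] := ccont_cabs_usc (mero_ccont merf fz) (@ltr01 R).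
have [s' [s'0 s'r s'd]] := pos_min2 r0 d0.
pose s := s' / 2; have s0 : 0 < s by rewrite /s; lra.
have sr : s < r by rewrite /s; lra.
have sd : s < d by rewrite /s; lra.
clearbody s.
pose B := cabs (fv f z) + 1; have B0 : 0 < B by rewrite ltr_wpDl ?cabs_ge0.
have D0 : 0 < cabs (cderiv (fv f) z) by rewrite cabs_gt0.
set D := cabs (cderiv (fv f) z) in D0.
have [||e [e0 es eD]] := @pos_min2 R (s / 2) (D * s ^+ 2 / (64 * B)).
- by lra.
- by rewrite divr_gt0 ?mulr_gt0 ?exprn_gt0.
exists e, (2 / D); split=> //; first by rewrite divr_gt0.
move=> x y xe ye.
have H := @disc_second_order _ (fv f) (cderiv (fv f)) z s B s0 (ltW B0) _ _ x y.
have {}H : cabs (fv f x - fv f y - cderiv (fv f) z * (x - y)) <=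
    16 * B / s ^+ 2 * (cabs (x - z) + cabs (y - z)) * cabs (x - y).
  apply: H; [| |lra|lra] => w ws.
    have wr : cabs (w - z) < r by lra.
    by have [fw _] := Hr w wr; exact: mero_cderiv.
  by apply/ltW/Hd; lra.
have xy0 := cabs_ge0 (x - y).
have : 16 * B / s ^+ 2 * (cabs (x - z) + cabs (y - z)) <= D / 2.
  apply: (@le_trans _ _ (16 * B / s ^+ 2 * (2 * (D * s ^+ 2 / (64 * B))))); last first.
    by rewrite le_eqVlt; apply/orP; left; apply/eqP; field; rewrite !gt_eqF.
  by rewrite ler_wpM2l ?divr_ge0 ?mulr_ge0 ?exprn_ge0 ?(ltW B0) ?(ltW s0)//; lra.
move=> h; have h2 := ler_wpM2r xy0 h.
have h3 := cabsB_ge (cderiv (fv f) z * (x - y)) (fv f x - fv f y).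
rewrite cabsM -/D (cabsBC (cderiv (fv f) z * (x - y))) in h3.
rewrite mulrAC ler_pdivlMr// [leLHS]mulrC; lra.
Qed.

(** Away from critical points the map has a locally Lipschitz inverse, but without uniform
    constants. So [X] is split into countably many pieces: first by the constant n + 1, then by the
    cells of a grid of mesh 1 / (4 (n + 1)). *)
Lemma hausdorff0_preimage (t : R) (X Y : set C) (v : C) : 0 <= t ->
  (forall z, X z -> [/\ f z <> None, cderiv (fv f) z != 0 & Y (fv f z + v)]) ->
  hausdorff t Y = 0%E -> hausdorff t X = 0%E.
Proof.
move=> t0 HX HY.
pose Xn (n : nat) := [set z | X z /\ forall x y, cabs (x - z) < n.+1%:R^-1 ->
  cabs (y - z) < n.+1%:R^-1 -> cabs (x - y) <= n.+1%:R * cabs (fv f x - fv f y)].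
pose idx n (z : C) := choice.pickle (Num.floor (complex.Re z * (4 * n.+1%:R)),
  Num.floor (complex.Im z * (4 * n.+1%:R))).
have fl (x y q : R) : 0 < q -> Num.floor (x * q) = Num.floor (y * q) -> `|x - y| < q^-1.
  move=> q0 E; have /andP[a1 a2] := floor_itv (x * q); have /andP[b1 b2] := floor_itv (y * q).
  rewrite E in a1 a2.
  rewrite -[ltRHS]mul1r ltr_pdivlMr// -[X in _ * X](gtr0_norm q0) -normrM mulrBl ltr_norml.
  by move: a1 a2 b1 b2; rewrite !intrD; lra.
apply: (@hausdorff0_sub _ _ _ (\bigcup_n \bigcup_i [set z | Xn n z /\ idx n z = i])).
  move=> z Xz; have [fz dz _] := HX z Xz.
  have [d [L [d0 L0 H]]] := local_bilipschitz fz dz.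
  pose n := (Num.Def.truncn (d^-1 + L)).+1.
  have hn : d^-1 + L < n%:R by exact: truncnS_gt.
  have di : 0 < d^-1 by rewrite invr_gt0.
  have n1 : n.+1%:R^-1 <= d.
    by rewrite invf_ple ?posrE ?ltr0n// -natr1; lra.
  have n2 : L <= n.+1%:R by rewrite -natr1; lra.
  exists n => //; exists (idx n z) => //; split=> //; split=> // x y xz yz.
  apply: (le_trans (H x y (lt_le_trans xz n1) (lt_le_trans yz n1))).
  by rewrite ler_wpM2r ?cabs_ge0.
apply: hausdorff0_bigcup => n; apply: hausdorff0_bigcup => i.
have n0 : 0 < n.+1%:R :> R by rewrite ltr0n.
apply: (@hausdorff0_lipschitz _ t n.+1%:R _ Y (fun z => fv f z + v) t0 n0) => //.
  by move=> x [[Xx _] _]; have [] := HX x Xx.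
move=> x y [[Xx Hx] ix] [[Xy _] iy].
have -> : fv f x + v - (fv f y + v) = fv f x - fv f y by ring.
apply: Hx; first by rewrite subrr cabs0 invr_gt0.
have := etrans ix (esym iy); move=> /(pcan_inj choice.pickleK)[E1 E2].
have q0 : 0 < 4 * n.+1%:R :> R by rewrite mulr_gt0.
have d1 := fl _ _ _ q0 E1; have d2 := fl _ _ _ q0 E2.
apply: (le_lt_trans (cabs_le_ReIm _)); rewrite creB cimB (distrC (complex.Re y)) (distrC (complex.Im y)).
have E : (4 * n.+1%:R)^-1 = n.+1%:R^-1 / 4 :> R by rewrite invfM mulrC.
have : 0 < n.+1%:R^-1 :> R by rewrite invr_gt0.
by move: d1 d2; rewrite E; move: (n.+1%:R^-1) => u; lra.
Qed.

End LocalInverse.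

Section EscapingNull.
Variable R : realType.
Local Notation C := (R[i]).
Variables (f : C -> option C) (Pstar : set C) (Rdag : R) (M : nat) (beta K : R).
Hypothesis merf : meromorphic f.
Hypothesis Pp : Pstar `<=` poles f.
Hypothesis finP : finite_set (poles f `\` Pstar).
Hypothesis Rdag0 : 0 < Rdag.
Hypothesis sep : forall a1 a2, poles f a1 -> poles f a2 -> a1 <> a2 ->
  cball a1 Rdag `&` cball a2 Rdag = set0.
Hypothesis beta0 : 0 <= beta.
Hypothesis mM : forall a, Pstar a -> (1 <= mult f a <= M)%N.
Hypothesis K1 : 1 <= K.
Hypothesis est : forall a z, Pstar a -> cball a Rdag z -> z != a ->
  [/\ K^-1 * (cabs a `^ (- beta) / cabs (z - a) ^+ mult f a) <= cabs (fv f z),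
      cabs (fv f z) <= K * (cabs a `^ (- beta) / cabs (z - a) ^+ mult f a),
      K^-1 * ((mult f a)%:R * cabs a `^ (- beta) / cabs (z - a) ^+ (mult f a).+1)
        <= cabs (cderiv (fv f) z) &
      cabs (cderiv (fv f) z)
        <= K * ((mult f a)%:R * cabs a `^ (- beta) / cabs (z - a) ^+ (mult f a).+1)].
Hypothesis tranf : transcendental f.
Hypothesis noinf : ~ inf_asymptotic_value f.
Variable rho : R.
Hypothesis ho : has_order f rho.
Hypothesis rho0 : 0 < rho.

(** The starting point itself need not be large, so the covers apply only from time 1 on. The set is
    therefore treated as a preimage under the first map of countably many sets [Eset]. *)
Lemma escaping_null t : rho * M%:R / (beta + M%:R + 1) < t ->
  exists r1, forall r, r1 <= r -> forall c, cbound c -> forall S,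
    hausdorff t (escaping_part S f c r) = 0%E.
Proof.
move: (Rdag0) (beta0) (K1) (rho0) => Rd0 be0 k1 rh0 tT.
have Mge0 : 0 <= M%:R :> R by exact: ler0n.
have den0 : 0 < beta + M%:R + 1 by lra.
have T0 : 0 <= rho * M%:R / (beta + M%:R + 1) by rewrite divr_ge0 ?mulr_ge0// ltW.
have t0 : 0 < t by lra.
have [r0 Hr0] := large_radius_near merf Pp finP Rdag0 sep beta0 mM K1 est tranf noinf.
have [r1 Hr1] : exists r1, forall r, r1 <= r -> r0 <= r -> forall c, cbound c ->
    hausdorff t [set y | exists2 a, Pstar a /\ r - Rdag / 2 <= cabs a & Eset f Rdag c 1 r a y] = 0%E.
  (* For [M = 0] there are no poles in [Pstar], and [tau] below would divide by zero. *)
  have [M0|M0] := posnP M.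
    exists 0 => r _ _ c _; apply: (@hausdorff0_sub _ _ _ set0).
      by move=> y [a [/mM]]; rewrite M0 leqn0 => /andP[] /[swap] /eqP ->.
    by apply/hausdorff0P => d e d0 e0; apply: hcov_sub (hcov_set0 _ _) => //; rewrite lee_fin ltW.
  have M0R : 0 < M%:R :> R by rewrite ltr0n.
  pose tau := t * (beta + M%:R + 1) / M%:R.
  have taur : rho < tau by rewrite /tau ltr_pdivlMr// -ltr_pdivrMr.
  pose q : R := (ncell M K * ncell M K)%N%:R * (8 * K ^+ 3) `^ t.
  have q0 : 0 <= q by rewrite mulr_ge0 ?powR_ge0.
  pose e := (2 * (q + 1))^-1.
  have e0 : 0 < e by rewrite invr_gt0; lra.
  have eN : q * e <= 2^-1.
    rewrite /e ler_pdivrMr; last by lra.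
    by rewrite mulrA mulVf// mul1r; lra.
  have [r2 [r21 Hr2]] := pole_tail merf ho rho0 taur e0.
  exists (r2 + Rdag / 2) => r rr2 rr0 c hc.
  have [|l [l1 l2 l3]] := Hr2 (r - Rdag / 2); first by lra.
  have En := Eset_null merf Pp Rdag0 sep beta0 mM K1 est (Hr0 r rr0) hc t0 l1 l2 l3 e0 eN.
  apply: (@hausdorff0_sub _ _ _ (\bigcup_j \bigcup_i
     [set y | [/\ (i < size (l j))%N, Pstar (nth 0 (l j) i) & Eset f Rdag c 1 r (nth 0 (l j) i) y]])).
    move=> y [a [Pa ra] Ey]; have [j aj] := l2 a (Pp Pa) ra.
    exists j => //; exists (index a (l j)) => //=.
    by rewrite index_mem nth_index.
  apply: hausdorff0_bigcup => j; apply: hausdorff0_bigcup => i.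
  have [ij|ij] := ltnP i (size (l j)); last first.
    apply: (@hausdorff0_sub _ _ _ set0); first by move=> y [].
    by apply/hausdorff0P => d v d0 v0; apply: hcov_sub (hcov_set0 _ _) => //; rewrite lee_fin ltW.
  have [Pn|nP] := pselect (Pstar (nth 0 (l j) i)); last first.
    apply: (@hausdorff0_sub _ _ _ set0); first by move=> y [].
    by apply/hausdorff0P => d v d0 v0; apply: hcov_sub (hcov_set0 _ _) => //; rewrite lee_fin ltW.
  apply: hausdorff0_sub (En 1%N (nth 0 (l j) i) Pn _); first by move=> y [].
  by have [] := l1 j _ (mem_nth 0 ij).
exists (Num.max r0 r1) => r; rewrite ge_max => /andP[rr0 rr1] c hc S.
have [[h1 h2 h3 h4 h5] hn] := Hr0 r rr0.
apply: (hausdorff0_preimage merf (ltW t0) _ (Hr1 r rr1 rr0 c hc) (v := c 1%N)).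
move=> z [_ Hz].
have /choice[w Hw] : forall n, exists w, (0 < n)%N -> Fit f c n z = Some w /\ r < cabs w.
  by move=> [|n]; [exists 0|have [w h] := Hz n.+1 isT; exists w].
have fw n : f (w n.+1) = Some (w n.+2 - c n.+2).
  have [F1 _] := Hw n.+1 isT; have [F2 _] := Hw n.+2 isT.
  move: F2; rewrite [Fit _ _ _.+2 _]/= -/(Fit f c n.+1 z) F1 /fn.
  by case: (f (w n.+1)) => //= v [<-]; rewrite addrK.
have fz : f z = Some (w 1%N - c 1%N).
  have [F1 _] := Hw 1%N isT; move: F1; rewrite /= /fn.
  by case: (f z) => //= v [<-]; rewrite addrK.
have [||a0 [fa0 [_ da0]]] := hn z.
- rewrite (fv_some fz); have [_ rw] := Hw 1%N isT; have := hc 1%N isT.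
  by have := cabsB_ge (w 1%N) (c 1%N); lra.
- by rewrite fz.
split; first by rewrite fz.
  by apply: da0 => //; apply/eqP => E; move: fz; rewrite E fa0.
rewrite (fv_some fz) subrK.
have [||a [fa [za _]]] := hn (w 1%N).
- rewrite (fv_some (fw 0%N)); have [_ rw] := Hw 2%N isT; have := hc 2%N isT.
  by have := cabsB_ge (w 2%N) (c 2%N); lra.
- by rewrite fw.
have ra : r - Rdag / 2 <= cabs a.
  by have [_ rw] := Hw 1%N isT; have := cabsB_ge (w 1%N) a; lra.
exists a; first by split=> //; exact: h5.
split=> //; exists (fun j => w j.+1); split=> // j.
by have [_ rw] := Hw j.+1 isT; rewrite add1n; split.
Qed.

End EscapingNull.

(** * Product measures on words *)

Section TreeCover.
Variables (R : realType) (T : eqType).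

(* If the total weight of the words W i is less than 1, one can walk down the
   tree keeping the weight of the words below the current vertex smaller than
   the weight of that vertex. *)
Lemma tree_cover (A : seq T) (p : T -> R) (W : nat -> seq T) :
  uniq A -> (forall a, a \in A -> 0 <= p a) -> \sum_(a <- A) p a = 1 ->
  (forall i, {subset W i <= A}) ->
  (\sum_(0 <= i <oo) (\prod_(a <- W i) p a)%:E < 1)%E ->
  exists w : nat -> T, (forall n, w n \in A) /\ forall i, W i <> mkseq w (size (W i)).
Proof.
move=> uA p0 p1 WA lt1.
pose mu (s : seq T) := \prod_(a <- s) p a.
have mu0 s : {subset s <= A} -> 0 <= mu s.
  by move=> sA; rewrite /mu big_seq; apply: prodr_ge0 => a /sA; exact: p0.
pose F s i := (if prefix s (W i) then mu (W i) else 0)%:E.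
have F0 s i : (0 <= F s i)%E by rewrite /F lee_fin; case: ifP => // _; exact: mu0.
pose S s := (\sum_(0 <= i <oo) F s i)%E.
pose good s := {subset s <= A} /\ (S s < (mu s)%:E)%E.
have step s : good s -> exists a, a \in A /\ good (rcons s a).
  move=> [sA Ss]; apply: contrapT => /forallNP no.
  have rA a : a \in A -> {subset rcons s a <= A}.
    by move=> aA b; rewrite mem_rcons inE => /predU1P[->|/sA].
  have ge a : a \in A -> ((mu (rcons s a))%:E <= S (rcons s a))%E.
    move=> aA; rewrite leNgt; apply/negP => lt; apply: (no a); split=> //.
    by split=> //; exact: rA.
  have neq i : W i <> s.
    move=> E; move: Ss; apply/negP; rewrite -leNgt.
    have -> : (mu s)%:E = F s i by rewrite /F E prefix_refl.
    rewrite /S (@nneseriesD1 _ (F s) i xpredT)//.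
    by rewrite leeDl// nneseries_ge0.
  (* No [W i] equals [s], so each word below [s] passes through exactly one child. If every child
     were overweight, so would [s] be, as the [p a] sum to 1. *)
  have SE : S s = (\sum_(a <- A) S (rcons s a))%E.
    rewrite /S -nneseries_sum; last by move=> *; exact: F0.
    apply: eq_eseriesr => i _; rewrite /F.
    have [/prefixP[u E]|nps] := boolP (prefix s (W i)); last first.
      rewrite big1_seq// => a /andP[_ aA]; case: ifP => // /prefixP[u E].
      by move/negP: nps; case; apply/prefixP; exists (a :: u); rewrite E cat_rcons.
    case: u E => [|b u] E; first by exfalso; apply: (neq i); rewrite E cats0.
    have bA : b \in A by apply: (WA i); rewrite E mem_cat mem_head orbT.
    rewrite (bigD1_seq b)//= big1_seq ?adde0.
      by rewrite E -cat_rcons prefix_prefix.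
    move=> a /andP[ab aA]; case: ifP => // /prefixP[u' E'].
    move: E'; rewrite E cat_rcons => /eqP; rewrite eqseq_cat// eqxx /= eqseq_cons.
    by move=> /andP[/eqP ba _]; rewrite ba eqxx in ab.
  move: Ss; apply/negP; rewrite -leNgt SE.
  have -> : mu s = \sum_(a <- A) mu (rcons s a).
    under eq_bigr do rewrite /mu big_rcons /=.
    by rewrite -mulr_sumr p1 mulr1.
  rewrite -sumEFin big_seq [leRHS]big_seq; apply: lee_sum => a; exact: ge.
have good0 : good [::].
  split=> //; rewrite /S /mu big_nil; apply: le_lt_trans lt1.
  by apply: lee_nneseries => [i _ _|i _]; rewrite /F ?prefix0s// lee_fin mu0.
have [a0 _] := step _ good0.
have /choice[G HG] : forall s, exists a, good s -> a \in A /\ good (rcons s a).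
  by move=> s; have [/step[a h]|] := pselect (good s); [exists a|exists a0].
pose fix st n := if n is k.+1 then rcons (st k) (G (st k)) else [::].
have gst n : good (st n) by elim: n => // n IH; have [] := HG _ IH.
pose w n := G (st n).
have stE n : st n = mkseq w n.
  by elim: n => // n IH; rewrite /= {1}IH mkseqS.
exists w; split=> [n|i E]; first by have [] := HG _ (gst n).
have [_] := gst (size (W i)); apply/negP; rewrite -leNgt stE -E.
have -> : (mu (W i))%:E = F (W i) i by rewrite /F prefix_refl.
rewrite /S (@nneseriesD1 _ (F (W i)) i xpredT)//.
by rewrite leeDl// nneseries_ge0.
Qed.

End TreeCover.

(** * Coded orbits *)

(** The intervals about [v j] of radius [e j] are nested, because [e j = 2 * e j.+1] and the
    increment is at most [e j.+1]. *)
Lemma geom_cvg (R : realType) (v : nat -> R) (d : R) : 0 <= d ->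
  (forall j, `|v j.+1 - v j| <= d / 2 ^+ j) ->
  exists x, forall j, `|x - v j| <= 2 * d / 2 ^+ j.
Proof.
move=> d0 H.
have p2 j : 0 < 2 ^+ j :> R by rewrite exprn_gt0.
pose e j : R := 2 * d / 2 ^+ j.
have eS j : e j = 2 * e j.+1.
  by rewrite /e exprS; field; rewrite gt_eqF.
have e0 j : 0 <= e j by rewrite /e divr_ge0 ?mulr_ge0 ?(ltW (p2 j)).
have Hd j : d / 2 ^+ j = e j.+1.
  by rewrite /e exprS; field; rewrite gt_eqF.
have [||x hx] := @nested_point _ (fun j => v j - e j) (fun j => 2 * e j).
- by move=> j; have := e0 j; lra.
- by move=> j; have := H j; rewrite Hd ler_norml; have := eS j; lra.
by exists x => j; have := hx j; rewrite -/(e j) ler_norml; lra.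
Qed.

Lemma geom_cvgC (R : realType) (u : nat -> R[i]) (d : R) : 0 <= d ->
  (forall j, cabs (u j.+1 - u j) <= d / 2 ^+ j) ->
  exists x, forall j, cabs (x - u j) <= 4 * d / 2 ^+ j.
Proof.
move=> d0 H.
have [|p hp] := @geom_cvg _ (fun j => complex.Re (u j)) d d0.
  by move=> j; apply: le_trans (H j); rewrite -creB; exact: Re_le_cabs.
have [|q hq] := @geom_cvg _ (fun j => complex.Im (u j)) d d0.
  by move=> j; apply: le_trans (H j); rewrite -cimB; exact: Im_le_cabs.
exists (p +i* q)%C => j; apply: (le_trans (cabs_le_ReIm _)).
rewrite creB cimB /=; have := hp j; have := hq j.
have -> : 4 * d / 2 ^+ j = 2 * d / 2 ^+ j + 2 * d / 2 ^+ j by rewrite -!mulrDl; congr (_ * _ / _); ring.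
lra.
Qed.

Section CodedOrbit.
Variable R : realType.
Local Notation C := (R[i]).
Variables (f : C -> option C) (c om : nat -> C) (phi : nat -> C -> C) (dl : R).
Hypothesis dl0 : 0 < dl.
Hypothesis om_pole : forall k, f (om k) = None.
Hypothesis phiP : forall k y, cabs (y - om k.+1) < 2 * dl ->
  cabs (phi k y - om k) < dl /\ f (phi k y) = Some (y - c k.+1).
Hypothesis phi_contr : forall k y y', cabs (y - om k.+1) < 2 * dl ->
  cabs (y' - om k.+1) < 2 * dl -> cabs (phi k y - phi k y') <= cabs (y - y') / 2.
Hypothesis phi_open : forall k V, copen V -> V `<=` cball (om k.+1) (2 * dl) ->
  copen (phi k @` V).

(** The inverse branch of [j] steps that leads from near [om (j + k)] at time [j + k] back to near
    [om k] at time [k]. *)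
Fixpoint pullback j k y := if j is j'.+1 then phi k (pullback j' k.+1 y) else y.

Lemma pullback_in j k y : cabs (y - om (j + k)) < 2 * dl ->
  cabs (pullback j k y - om k) < 2 * dl.
Proof.
elim: j k => [|j IH] k //= h.
have [|h1 _] := @phiP k (pullback j k.+1 y); first by apply: IH; rewrite addnS.
by have := dl0; lra.
Qed.

Lemma pullback_contr j k y y' : cabs (y - om (j + k)) < 2 * dl ->
  cabs (y' - om (j + k)) < 2 * dl ->
  cabs (pullback j k y - pullback j k y') <= cabs (y - y') / 2 ^+ j.
Proof.
elim: j k => [|j IH] k /= h h'; first by rewrite expr0 divr1.
have h1 := @pullback_in j k.+1 y; have h2 := @pullback_in j k.+1 y'.
rewrite addnS in h1 h2; have := IH k.+1; rewrite addnS => /(_ h h') h3.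
have h4 := phi_contr (h1 h) (h2 h'); apply: (le_trans h4).
by rewrite exprSr invfM mulrA ler_pM2r// invr_gt0.
Qed.

Lemma pullback_open j k V : copen V -> V `<=` cball (om (j + k)) (2 * dl) ->
  copen (pullback j k @` V).
Proof.
elim: j k V => [|j IH] k V oV Vs; first by rewrite image_id.
have -> : pullback j.+1 k @` V = phi k @` (pullback j k.+1 @` V) by rewrite image_comp.
apply: phi_open; first by apply: IH => //; rewrite addnS.
by move=> _ [y Vy <-]; apply: pullback_in; rewrite addnS; exact: Vs.
Qed.

Lemma pullbackSr j k y : pullback j.+1 k y = pullback j k (phi (j + k) y).
Proof. by elim: j k => // j IH k; have := IH k.+1; rewrite addnS /= => ->. Qed.

Lemma pullback_Fit i j y : (i <= j)%N -> cabs (y - om j) < 2 * dl ->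
  Fit f c i (pullback j 0 y) = Some (pullback (j - i) i y).
Proof.
elim: i => [|i IH] ij h; first by rewrite subn0.
rewrite /= IH//; last exact: ltnW.
have -> : (j - i = (j - i.+1).+1)%N by rewrite subnSK.
rewrite /= /fn.
have [|_ ->] := @phiP i (pullback (j - i.+1) i.+1 y).
  by apply: pullback_in; rewrite subnK.
by rewrite /= subrK.
Qed.

(** [x k] is the limit of the pullbacks of [om (j + k)]. Discs of radius [dl] about [x n] lie in the
    domains of the branches, hence pull back univalently for every [n]. Pullbacks of the poles
    [om n] accumulate at [x 0], so the iterates are not all defined on any neighbourhood of it. *)
Lemma coded_orbit : exists x : nat -> C,
  (forall k, cabs (x k - om k) < dl /\ f (x k) = Some (x k.+1 - c k.+1)) /\
  (forall k, Fit f c k (x 0%N) = Some (x k)) /\ radial_julia f c (x 0%N).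
Proof.
move: (dl0) => d0.
have om_in k : cabs (om k - om k) < 2 * dl by rewrite subrr cabs0 mulr_gt0.
have p2 j : 0 < 2 ^+ j :> R by rewrite exprn_gt0.
have ex k : exists x, forall j, cabs (x - pullback j k (om (j + k))) <= 4 * dl / 2 ^+ j.
  apply: (geom_cvgC (ltW d0)) => j; rewrite pullbackSr.
  have [h1 _] := phiP (om_in (j + k).+1).
  apply: (le_trans (@pullback_contr j k _ _ _ (om_in _))); first by lra.
  by rewrite ler_pM2r ?invr_gt0// ltW.
have [x Hx] := choice ex.
have small (t : R) D : (forall j, t <= D / 2 ^+ j) -> t <= 0.
  move=> H; rewrite leNgt; apply/negP => t0; have [n hn] := halves_small D t0.
  by have := H n; lra.
(* The limit satisfies only the weak bound [dl]. This puts [x k.+1] in the domain of [phi k], after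
   which [xE] and [phiP] restore the strict bound. *)
have x2 k : cabs (x k - om k) < 2 * dl.
  suff : cabs (x k - om k) - dl <= 0 by lra.
  apply: (small _ (2 * dl)) => j.
  have [h1 _] := @phiP k _ (@pullback_in j k.+1 (om (j + k.+1)%N) (om_in _)).
  have := Hx k j.+1; rewrite addSnnS /= => h2.
  have := cabs_tri (x k) (phi k (pullback j k.+1 (om (j + k.+1)))) (om k).
  have -> : 2 * dl / 2 ^+ j = 4 * dl / 2 ^+ j.+1 by rewrite exprS; field; rewrite gt_eqF.
  lra.
have xE k : x k = phi k (x k.+1).
  apply/eqP; rewrite -subr_eq0 -cabs_eq0 eq_le cabs_ge0 andbT.
  apply: (small _ (4 * dl)) => j.
  pose u := pullback j k.+1 (om (j + k.+1)%N).
  have uin : cabs (u - om k.+1) < 2 * dl by apply: pullback_in; exact: om_in.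
  have h1 := phi_contr uin (x2 k.+1).
  have := Hx k.+1 j; rewrite cabsBC -/u => h2.
  have := Hx k j.+1; rewrite addSnnS /= -/u => h3.
  have := cabs_tri (x k) (phi k u) (phi k (x k.+1)).
  have E : 4 * dl / 2 ^+ j.+1 = 4 * dl / 2 ^+ j / 2 by rewrite exprS; field; rewrite gt_eqF.
  rewrite E in h3; lra.
have xP k : cabs (x k - om k) < dl /\ f (x k) = Some (x k.+1 - c k.+1).
  by rewrite !(xE k); exact: phiP.
have xF k : Fit f c k (x 0%N) = Some (x k).
  by elim: k => //= k ->; rewrite /fn (xP k).2 /= subrK.
have xpb n k : x k = pullback n k (x (n + k)%N).
  by elim: n k => //= n IH k; rewrite {1}xE IH addnS.
exists x; split=> //; split=> //; split; last first.
  split; first by move=> n; rewrite xF.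
  exists dl; split=> // n; exists n; split=> //.
  have bin y : cabs (y - x n) < dl -> cabs (y - om n) < 2 * dl.
    by have [h _] := xP n; have := cabs_tri y (x n) (om n); lra.
  have FE y : cabs (y - x n) < dl -> Fit f c n (pullback n 0 y) = Some y.
    by move=> /bin hy; rewrite pullback_Fit// subnn.
  exists (pullback n 0 @` cball (x n) dl); split.
  - by apply: pullback_open; [exact: cball_open|move=> y /bin; rewrite addn0].
  - by exists (x n); [rewrite /cball /= subrr cabs0|have := xpb n 0%N; rewrite addn0].
  - by move=> _ [y /bin hy <-] k kn; rewrite pullback_Fit.
  - by move=> _ _ /set_mem[y yb <-] /set_mem[y' yb' <-]; rewrite !FE//= => ->.
  - rewrite xF /=; apply/seteqP; split.
      by move=> _ [_ [y yb <-] <-]; rewrite FE.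
    by move=> y yb; exists (pullback n 0 y); [exists y|rewrite FE].
move=> [r [r0 [df _]]].
have [n hn] := halves_small dl r0.
have E := xpb n 0%N; rewrite addn0 in E.
have hom : cabs (om n - om (n + 0)) < 2 * dl by rewrite addn0.
have hxn : cabs (x n - om (n + 0)) < 2 * dl by rewrite addn0.
have := pullback_contr hom hxn; rewrite -E => h1.
apply: (df (pullback n 0 (om n)) _ n.+1).
  rewrite /cball /=; apply: (le_lt_trans h1); apply: le_lt_trans hn.
  by rewrite ler_pM2r ?invr_gt0// cabsBC ltW//; exact: (xP n).1.
by rewrite /= pullback_Fit// subnn /= /fn om_pole.
Qed.

End CodedOrbit.

(** * Mass distribution on coded sets *)

Section CantorMass.
Variables (R : realType) (T : eqType).
Local Notation C := (R[i]).

Lemma seq_bound_lt1 (A : seq T) (p : T -> R) : (forall a, a \in A -> p a < 1) ->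
  exists q, [/\ 0 <= q, q < 1 & forall a, a \in A -> p a <= q].
Proof.
elim: A => [|b A IH] H; first by exists 0.
have [|q [q0 q1 Hq]] := IH; first by move=> a aA; apply: H; rewrite inE aA orbT.
exists (Num.max q (p b)); split; first by rewrite le_max q0.
  by rewrite gt_max q1 H// mem_head.
move=> a; rewrite inE => /predU1P[->|/Hq h]; rewrite le_max ?lexx ?orbT//.
by rewrite h.
Qed.

Lemma prod_le_expr (p : T -> R) q (s : seq T) :
  (forall a, a \in s -> 0 <= p a /\ p a <= q) -> \prod_(a <- s) p a <= q ^+ size s.
Proof.
elim: s => [|b s IH] H; first by rewrite big_nil expr0.
rewrite big_cons /= exprS; have [h1 h2] := H b (mem_head _ _).
have Hs a : a \in s -> 0 <= p a /\ p a <= q by move=> h; apply: H; rewrite inE h orbT.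
apply: ler_pM => //; last exact: IH.
by rewrite big_seq; apply: prodr_ge0 => a /Hs[].
Qed.

Lemma prodr_powR (g : T -> R) s (l : seq T) : (forall a, a \in l -> 0 <= g a) ->
  \prod_(a <- l) g a `^ s = (\prod_(a <- l) g a) `^ s.
Proof.
elim: l => [|b l IH] H; first by rewrite !big_nil powR1.
have Hl a : a \in l -> 0 <= g a by move=> h; apply: H; rewrite inE h orbT.
rewrite !big_cons IH// powRM//; first by apply: H; rewrite mem_head.
by rewrite big_seq; apply: prodr_ge0.
Qed.

(* The weights p a = g a ^ s / sum define a product measure on sequences; a
   covering set U meeting two coded points has diameter at least the product of
   the g along their common prefix, so it carries at most a constant times
   diam(U) ^ s of that measure. *)
Lemma cantor_hausdorff_neq0 (A : seq T) (g : T -> R) (s c1 : R) (X : (nat -> T) -> C)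
    (E : set C) : uniq A -> 0 <= s -> (forall a, a \in A -> 0 < g a) ->
  1 <= \sum_(a <- A) g a `^ s -> (1 < size A)%N -> 0 < c1 ->
  (forall w, (forall n, w n \in A) -> E (X w)) ->
  (forall w t n, (forall k, w k \in A) -> (forall k, t k \in A) ->
     (forall k, (k < n)%N -> w k = t k) -> w n <> t n ->
     c1 * \prod_(a <- mkseq w n) g a <= cabs (X w - X t)) ->
  hausdorff s E <> 0%E.
Proof.
move=> uA s0 g0 S1 sA c0 XE dist /hausdorff0P Hcov.
pose S := \sum_(a <- A) g a `^ s.
have S0 : 0 < S by exact: lt_le_trans ltr01 S1.
pose p a := g a `^ s / S.
have p0 a : a \in A -> 0 < p a by move=> /g0 h; rewrite divr_gt0// powR_gt0.
have psum : \sum_(a <- A) p a = 1 by rewrite /p -mulr_suml mulfV// gt_eqF.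
have p_lt1 a : a \in A -> p a < 1.
  move=> aA; rewrite -psum (bigD1_seq a)//= ltrDl.
  have [b [bA ba]] : exists b, b \in A /\ b != a.
    apply: contrapT => /forallNP no.
    suff : (size A <= size [:: a])%N by rewrite leqNgt sA.
    apply: uniq_leq_size => // b bA; rewrite inE; apply/negPn/negP => ba.
    by apply: (no b).
  rewrite -big_filter (bigD1_seq b) ?mem_filter ?ba ?filter_uniq//=.
  rewrite ltr_pwDl ?p0// big_seq_cond; apply: sumr_ge0 => e /andP[].
  by rewrite mem_filter => /andP[_ /p0/ltW].
have [q [q0 q1 Hq]] := seq_bound_lt1 p_lt1.
have [a0 a0A] : exists a0, a0 \in A by case: (A) sA => // a ? _; exists a; rewrite mem_head.
have v0 : 0 < c1 `^ s / 4 by rewrite divr_gt0// powR_gt0.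
have [U [EU Ud Us]] := Hcov 1 _ ltr01 v0.
pose mu (l : seq T) := \prod_(a <- l) p a.
pose inA (w : nat -> T) := forall n, w n \in A.
have ex i : exists W : seq T, [/\ {subset W <= A},
    forall w, inA w -> U i (X w) -> W = mkseq w (size W) &
    ((mu W)%:E <= (c1 `^ (- s))%:E * hterm s (U i) + (2^-1 / (2 ^ i.+1)%:R)%:E)%E].
  (* When [U i] meets at most one coding sequence its diameter gives no information; a prefix of
     length [N] then has mass within the correction term. *)
  have [N hN] : exists N, q ^+ N <= 2^-1 / (2 ^ i.+1)%:R.
    have e1 : 0 < 2^-1 / (2 ^ i.+1)%:R :> R by rewrite divr_gt0// ltr0n expn_gt0.
    have qn : `|q| < 1 by rewrite ger0_norm.
    have /cvgr_lt/(_ _ e1)[N _ HN] := cvg_expr qn.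
    by exists N; apply/ltW/HN => /=.
  have e0 : 0 <= 2^-1 / (2 ^ i.+1)%:R :> R by rewrite divr_ge0 ?invr_ge0.
  have long w : inA w -> (mu (mkseq w N) <= 2^-1 / (2 ^ i.+1)%:R).
    move=> wA; apply: le_trans hN; rewrite -{2}(size_mkseq w N); apply: prod_le_expr.
    by move=> a /mapP[k _ ->]; split; [apply/ltW/p0|exact: Hq].
  have mA w n : inA w -> {subset mkseq w n <= A} by move=> wA a /mapP[k _ ->].
  have [[w0 [w0A w0U]]|no] := pselect (exists w, inA w /\ U i (X w)); last first.
    exists (mkseq (fun=> a0) N); split; first exact: mA.
      by move=> w wA wU; exfalso; apply: no; exists w.
    apply: (@le_trans _ _ (2^-1 / (2 ^ i.+1)%:R)%:E); first by rewrite lee_fin; exact: long.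
    by rewrite leeDr// mule_ge0 ?hterm_ge0// lee_fin powR_ge0.
  have [P|nP] := pselect (exists n, exists w, [/\ inA w, U i (X w) & w n <> w0 n]); last first.
    exists (mkseq w0 N); split; first exact: mA.
      move=> w wA wU; rewrite size_mkseq; apply: eq_mkseq => k.
      by apply: contrapT => h; apply: nP; exists k, w; split=> // h'; apply: h.
    apply: (@le_trans _ _ (2^-1 / (2 ^ i.+1)%:R)%:E); first by rewrite lee_fin; exact: long.
    by rewrite leeDr// mule_ge0 ?hterm_ge0// lee_fin powR_ge0.
  (* The least such [n] is the length of the common prefix of all codes met by [U i], and a sequence
     that differs there bounds the diameter below. *)
  pose Q n := `[< exists w, [/\ inA w, U i (X w) & w n <> w0 n] >].
  have exQ : exists n, Q n by have [n h] := P; exists n; apply/asboolP.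
  have [n /asboolP[w [wA wU wn]] nmin] := ex_minnP exQ.
  have agree t k : inA t -> U i (X t) -> (k < n)%N -> t k = w0 k.
    move=> tA tU kn; apply: contrapT => h.
    have : Q k by apply/asboolP; exists t.
    by move=> /nmin; rewrite leqNgt kn.
  exists (mkseq w0 n); split; first exact: mA.
    move=> t tA tU; rewrite size_mkseq; apply/eq_in_map => k.
    by rewrite mem_iota add0n => /andP[_ kn]; rewrite agree.
  apply: (@le_trans _ _ ((c1 `^ (- s))%:E * hterm s (U i))%E); last first.
    by rewrite leeDl// lee_fin.
  have [D [D0 DE hD]] : exists D, [/\ 0 <= D, hterm s (U i) = (D `^ s)%:E &
      forall x y, U i x -> U i y -> cabs (x - y) <= D].
    have [dE d0] := cdiam_fin w0U (Ud i).
    exists (fine (cdiam (U i))); split=> //; first exact: htermE w0U.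
    by move=> x y Ux Uy; rewrite -lee_fin -dE; exact: cdiam_ge.
  have h1 : c1 * \prod_(a <- mkseq w0 n) g a <= D.
    apply: (le_trans _ (hD _ _ w0U wU)); apply: dist => // [k kn|h].
      by rewrite (agree w).
    by apply: wn.
  rewrite DE -EFinM lee_fin.
  have gm : forall a, a \in mkseq w0 n -> 0 <= g a by move=> a /(mA _ _ w0A) /g0 /ltW.
  have P0 : 0 <= \prod_(a <- mkseq w0 n) g a by rewrite big_seq; apply: prodr_ge0.
  apply: (@le_trans _ _ ((\prod_(a <- mkseq w0 n) g a) `^ s)).
    rewrite -prodr_powR// /mu [leLHS]big_seq [leRHS]big_seq.
    apply: ler_prod => a /(mA _ _ w0A) aA; rewrite (ltW (p0 _ aA)) /p /=.
    by rewrite ler_pdivrMr// ler_peMr// powR_ge0.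
  rewrite powRN mulrC ler_pdivlMr ?powR_gt0// -powRM// ?(ltW c0)//.
  apply: ge0_ler_powR => //; rewrite ?nnegrE//.
    by rewrite mulr_ge0// ltW.
  by rewrite mulrC.
have [W HW] := choice ex.
have [| | |w [wA wW]] := @tree_cover R T A p W uA _ psum.
- by move=> a /p0/ltW.
- by move=> i; have [] := HW i.
- have cs0 : (0 <= (c1 `^ (- s))%:E)%E by rewrite lee_fin powR_ge0.
  apply: le_lt_trans (_ : (4^-1 + 2^-1)%:E < 1)%E; last by rewrite lte_fin; lra.
  apply: (@le_trans _ _ (\sum_(0 <= i <oo) ((c1 `^ (- s))%:E * hterm s (U i) +
      (2^-1 / (2 ^ i.+1)%:R)%:E))%E).
    apply: lee_nneseries => [i _ _|i _]; last by have [] := HW i.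
    rewrite lee_fin big_seq; apply: prodr_ge0 => a; have [WA _ _] := HW i.
    by move=> /WA/p0/ltW.
  apply: (le_trans (epsilon_trick xpredT _ _)) => [i|//|].
    by rewrite mule_ge0 ?hterm_ge0.
  rewrite EFinD leeD2r// nneseriesZl; last by move=> i _; exact: hterm_ge0.
  apply: (le_trans (lee_wpmul2l cs0 Us)).
  by rewrite -EFinM lee_fin powRN mulrA mulVf ?mul1r// gt_eqF// powR_gt0.
have [i _ wU] := EU _ (XE w wA).
by apply: (wW i); have [_ h _] := HW i; exact: h.
Qed.

End CantorMass.

(** * Lower bound *)

Section LowerBound.
Variable R : realType.
Local Notation C := (R[i]).
Variables (f : C -> option C) (Pstar : set C) (Rdag : R) (M : nat) (beta K : R).
Hypothesis merf : meromorphic f.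
Hypothesis Pp : Pstar `<=` poles f.
Hypothesis finP : finite_set (poles f `\` Pstar).
Hypothesis Rdag0 : 0 < Rdag.
Hypothesis sep : forall a1 a2, poles f a1 -> poles f a2 -> a1 <> a2 ->
  cball a1 Rdag `&` cball a2 Rdag = set0.
Hypothesis beta0 : 0 <= beta.
Hypothesis mM : forall a, Pstar a -> (1 <= mult f a <= M)%N.
Hypothesis K1 : 1 <= K.
Hypothesis est : forall a z, Pstar a -> cball a Rdag z -> z != a ->
  [/\ K^-1 * (cabs a `^ (- beta) / cabs (z - a) ^+ mult f a) <= cabs (fv f z),
      cabs (fv f z) <= K * (cabs a `^ (- beta) / cabs (z - a) ^+ mult f a),
      K^-1 * ((mult f a)%:R * cabs a `^ (- beta) / cabs (z - a) ^+ (mult f a).+1)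
        <= cabs (cderiv (fv f) z) &
      cabs (cderiv (fv f) z)
        <= K * ((mult f a)%:R * cabs a `^ (- beta) / cabs (z - a) ^+ (mult f a).+1)].

Definition coded (c om x : nat -> C) := forall k,
  cabs (x k - om k) < Rdag / 4 /\ f (x k) = Some (x k.+1 - c k.+1).

(** With dl = Rdag / 4, [pole_univalent] is applied to w = om (k+1) - c (k+1). The constant [q1]
    secures K < |w| d^M, [q2] makes the disc of radius Rdag / 2 fit the solvable disc, and d <= Rdag
    / 8 puts the image within Rdag / 4 of [om k]. *)
Lemma coded_point : exists A0 : R, forall c, cbound c -> forall om,
  (forall k, Pstar (om k) /\ A0 <= cabs (om k)) -> exists x, [/\ coded c om x,
    (forall k, Fit f c k (x 0%N) = Some (x k)) & radial_julia f c (x 0%N)].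
Proof.
move: (Rdag0) (K1) => Rd0 k1.
have k0 : 0 < K by lra.
have e0 := eta_gt0 M K1.
have Rd8 : 0 < Rdag / 8 by lra.
have [d [d0 d1 d8]] := pos_min2 ltr01 Rd8.
have dM : 0 < d ^+ M by rewrite exprn_gt0.
have W0 : 0 < Wmin M K Rdag.
  rewrite /Wmin; have : 0 <= 2 * K * (1 + 2 / Rdag) ^+ M; last by lra.
  by rewrite !mulr_ge0 ?exprn_ge0 ?addr_ge0 ?divr_ge0// ltW.
have k2 : 0 < 4 * K ^+ 2 by rewrite mulr_gt0// exprn_gt0.
have [q1 q1E] : exists q1, q1 = K / d ^+ M by eexists.
have [q2 q2E] : exists q2, q2 = 2 * (Rdag / 4) / (eta K M / (4 * K ^+ 2)) by eexists.
have q10 : 0 < q1 by rewrite q1E divr_gt0.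
have q20 : 0 < q2 by rewrite q2E divr_gt0 ?divr_gt0//; lra.
exists (3 + Wmin M K Rdag + 4 * K ^+ 2 + q1 + q2) => c hc om hom.
have ex k : exists phi : C -> C,
   [/\ (forall y, cabs (y - om k.+1) < 2 * (Rdag / 4) ->
          cabs (phi y - om k) < Rdag / 4 /\ f (phi y) = Some (y - c k.+1)),
       (forall y y', cabs (y - om k.+1) < 2 * (Rdag / 4) ->
          cabs (y' - om k.+1) < 2 * (Rdag / 4) ->
          cabs (phi y - phi y') <= cabs (y - y') / 2) &
       (forall V, copen V -> V `<=` cball (om k.+1) (2 * (Rdag / 4)) ->
          copen (phi @` V))].
  have [Pa aA] := hom k; have [_ bA] := hom k.+1.
  have fa := Pp Pa; have /andP[m0 mM'] := mM Pa.
  have ck := hc k.+1 isT.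
  have wA := cabsB_ge (om k.+1) (c k.+1).
  have b1 : cabs (om k) `^ (- beta) <= 1 by apply: ba_le1 => //; lra.
  set w := om k.+1 - c k.+1 in wA.
  have := @pole_univalent R f (om k) (mult f (om k)) M (cabs (om k) `^ (- beta)) K Rdag
    merf fa Rdag0 (fun z => pole_isolated Rdag0 sep fa) m0 mM'
    (ba_gt0 merf Pp Rdag0 est Pa) K1 (fun z => est Pa) w (2 * (Rdag / 4)) d b1.
  case.
  - by lra.
  - by lra.
  - by rewrite d0 d1.
  - by rewrite -ltr_pdivrMr// -q1E; lra.
  - by rewrite [leRHS]mulrC -ler_pdivrMr ?divr_gt0// -q2E; lra.
  move=> phi [h1 h2 h3].
  have tr y : cabs (y - om k.+1) = cabs (y - c k.+1 - w).
    by rewrite /w; congr cabs; ring.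
  exists (fun y => phi (y - c k.+1)); split.
  - by move=> y; rewrite tr => /h1[g1 g2 g3]; split=> //; lra.
  - move=> y y'; rewrite !tr => /h2 h /h; congr (_ <= cabs _ / 2); ring.
  - move=> V oV Vs.
    have -> : (fun y => phi (y - c k.+1)) @` V = phi @` ((fun y => y - c k.+1) @` V).
      by rewrite image_comp.
    apply: h3.
      move=> _ [y Vy <-]; have [r [r0 rV]] := oV _ Vy; exists r; split=> // z.
      rewrite /cball /= => zr; exists (z + c k.+1); last by rewrite addrK.
      by apply: rV; rewrite /cball /=; move: zr; congr (cabs _ < _); ring.
    by move=> _ [y /Vs Vy <-]; rewrite /cball /= -tr.
have [phi Hphi] := choice ex.
have [|k|k y|k y y'|k V|x [h1 [h2 h3]]] := @coded_orbit R f c om phi (Rdag / 4).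
- by lra.
- by have [/Pp] := hom k.
- by have [h _ _] := Hphi k; exact: h.
- by have [_ h _] := Hphi k; exact: h.
- by have [_ _ h] := Hphi k; exact: h.
by exists x.
Qed.

Variable m : nat.
Hypothesis m0 : (0 < m)%N.
Hypothesis m_le : (m <= M)%N.

Local Notation ee := (1 + m%:R^-1).

(** The contraction attributed to one visit at [a], after the regrouping of powers of consecutive
    poles; the constant is that of [lip_const] times [lipC]. *)
Definition wt (a : C) : R := (4 * K * lipC M K)^-1 * cabs a `^ (- ((beta + m%:R + 1) / m%:R)).

Lemma lip_const (x W : R) : 0 < x -> 1 <= W ->
  (2 * W) * (K * (2 * W) / x `^ (- beta)) `^ m%:R^-1 <= 4 * K * W `^ ee * x `^ (beta / m%:R).
Proof.
move: (K1) => k1 x0 W1.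
have k0 : 0 < K by lra.
have W0 : 0 < W by lra.
have mi : m%:R^-1 <= 1 :> R by rewrite invf_le1 ?ltr0n// ler1n.
rewrite powRN invrK.
have -> : K * (2 * W) * x `^ beta = (2 * K) * W * x `^ beta by ring.
rewrite powRM ?powR_ge0//; last by rewrite mulr_ge0 ?mulr_ge0// ltW.
rewrite powRM ?(ltW W0)//; last by rewrite mulr_ge0// ltW.
rewrite -powRrM powRD; last by rewrite gt_eqF//.
rewrite powRr1 ?(ltW W0)//.
have h : (2 * K) `^ m%:R^-1 <= 2 * K.
  by rewrite -[leRHS]powRr1; [rewrite ler_powR//; lra|lra].
have a0 := powR_ge0 W m%:R^-1; have b0 := powR_ge0 x (beta / m%:R).
have -> : 2 * W * ((2 * K) `^ m%:R^-1 * W `^ m%:R^-1 * x `^ (beta / m%:R)) =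
  2 * W * (2 * K) `^ m%:R^-1 * W `^ m%:R^-1 * x `^ (beta / m%:R) by ring.
have -> : 4 * K * (W * W `^ m%:R^-1) * x `^ (beta / m%:R) =
  2 * W * (2 * K) * W `^ m%:R^-1 * x `^ (beta / m%:R) by ring.
rewrite ler_wpM2r// ler_wpM2r// ler_wpM2l//; lra.
Qed.

(** Since (beta + m + 1) / m = beta / m + (1 + 1/m), multiplying the Lipschitz bound by [wt a]
    leaves (W / |a|)^(1+1/m). With [W] the modulus of the next pole this telescopes along an
    orbit. *)
Lemma coded_lip a x y W : Pstar a -> mult f a = m -> x != a -> y != a ->
  cabs (x - a) <= Rdag / 2 -> cabs (y - a) <= Rdag / 2 -> 0 < cabs a -> 1 <= W ->
  cabs (fv f x) <= 2 * W -> cabs (fv f y) <= 2 * W ->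
  cabs (fv f x - fv f y) * wt a <= W `^ ee * cabs a `^ (- ee) * cabs (x - y).
Proof.
move: (Rdag0) (K1) => Rd0 k1 Pa am xa ya xR yR a0 W1 Wx Wy.
have k0 : 0 < K by lra.
have L0 := lipC_gt0 M K1.
have W0 : 0 < 2 * W by lra.
have fa := Pp Pa.
have est' z := @est a z Pa; rewrite am in est'.
have h := @pole_lipschitz R f a m M (cabs a `^ (- beta)) K Rdag
    merf Rdag0 (fun z => pole_isolated Rdag0 sep fa) m0 m_le
    (ba_gt0 merf Pp Rdag0 est Pa) K1 est' x y (2 * W) xa ya xR yR W0 Wx Wy.
have h2 := lip_const a0 W1.
have w0 : 0 <= wt a by rewrite /wt mulr_ge0 ?powR_ge0// invr_ge0 !mulr_ge0// ltW.
apply: (le_trans (ler_wpM2r w0 h)).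
rewrite -[lipC _ _ * _ * _]mulrA.
apply: (@le_trans _ _ (lipC M K * (4 * K * W `^ ee * cabs a `^ (beta / m%:R)) * cabs (x - y) * wt a)).
  by apply: ler_wpM2r => //; apply: ler_wpM2r; [exact: cabs_ge0|apply: ler_wpM2l => //; exact: ltW].
rewrite /wt.
have mn : m%:R != 0 :> R by rewrite pnatr_eq0 -lt0n.
have -> : - ((beta + m%:R + 1) / m%:R) = - (beta / m%:R) + - ee by field.
rewrite (@powRD _ (cabs a)); last by rewrite (gt_eqF a0) implybT.
rewrite le_eqVlt; apply/orP; left; apply/eqP.
rewrite [cabs a `^ (- (beta / m%:R))]powRN.
have b0 : cabs a `^ (beta / m%:R) != 0 by rewrite gt_eqF// powR_gt0.
by field; rewrite b0 !gt_eqF.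
Qed.

Variable Amax : R.
Definition alph (a : C) :=
  [/\ Pstar a, mult f a = m, 1 + Rdag / 4 <= cabs a & cabs a <= Amax].

Lemma coded_neq c om x k : (forall k, alph (om k)) -> coded c om x -> x k != om k.
Proof.
move=> ha hx; apply/eqP => E; have [_] := hx k; rewrite E.
by have [/Pp -> _ _ _] := ha k.
Qed.

(** When the codes first differ, the points are Rdag / 2 apart. Pulling this back along the common
    prefix loses the weights and one end factor, at most Amax^(1+1/m) <= Amax^2. *)
Lemma coded_dist n c om ta x y : cbound c -> (forall k, alph (om k)) ->
  (forall k, alph (ta k)) -> coded c om x -> coded c ta y ->
  (forall k, (k < n)%N -> om k = ta k) -> om n <> ta n ->
  Rdag / (2 * Amax ^+ 2) * \prod_(a <- mkseq om n) wt a <= cabs (x 0%N - y 0%N).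
Proof.
move: (Rdag0) (K1) => Rd0 k1 hc ha hb hx hy agr dif.
have A1 : 1 <= Amax by have [_ _ h1 h2] := ha 0%N; lra.
have A0 : 0 < Amax by lra.
have wt0 a : 0 <= wt a.
  have L0 := lipC_gt0 M K1; have k0 : 0 < K by lra.
  by rewrite /wt mulr_ge0 ?powR_ge0// invr_ge0 !mulr_ge0// ltW.
have sepa k (x' y' om' ta' : nat -> C) : (forall k, alph (om' k)) ->
    (forall k, alph (ta' k)) -> cabs (x' k - om' k) < Rdag / 4 ->
    cabs (y' k - ta' k) < Rdag / 4 -> om' k <> ta' k -> Rdag / 2 <= cabs (x' k - y' k).
  move=> ha' hb' h1 h2 ne; have [Pa _ _ _] := ha' k; have [Pb _ _ _] := hb' k.
  have : Rdag <= cabs (ta' k - om' k).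
    rewrite leNgt; apply/negP => h.
    by apply: (pole_isolated Rdag0 sep (Pp Pa) h) (Pp Pb); apply/eqP => E; apply: ne.
  have := cabs_tri (ta' k) (y' k) (om' k); have := cabs_tri (y' k) (x' k) (om' k).
  by rewrite (cabsBC (ta' k) (y' k)) (cabsBC (y' k) (x' k)); lra.
have im : m%:R^-1 <= 1 :> R by rewrite invf_le1 ?ltr0n// ler1n.
have im0 : 0 <= m%:R^-1 :> R by rewrite invr_ge0.
pose c1 := Rdag / (2 * Amax ^+ 2).
have c10 : 0 < c1 by rewrite /c1 divr_gt0// mulr_gt0// exprn_gt0.
have main : (0 < n)%N -> c1 * cabs (om 0%N) `^ ee * \prod_(a <- mkseq om n) wt a <=
    cabs (x 0%N - y 0%N).
  elim: n c om ta x y hc ha hb hx hy agr dif => // n IH c om ta x y hc ha hb hx hy agr dif _.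
  have om0 : om 0%N = ta 0%N by exact: agr.
  have [Pa am a1 a2] := ha 0%N; have [_ _ b1 b2] := ha 1%N; have [_ _ d1 d2] := hb 1%N.
  have [xo fx] := hx 0%N; have [yo fy] := hy 0%N.
  have [xo1 _] := hx 1%N; have [yo1 _] := hy 1%N.
  rewrite -om0 in yo.
  have xn := coded_neq 0 ha hx; have yn := coded_neq 0 hb hy; rewrite -om0 in yn.
  have ap : 0 < cabs (om 0%N) by lra.
  have c1' := hc 1%N isT.
  have xv : cabs (fv f (x 0%N)) <= 2 * cabs (om 1%N).
    rewrite (fv_some fx); have := cabsB_le (x 1%N) (c 1%N).
    by have := cabs_tri (x 1%N) (om 1%N) 0; rewrite !subr0; lra.
  have yv : cabs (fv f (y 0%N)) <= 2 * cabs (ta 1%N).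
    rewrite (fv_some fy); have := cabsB_le (y 1%N) (c 1%N).
    by have := cabs_tri (y 1%N) (ta 1%N) 0; rewrite !subr0; lra.
  have fxy : fv f (x 0%N) - fv f (y 0%N) = x 1%N - y 1%N.
    by rewrite (fv_some fx) (fv_some fy); ring.
  have step W : 1 <= W -> cabs (om 1%N) <= W -> cabs (ta 1%N) <= W ->
      cabs (om 0%N) `^ ee * wt (om 0%N) * (cabs (x 1%N - y 1%N) / W `^ ee) <=
      cabs (x 0%N - y 0%N).
    move=> W1 oW tW.
    have := @coded_lip (om 0%N) (x 0%N) (y 0%N) W Pa am xn yn.
    rewrite fxy => H.
    have {}H : cabs (x 1%N - y 1%N) * wt (om 0%N) <=
        W `^ ee * cabs (om 0%N) `^ (- ee) * cabs (x 0%N - y 0%N) by apply: H => //; lra.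
    have We : 0 < W `^ ee by rewrite powR_gt0//; lra.
    have ae : 0 < cabs (om 0%N) `^ ee by rewrite powR_gt0.
    rewrite powRN in H.
    have -> : cabs (om 0%N) `^ ee * wt (om 0%N) * (cabs (x 1%N - y 1%N) / W `^ ee) =
      (cabs (x 1%N - y 1%N) * wt (om 0%N)) * (cabs (om 0%N) `^ ee / W `^ ee) by ring.
    apply: (le_trans (ler_wpM2r _ H)); first by rewrite divr_ge0// ltW.
    by rewrite le_eqVlt; apply/orP; left; apply/eqP; field; rewrite !gt_eqF.
  have mk : mkseq om n.+1 = om 0%N :: mkseq (fun k => om k.+1) n.
    by rewrite /mkseq /= -[1%N]addn0 iotaDl -map_comp.
  have ae0 : 0 <= cabs (om 0%N) `^ ee * wt (om 0%N) by rewrite mulr_ge0 ?powR_ge0.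
  rewrite mk big_cons.
  (* At the last common letter the next poles differ, so [W] must dominate both and is taken as
     [Amax]; before it they agree and [W] is their modulus. *)
  case: n IH agr dif mk => [|n] IH agr dif mk.
    rewrite /mkseq /= big_nil mulr1.
    apply: (le_trans _ (step Amax A1 b2 d2)).
    have -> : c1 * cabs (om 0%N) `^ ee * wt (om 0%N) =
      cabs (om 0%N) `^ ee * wt (om 0%N) * c1 by ring.
    apply: ler_wpM2l => //.
    have Ae : 0 < Amax `^ ee by rewrite powR_gt0.
    rewrite ler_pdivlMr//.
    have h1 := sepa 1%N x y om ta ha hb xo1 yo1 dif.
    apply: le_trans h1; rewrite /c1.
    have : Amax `^ ee <= Amax ^+ 2 by rewrite -powR_mulrn ?(ltW A0)// ler_powR//; lra.
    have A20 : 0 < Amax ^+ 2 by rewrite exprn_gt0.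
    move=> h3; have -> : Rdag / (2 * Amax ^+ 2) * Amax `^ ee = Rdag / 2 * (Amax `^ ee / Amax ^+ 2).
      by field; rewrite gt_eqF.
    by rewrite ler_piMr//; [lra|rewrite ler_pdivrMr// mul1r].
  have o1 : om 1%N = ta 1%N by exact: agr.
  have := IH (fun k => c k.+1) (fun k => om k.+1) (fun k => ta k.+1)
    (fun k => x k.+1) (fun k => y k.+1).
  move=> {}IH.
  have {}IH : c1 * cabs (om 1%N) `^ ee * \prod_(a <- mkseq (fun k => om k.+1) n.+1) wt a <=
      cabs (x 1%N - y 1%N).
    by apply: IH => // k ?; [exact: hc|exact: agr].
  have W1 : 1 <= cabs (om 1%N) by lra.
  have t1 : cabs (ta 1%N) <= cabs (om 1%N) by rewrite o1.
  apply: (le_trans _ (step _ W1 (lexx _) t1)).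
  have We : 0 < cabs (om 1%N) `^ ee by rewrite powR_gt0//; lra.
  set P := \prod_(a <- _) _ in IH *.
  have -> : c1 * cabs (om 0%N) `^ ee * (wt (om 0%N) * P) =
    cabs (om 0%N) `^ ee * wt (om 0%N) * (c1 * P) by ring.
  apply: ler_wpM2l => //; rewrite ler_pdivlMr//; apply: le_trans IH.
  by rewrite le_eqVlt; apply/orP; left; apply/eqP; ring.
case: n main agr dif => [_ _|n main _ _].
  move=> dif; rewrite /mkseq /= big_nil mulr1.
  apply: (le_trans _ (sepa 0%N x y om ta ha hb (hx 0%N).1 (hy 0%N).1 dif)).
  rewrite invfM mulrA ler_piMr//; first by lra.
  by rewrite invf_le1 ?exprn_gt0// exprn_ege1.
apply: (le_trans _ (main isT)); rewrite -/c1; apply: ler_wpM2r.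
  by apply: prodr_ge0.
rewrite ler_peMr ?(ltW c10)//; have [_ _ h1 _] := ha 0%N.
rewrite -[leLHS](powRr0 (cabs (om 0%N))); apply: ler_powR; lra.
Qed.

End LowerBound.

Lemma esum_infty_seq (R : realType) (T : choiceType) (S F : set T) (h : T -> R) (v : R) :
  (forall a, 0 <= h a) -> (\esum_(a in S) (h a)%:E = +oo)%E -> finite_set F ->
  exists A : seq T, [/\ uniq A, forall a, a \in A -> S a /\ ~ F a &
    v < \sum_(a <- A) h a].
Proof.
move=> h0 Soo finF.
have h0E a : (0 <= (h a)%:E)%E by rewrite lee_fin.
have FI : finite_set (S `&` F) by apply: sub_finite_set finF => x [].
have SF : (\esum_(a in S `&` ~` F) (h a)%:E = +oo)%E.
  have := Soo; rewrite (esumID F)//.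
  rewrite (esum_fset FI)// fsbig_finite// sumEFin.
  by case: (\esum_(i in _) _)%E.
have [A [[finA AS] hA]] : exists A, fsets (S `&` ~` F) A /\
    (v%:E < \sum_(x \in A) (h x)%:E)%E.
  apply: contrapT => /forallNP no.
  suff : (\esum_(a in S `&` ~` F) (h a)%:E <= v%:E)%E by rewrite SF.
  apply: ge_ereal_sup => _ [A fA <-]; rewrite leNgt; apply/negP => lt.
  by apply: (no A).
exists (fset_set A); split; first exact: fset_uniq.
  by move=> a; rewrite in_fset_set// inE => /AS[].
by move: hA; rewrite fsbig_finite// sumEFin lte_fin.
Qed.

(** Existence of the limit gives content to [lim], which otherwise would be a default value.
    Freezing [g] below [r1] makes the monotonicity global. *)
Lemma cvg_nonincreasing_ge0 (R : realType) (g : R -> R) (r1 : R) :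
  (forall r r', r1 <= r -> r <= r' -> g r' <= g r) -> (forall r, 0 <= g r) ->
  cvg (g r @[r --> +oo]).
Proof.
move=> mono g0; pose h r := - g (Num.max r1 r).
have hm : {homo h : n m / n <= m}.
  move=> r r' rr; rewrite /h lerN2; apply: mono; first by rewrite le_max lexx.
  by rewrite ge_max !le_max lexx rr orbT.
have hb : has_ubound (range h) by exists 0 => _ [r _ <-]; rewrite oppr_le0.
have hc := nondecreasing_cvgr hm hb.
apply/cvg_ex; exists (- sup (range h)); apply: cvg_trans (cvgN hc).
apply: near_eq_cvg; near=> r; rewrite /h /= opprK max_r; first by [].
by near: r; apply: nbhs_pinfty_ge; exact: num_real.
Unshelve. all: by end_near. Qed.

Section RadialLowerBound.
Variable R : realType.
Local Notation C := (R[i]).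
Variables (f : C -> option C) (Pstar : set C) (Rdag : R) (M : nat) (beta K : R).
Hypothesis merf : meromorphic f.
Hypothesis Pp : Pstar `<=` poles f.
Hypothesis finP : finite_set (poles f `\` Pstar).
Hypothesis Rdag0 : 0 < Rdag.
Hypothesis sep : forall a1 a2, poles f a1 -> poles f a2 -> a1 <> a2 ->
  cball a1 Rdag `&` cball a2 Rdag = set0.
Hypothesis beta0 : 0 <= beta.
Hypothesis mM : forall a, Pstar a -> (1 <= mult f a <= M)%N.
Hypothesis K1 : 1 <= K.
Hypothesis est : forall a z, Pstar a -> cball a Rdag z -> z != a ->
  [/\ K^-1 * (cabs a `^ (- beta) / cabs (z - a) ^+ mult f a) <= cabs (fv f z),
      cabs (fv f z) <= K * (cabs a `^ (- beta) / cabs (z - a) ^+ mult f a),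
      K^-1 * ((mult f a)%:R * cabs a `^ (- beta) / cabs (z - a) ^+ (mult f a).+1)
        <= cabs (cderiv (fv f) z) &
      cabs (cderiv (fv f) z)
        <= K * ((mult f a)%:R * cabs a `^ (- beta) / cabs (z - a) ^+ (mult f a).+1)].

Variables (rho : R) (m : nat).
Hypothesis m0 : (0 < m)%N.
Hypothesis m_le : (m <= M)%N.
Hypothesis class : forall t, t < rho ->
  (\esum_(a in [set a | f a = None /\ mult f a = m]) (cabs a `^ (- t))%:E = +oo)%E.

(** The exponent [th] is less than [rho] exactly because of the bound on [s], so the sum of
    |a|^(-th) diverges. Discarding the finitely many poles below [B] still leaves a finite alphabet
    whose weights have s-th powers summing to at least 1. *)
Lemma radial_neq0 c s r : cbound c -> 0 <= s -> s < rho * m%:R / (beta + m%:R + 1) ->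
  hausdorff s (escaping_part (radial_julia f c) f c r) <> 0%E.
Proof.
move: (Rdag0) (K1) (beta0) => Rd0 k1 be0 hc s0 sr.
have k0 : 0 < K by lra.
have mp : 0 < m%:R :> R by rewrite ltr0n.
have [A0 HA0] := coded_point merf Pp Rdag0 sep beta0 mM K1 est.
have [B [B1 B2 B3]] : exists B, [/\ A0 <= B, 1 + Rdag / 4 <= B & r + Rdag / 4 <= B].
  exists (`|A0| + (1 + Rdag / 4) + `|r|).
  by have := ler_norm A0; have := ler_norm r; have := normr_ge0 A0; have := normr_ge0 r;
     split; lra.
pose th := s * ((beta + m%:R + 1) / m%:R).
have g0 : 0 < (beta + m%:R + 1) / m%:R by rewrite divr_gt0//; lra.
have th_rho : th < rho.
  rewrite /th mulrA ltr_pdivrMr//; move: sr; rewrite ltr_pdivlMr//; lra.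
have th0 : 0 <= th by rewrite mulr_ge0// ltW.
have [k kE] : exists k, k = (4 * K * lipC M K)^-1 by eexists.
have k_gt0 : 0 < k by rewrite kE invr_gt0 !mulr_gt0// lipC_gt0.
pose F := (poles f `\` Pstar) `|` [set a | f a = None /\ cabs a <= B].
have finF : finite_set F by rewrite finite_setU; split=> //; exact: poles_finite.
have [A [uA HA Av]] := esum_infty_seq ((k `^ s)^-1 + 1) (fun a => powR_ge0 _ _)
  (class th_rho) finF.
have HA' a : a \in A -> [/\ Pstar a, mult f a = m & B <= cabs a].
  move=> /HA[[fa am] nF]; split=> //.
    by apply: contrapT => nP; apply: nF; left.
  by rewrite leNgt; apply/negP => /ltW h; apply: nF; right.
pose Amax := \sum_(a <- A) cabs a.
have alphA a : a \in A -> alph f Pstar Rdag m Amax a.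
  move=> aA; have [Pa am aB] := HA' a aA; split=> //; first by lra.
  rewrite /Amax (bigD1_seq a)//= lerDl sumr_ge0// => *; exact: cabs_ge0.
have ex (w : nat -> C) : exists x : nat -> C, (forall n, w n \in A) ->
    [/\ coded f Rdag c w x, (forall k, Fit f c k (x 0%N) = Some (x k)) &
     radial_julia f c (x 0%N)].
  have [wA|nw] := pselect (forall n, w n \in A); last by exists w.
  have [|x hx] := HA0 c hc w; last by exists x.
  by move=> n; have [Pa _ aB] := HA' _ (wA n); split=> //; lra.
have [X HX] := choice ex.
have ks0 : 0 < k `^ s by rewrite powR_gt0.
apply: (@cantor_hausdorff_neq0 R _ A (wt M beta K m) s (Rdag / (2 * Amax ^+ 2))
  (fun w => X w 0%N)) => //.
- move=> a /HA'[_ _ aB]; rewrite /wt -kE mulr_gt0// powR_gt0//; lra.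
- rewrite (eq_bigr (fun a => k `^ s * cabs a `^ (- th))) => [|a _].
    rewrite -mulr_sumr mulrC -ler_pdivrMr// mul1r; lra.
  rewrite /wt -kE powRM ?powR_ge0 ?(ltW k_gt0)// -powRrM; congr (_ * _ `^ _).
  by rewrite /th; ring.
- have : \sum_(a <- A) cabs a `^ (- th) <= (size A)%:R.
    rewrite -sum1_size natr_sum big_seq [leRHS]big_seq; apply: ler_sum => a /HA'[_ _ aB].
    by rewrite -[leRHS](powRr0 (cabs a)); apply: ler_powR; [lra|rewrite oppr_le0].
  have : 0 < (k `^ s)^-1 by rewrite invr_gt0.
  by rewrite -(@ltr_nat R); lra.
- have [a aA] : exists a, a \in A.
    case: (A) Av => [|a l] ; last by exists a; rewrite mem_head.
    rewrite big_nil; have : 0 < (k `^ s)^-1 by rewrite invr_gt0.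
    lra.
  have [_ _ a1 a2] := alphA a aA.
  by rewrite divr_gt0// mulr_gt0// exprn_gt0//; lra.
- move=> w wA; have [cx xF xr] := HX w wA; split=> // n _.
  exists (X w n); split; first exact: xF.
  have [h _] := cx n; have [_ _ wB] := HA' _ (wA n).
  by have := cabsB_ge (w n) (w n - X w n); rewrite subKr (cabsBC (w n)); lra.
- move=> w t n wA tA agr dif.
  have [cx _ _] := HX w wA; have [cy _ _] := HX t tA.
  apply: (coded_dist merf Pp Rdag0 sep K1 est m0 m_le hc _ _ cx cy) => // j; exact: alphA.
Qed.

End RadialLowerBound.

Theorem theorem6p4 (R : realType) (f0 : R[i] -> option R[i]) (rho : R)
    (Pstar : set R[i]) (Rstar Rdag : R) (M : nat) (beta : R) :
  (* f0 : C -> C^ transcendental meromorphic of finite order rho > 0 *)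
  meromorphic f0 -> transcendental f0 -> has_order f0 rho -> 0 < rho ->
  (* (KU1) infinity is not an asymptotic value of f0 *)
  ~ inf_asymptotic_value f0 ->
  (* (KU2) *)
  Pstar `<=` poles f0 -> finite_set (poles f0 `\` Pstar) -> 0 < Rstar ->
  (forall a, Pstar a -> ((2 * Rstar)%:E < dist_to (sing_vals f0) a)%E) ->
  (* (KU3) *)
  0 < Rdag ->
  (forall a1 a2, poles f0 a1 -> poles f0 a2 -> a1 <> a2 ->
     cball a1 Rdag `&` cball a2 Rdag = set0) ->
  (* (KU4) *)
  0 <= beta ->
  (forall a, Pstar a -> (1 <= mult f0 a <= M)%N) ->
  (exists K : R, 1 <= K /\
     forall a z, Pstar a -> cball a Rdag z -> z != a ->
       [/\ K^-1 * (cabs a `^ (- beta) / cabs (z - a) ^+ mult f0 a) <= cabs (fv f0 z),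
           cabs (fv f0 z) <= K * (cabs a `^ (- beta) / cabs (z - a) ^+ mult f0 a),
           K^-1 * ((mult f0 a)%:R * cabs a `^ (- beta) / cabs (z - a) ^+ (mult f0 a).+1)
             <= cabs (cderiv (fv f0) z) &
           cabs (cderiv (fv f0) z)
             <= K * ((mult f0 a)%:R * cabs a `^ (- beta) / cabs (z - a) ^+ (mult f0 a).+1)]) ->
  exists eps : R, 0 < eps /\
    forall c : nat -> R[i], (forall n, (0 < n)%N -> cabs (c n) < eps) ->
      [/\ (forall Ms : nat, is_Mstar f0 rho M Ms ->
             rho * Ms%:R / (beta + Ms%:R + 1) <= EHD f0 c),
          EHD f0 c <= ED f0 c &
          ED f0 c <= rho * M%:R / (beta + M%:R + 1)].
Proof.
move=> merf tranf ho rho0 noinf Pp finP _ _ Rdag0 sep beta0 mM [K [K1 est]].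
exists 1; split; [exact: ltr01|move=> c hc].
have null t := @escaping_null R f0 Pstar Rdag M beta K merf Pp finP Rdag0 sep beta0 mM K1 est
  tranf noinf rho ho rho0 t.
have den0 (n : nat) : 0 < beta + n%:R + 1 by have : 0 <= n%:R :> R := ler0n _ _; lra.
set T := rho * M%:R / (beta + M%:R + 1) in null *.
have T0 : 0 <= T by rewrite divr_ge0 ?mulr_ge0 ?(ltW rho0) ?(ltW (den0 M)).
(* Any exponent above [T] would do: it keeps the infima defining [HD] over nonempty sets, which
   monotonicity in the set requires. *)
have [|r1 Hr1] := null (T + 1); first by lra.
have T10 : 0 <= T + 1 by lra.
have cv S : cvg (HD (escaping_part S f0 c r) @[r --> +oo]).
  apply: (@cvg_nonincreasing_ge0 _ _ r1) => [r r' rr rr'|r]; last exact: HD_ge0.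
  apply: (HD_mono T10 (Hr1 r rr c hc S)) => z [Sz h]; split=> // n n0.
  by have [w [-> rw]] := h n n0; exists w; split=> //; exact: le_lt_trans rw.
have evt (Q : R -> Prop) r2 : (forall r, r2 <= r -> Q r) -> \forall r \near +oo, Q r.
  by move=> H; exists r2; split; [exact: num_real|move=> r /ltW; exact: H].
split.
- move=> Ms [/andP[Ms0 MsM] [_ class] _]; apply: limr_ge; first exact: cv.
  apply: (evt _ r1) => r rr.
  apply: (HD_ge T10 (Hr1 r rr c hc _)) => s s0 sT.
  exact: (radial_neq0 merf Pp finP Rdag0 sep beta0 mM K1 est Ms0 MsM class).
- apply: ler_lim; [exact: cv|exact: cv|].
  apply: (evt _ r1) => r rr.
  by apply: (HD_mono T10 (Hr1 r rr c hc _)) => z [[Jz _] h].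
(* The radius beyond which the escaping set is null depends on the exponent, so [T] is reached only
   through [T + e]. *)
apply/ler_addgt0Pr => e e0; apply: limr_le; first exact: cv.
have [|r2 Hr2] := null (T + e); first by lra.
by apply: (evt _ r2) => r rr; apply: HD_le; [lra|exact: Hr2].
Qed.
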